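(* Let $k$ be a field, $Q$ a finite quiver, $R=kQ$, and let $J$ be the ideal of $R$ generated by the arrows. Let $I\subseteq J^2$ be a two-sided ideal generated by length-homogeneous elements such that $\Lambda=R/I$ is a Koszul algebra, and let $M$ be a linear right $\Lambda$-module. Suppose that the start of a minimal projective linear resolution $$\coprod_{i=1}^{t_1}w_i\Lambda\to\coprod_{i=1}^{t_0}v_i\Lambda\to M\to0$$ is given, where the $v_i$ and $w_i$ are vertices of $Q$ and $t_0,t_1$ are positive integers. Let $>$ be an admissible order on the paths of $Q$. (a) There exists a projective presentation $$0\to\Big(\coprod_{i=1}^{t_1}f^1_iR\Big)\amalg\Big(\coprod_{j\in U_1}{f^1_j}'R\Big)\xrightarrow{H^1}\coprod_{i=1}^{t_0}f^0_iR\xrightarrow{\pi}M\to0$$ of $M$ as a right $R$-module, with $H^1$ the inclusion, where the $f^0_i$ are vertices, the sets $\{f^1_i\}_{i=1}^{t_1}$ and $\{{f^1_j}'\}_{j\in U_1}$ are (each) right uniform and right tip-reduced and contained in $\coprod_{i=1}^{t_0}f^0_iR$, and they can be chosen such that every coordinate of each $f^1_i$ as an element of $\coprod_{i=1}^{t_0}f^0_iR$ is a sum of elements of length $1$ in $R$ (a $k$-linear combination of arrows) and each ${f^1_j}'$ is in $\coprod_{i=1}^{t_0}f^0_iI$. (b) There is an algorithm to construct a finite set of elements $\{f^2_i\}_{i\in T_2}$ in $\coprod_{i=1}^{t_1}f^1_iR$, with $f^2_i=\sum_{l=1}^{t_1}f^1_lr_l$ for some linear elements $r_l$ of $R$ (depending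 on $i$; $k$-linear combinations of arrows), such that $$\coprod_{i\in T_2}f^2_iR\Big/\coprod_{i\in T_2}f^2_iI\xrightarrow{e^2}\coprod_{i=1}^{t_1}f^1_iR\Big/\coprod_{i=1}^{t_1}f^1_iI\to\Omega^1_\Lambda(M)\to0$$ is the start of a minimal projective linear resolution of $\Omega^1_\Lambda(M)$, where $\Omega^1_\Lambda(M)=\operatorname{Ker}(\coprod_{i=1}^{t_0}v_i\Lambda\to M)$ and $e^2$ is induced by the inclusion $\coprod_{i\in T_2}f^2_iR\hookrightarrow\coprod_{i=1}^{t_1}f^1_iR$.
   Context: Path algebra. $Q_0$ is the vertex set of $Q$; $\mathcal B$ is the set of finite directed paths (vertices are paths of length $0$) and is a $k$-basis of $R=kQ$; $pq$ is the concatenation ($p$ followed by $q$) if the terminus of $p$ is the origin of $q$, and $0$ otherwise. $R$ is graded by path length, and this induces a grading $\Lambda=\Lambda_0\amalg\Lambda_1\amalg\cdots$ with graded radical $\mathfrak r=\coprod_{i\ge1}\Lambda_i$. A nonzero element $x$ of a right $R$-module is right uniform if $x=xv$ for some $v\in Q_0$. Linear modules and Koszul algebras. A graded right $\Lambda$-module $M$ with $M_n=0$ for $n\ll0$ has a minimal graded projective resolution $(\mathbb L,e)$, minimal meaning $e^n(L^n)\subseteq L^{n-1}\mathfrak r$ for all $n\ge1$. The resolution $(\mathbb L,e)$ is linear, and $M$ is a linear module, if for each $n\ge0$ the graded module $L^n$ is finitely generated in degree $n$. $\Lambda$ is a Koszul algebra if $\Lambda_0$ is a linear right $\Lambda$-module.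 The start of a minimal projective linear resolution of $M$ means the part $L^1\to L^0\to M\to0$ of such a resolution (for $\Omega^1_\Lambda(M)$, which is generated in degree $1$, this is understood after shifting degrees by $1$). Admissible order: a well-order $>$ on $\mathcal B$ such that $p>q$ implies $pr>qr$ whenever $pr,qr\neq0$, and $rp>rq$ whenever $rp,rq\ne 0$; and $p=qr$ (all paths) implies $p\ge q$ and $p\ge r$. Tips. For vertices $f^0_i$, $\coprod_{i=1}^{t_0}f^0_iR$ has $k$-basis the elements $\varepsilon_ip$ ($p$ a path with origin $f^0_i$, placed in coordinate $i$), ordered by $\varepsilon_ip>\varepsilon_jq$ iff $p>q$, or $p=q$ and $i>j$ (for a fixed order on $\{1,\dots,t_0\}$). The tip of a nonzero element is the largest basis element occurring in it. $\varepsilon_ip$ left divides $\varepsilon_jq$ iff $i=j$ and $q=ps$ for some path $s$. A set of nonzero right uniform elements is right tip-reduced if no tip of an element left divides the tip of a different element. $f_iI$ denotes $\{f_ir:r\in I\}$. Algorithm. ''Algorithm'' means a finitely terminating procedure in which arithmetic and equality tests in $k$ and concatenation and comparison (with respect to $>$) of paths are elementary operations; the input is $Q$, a finite set of homogeneous degree-$2$ generators of $I$, and the matrix of $\coprod_{i=1}^{t_1} w_i\Lambda\to\coprod_{i=1}^{t_0} v_i\Lambda$. The Gröbner basis of $I$ is not assumed finite. *)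

(* Defs.v *)
From HB Require Import structures.
From mathcomp Require Import all_boot all_order all_algebra.
From mathcomp Require Import finmap.
From mathcomp.multinomials Require Import monalg.
From mathcomp.classical Require Import boolp.
Set Implicit Arguments.
Unset Strict Implicit.
Unset Printing Implicit Defensive.
Import GRing.Theory.
Local Open Scope ring_scope.

Record quiver := Quiver {
  vertex :> finType;
  arrow : finType;
  src : arrow -> vertex;
  tgt : arrow -> vertex }.
Arguments src {q}.
Arguments tgt {q}.

Section Paths.
Variable Q : quiver.

Fixpoint is_walk (u : Q) (s : seq (arrow Q)) : bool :=
  if s is a :: s' then (src a == u) && is_walk (tgt a) s' else true.

(* A path is an origin together with a composable sequence of arrows; the
   paths of length 0 are the vertices. *)
Record qpath := QPath {
  path_val :> Q * seq (arrow Q);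
  _ : is_walk path_val.1 path_val.2 }.

HB.instance Definition _ := [isSub for path_val].
HB.instance Definition _ := [Choice of qpath by <:].

Definition orig (p : qpath) : Q := (path_val p).1.
Definition arrows (p : qpath) : seq (arrow Q) := (path_val p).2.
Definition terminus (p : qpath) : Q := last (orig p) (map tgt (arrows p)).
Definition plen (p : qpath) : nat := size (arrows p).

Definition vertex_path (u : Q) : qpath := @QPath (u, [::]) isT.

Lemma arrow_path_subproof (a : arrow Q) : is_walk (src a) [:: a].
Proof. by rewrite /= eqxx. Qed.
Definition arrow_path (a : arrow Q) : qpath :=
  @QPath (src a, [:: a]) (arrow_path_subproof a).

Lemma is_walk_cat u s1 s2 :
  is_walk u (s1 ++ s2) = is_walk u s1 && is_walk (last u (map tgt s1)) s2.
Proof. by elim: s1 u => //= a s1 IH u; rewrite IH andbA. Qed.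

(* p followed by q; None stands for the product 0. *)
Definition pcat (p q : qpath) : option qpath :=
  if terminus p == orig q then insub (orig p, arrows p ++ arrows q) else None.

Lemma pcatE p q r : pcat p q = Some r <->
  terminus p = orig q /\ path_val r = (orig p, arrows p ++ arrows q).
Proof.
rewrite /pcat; case: eqP => [e|ne]; last by split=> // -[].
case: insubP => [x _ vx|/negP[]]; last first.
  case: p q e => -[u s] /= hs [[u' s'] hs'] /= e.
  by rewrite is_walk_cat hs /=; move: e; rewrite /terminus /orig /= => ->.
split=> [[<-]|[_ hr]]; first by split.
by congr Some; apply: val_inj; rewrite /= vx hr.
Qed.

Lemma pcat_None p q : (pcat p q = None) <-> terminus p <> orig q.
Proof.
rewrite /pcat; case: eqP => [e|ne]; last by split.
case: insubP => [x _ vx|/negP[]]; first by split.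
case: p q e => -[u s] /= hs [[u' s'] hs'] /= e.
by rewrite is_walk_cat hs /=; move: e; rewrite /terminus /orig /= => ->.
Qed.

Lemma pcatA p q r :
  obind (pcat p) (pcat q r) = obind (pcat^~ r) (pcat p q).
Proof.
have termE x y z : pcat x y = Some z -> orig z = orig x /\ terminus z = terminus y.
  move=> /pcatE[e ez]; rewrite /terminus /orig /arrows ez; split=> //=.
  rewrite map_cat last_cat; move: e; rewrite /terminus => ->; done.
case qr: (pcat q r) => [x|] /=; case pq: (pcat p q) => [y|] //=.
- have [ox _] := termE _ _ _ qr; have [_ ty] := termE _ _ _ pq.
  move/pcatE: (qr) => [eqr vx]; move/pcatE: (pq) => [epq vy].
  case px: (pcat p x) => [z|]; last by move/pcat_None: px; rewrite ox.
  move/pcatE: px => [_ vz]; apply/esym/pcatE; split; first by rewrite ty.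
  by rewrite vz /orig /arrows vy vx /= catA.
- have [ox _] := termE _ _ _ qr.
  by apply/pcat_None; rewrite ox; apply/pcat_None.
- have [_ ty] := termE _ _ _ pq.
  by apply/esym/pcat_None; rewrite ty; apply/pcat_None.
Qed.

Lemma pcat1p p : pcat (vertex_path (orig p)) p = Some p.
Proof. by apply/pcatE; split=> //; case: p => -[]. Qed.

Lemma pcatp1 p : pcat p (vertex_path (terminus p)) = Some p.
Proof. by apply/pcatE; split=> //; rewrite cats0; case: p => -[]. Qed.

End Paths.

Section PathAlgebra.
Variables (k : fieldType) (Q : quiver).

Definition pathalg := {malg k[qpath Q]}.
HB.instance Definition _ := GRing.Lmodule.on pathalg.

Implicit Types (x y z : pathalg) (p q : qpath Q).

Definition pa_term (c : k) (o : option (qpath Q)) : pathalg :=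
  if o is Some p then << c *g p >> else 0.

Definition pa_mul x y : pathalg :=
  \sum_(p <- msupp x) \sum_(q <- msupp y) pa_term (x@_p * y@_q) (pcat p q).

Definition pa_one : pathalg := \sum_(u : Q) << vertex_path u >>.

Lemma pa_term0 o : pa_term 0 o = 0.
Proof. by case: o => //= p; rewrite monalgU0. Qed.

Lemma pa_termD a b o : pa_term (a + b) o = pa_term a o + pa_term b o.
Proof. by case: o => [p|] /=; rewrite ?addr0 // monalgUD. Qed.

Lemma pa_mulw (d1 d2 : {fset qpath Q}) x y :
  (msupp x `<=` d1)%fset -> (msupp y `<=` d2)%fset ->
  pa_mul x y = \sum_(p <- d1) \sum_(q <- d2) pa_term (x@_p * y@_q) (pcat p q).
Proof.
move=> le1 le2; rewrite /pa_mul (big_fset_incl _ le1) /=.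
  apply/eq_bigr=> p _; apply/big_fset_incl => // q _ /mcoeff_outdom ->.
  by rewrite mulr0 pa_term0.
move=> p _ /mcoeff_outdom xp.
by rewrite big1 // => q _; rewrite xp mul0r pa_term0.
Qed.

Lemma pa_mulDl : left_distributive pa_mul +%R.
Proof.
move=> x y z.
rewrite (pa_mulw (msuppD_le x y) (fsubset_refl _)).
rewrite (pa_mulw (fsubsetUl (msupp x) (msupp y)) (fsubset_refl (msupp z))).
rewrite (pa_mulw (fsubsetUr (msupp x) (msupp y)) (fsubset_refl (msupp z))).
rewrite -big_split /=; apply/eq_bigr=> p _.
rewrite -big_split /=; apply/eq_bigr=> q _.
by rewrite mcoeffD mulrDl pa_termD.
Qed.

Lemma pa_mulDr : right_distributive pa_mul +%R.
Proof.
move=> z x y.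
rewrite (pa_mulw (fsubset_refl _) (msuppD_le x y)).
rewrite (pa_mulw (fsubset_refl (msupp z)) (fsubsetUl (msupp x) (msupp y))).
rewrite (pa_mulw (fsubset_refl (msupp z)) (fsubsetUr (msupp x) (msupp y))).
rewrite -big_split /=; apply/eq_bigr=> p _.
rewrite -big_split /=; apply/eq_bigr=> q _.
by rewrite mcoeffD mulrDr pa_termD.
Qed.

Lemma pa_mul0r x : pa_mul 0 x = 0.
Proof. by rewrite /pa_mul msupp0 big_seq_fset0. Qed.

Lemma pa_mulr0 x : pa_mul x 0 = 0.
Proof. by rewrite /pa_mul big1 // => p _; rewrite msupp0 big_seq_fset0. Qed.

Lemma pa_mulUU a b p q :
  pa_mul << a *g p >> << b *g q >> = pa_term (a * b) (pcat p q).
Proof. by rewrite (pa_mulw msuppU_le msuppU_le) !big_seq_fset1 !mcoeffUU. Qed.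

Lemma pa_mul_suml (I : Type) (r : seq I) (F : I -> pathalg) y :
  pa_mul (\sum_(i <- r) F i) y = \sum_(i <- r) pa_mul (F i) y.
Proof. exact: (big_morph (pa_mul^~ y) (fun _ _ => pa_mulDl _ _ _) (pa_mul0r _)). Qed.

Lemma pa_mul_sumr (I : Type) (r : seq I) (F : I -> pathalg) y :
  pa_mul y (\sum_(i <- r) F i) = \sum_(i <- r) pa_mul y (F i).
Proof. exact: (big_morph (pa_mul y) (fun _ _ => pa_mulDr _ _ _) (pa_mulr0 _)). Qed.

Lemma pa_mulA : associative pa_mul.
Proof.
move=> x y z; rewrite (monalgE x) (monalgE y) (monalgE z).
rewrite [X in _ = pa_mul X _]pa_mul_suml [LHS]pa_mul_suml [RHS]pa_mul_suml.
apply: eq_bigr => p _.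
rewrite [X in pa_mul _ X = _]pa_mul_suml [X in _ = pa_mul X _]pa_mul_sumr.
rewrite [LHS]pa_mul_sumr [RHS]pa_mul_suml; apply: eq_bigr => q _.
rewrite [X in pa_mul _ X = _]pa_mul_sumr [LHS]pa_mul_sumr [RHS]pa_mul_sumr.
apply: eq_bigr => r _.
rewrite !pa_mulUU; have := pcatA p q r.
case: (pcat q r) => [u|]; case: (pcat p q) => [w|] /=; rewrite ?pa_mulUU ?mulrA.
- by move=> ->.
- by rewrite pa_mul0r => ->.
- by rewrite pa_mulr0 => <-.
- by rewrite pa_mulr0 pa_mul0r.
Qed.

Lemma pa_mul1r : left_id pa_one pa_mul.
Proof.
move=> x; rewrite [x in LHS]monalgE [RHS]monalgE pa_mul_sumr.
apply: eq_bigr => p _; rewrite /pa_one pa_mul_suml (bigD1 (orig p)) //=.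
rewrite pa_mulUU pcat1p mul1r /= big1 ?addr0 // => u /eqP ne.
by rewrite pa_mulUU; have /pcat_None-> : terminus (vertex_path u) <> orig p.
Qed.

Lemma pa_mulr1 : right_id pa_one pa_mul.
Proof.
move=> x; rewrite [x in LHS]monalgE [RHS]monalgE pa_mul_suml.
apply: eq_bigr => p _; rewrite /pa_one pa_mul_sumr (bigD1 (terminus p)) //=.
rewrite pa_mulUU pcatp1 mulr1 /= big1 ?addr0 // => u /eqP ne.
rewrite pa_mulUU; have /pcat_None-> // : terminus p <> orig (vertex_path u).
by move=> e; apply: ne; rewrite e.
Qed.

HB.instance Definition _ := GRing.Zmodule_isPzRing.Build pathalg
  pa_mulA pa_mul1r pa_mulr1 pa_mulDl pa_mulDr.

Definition vtx (u : Q) : pathalg := << vertex_path u >>.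
Definition arr (a : arrow Q) : pathalg := << arrow_path a >>.

(* Homogeneous elements for the length grading, extended by 0 to negative
   degrees. *)
Definition pa_deg (n : int) x : Prop :=
  if n is Posz m then forall p, p \in msupp x -> plen p = m else x = 0.

Definition linear_elt x : Prop := pa_deg 1 x.

(* Finite formal sums of terms c p: the form in which elements of kQ are
   given to, and returned by, an algorithm. *)
Definition terms := seq (k * qpath Q).
Definition pa_of_terms (s : terms) : pathalg := \sum_(t <- s) << t.1 *g t.2 >>.

End PathAlgebra.

Section TwoSidedIdeals.
Variable R : pzRingType.

Definition ideal_gen (S : R -> Prop) (x : R) : Prop :=
  exists (n : nat) (a g b : 'I_n -> R),
    (forall i, S (g i)) /\ x = \sum_i a i * g i * b i.

Definition ideal_prod (A B : R -> Prop) (x : R) : Prop :=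
  exists (n : nat) (a b : 'I_n -> R),
    (forall i, A (a i) /\ B (b i)) /\ x = \sum_i a i * b i.

End TwoSidedIdeals.

Definition arrow_ideal (k : fieldType) (Q : quiver) : pathalg k Q -> Prop :=
  ideal_gen (fun x => exists a, x = arr k a).

Section AdmissibleOrder.
Variables (Q : quiver) (lt : rel (qpath Q)).

Definition strict_well_order : Prop :=
  [/\ irreflexive lt, transitive lt,
      (forall p q, [\/ lt p q, p = q | lt q p]) & well_founded (fun p q => lt p q)].

Definition admissible : Prop :=
  [/\ strict_well_order,
      (forall p q r pr qr, lt q p -> pcat p r = Some pr -> pcat q r = Some qr ->
         lt qr pr),
      (forall p q r rp rq, lt q p -> pcat r p = Some rp -> pcat r q = Some rq ->
         lt rq rp) &
      (forall p q r, pcat q r = Some p -> ~~ lt p q /\ ~~ lt p r)].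

End AdmissibleOrder.

(* Right R-modules are left modules over the converse ring R^c. *)

Definition ract (R : pzRingType) (M : lmodType R^c) (x : M) (r : R) : M :=
  (r : R^c) *: x.
Notation "x ** r" := (ract x r) (at level 40, left associativity) : ring_scope.

Section Submodule.
Variables (S : pzRingType) (V : lmodType S) (W : submodClosed V).

Record submod := Submod { submod_val :> V; _ : submod_val \in W }.
HB.instance Definition _ := [isSub for submod_val].
HB.instance Definition _ := [Choice of submod by <:].
HB.instance Definition _ := [SubChoice_isSubLmodule of submod by <:].

End Submodule.

Section Kernel.
Variables (S : pzRingType) (A B : lmodType S) (f : {linear A -> B}).

Definition ker_pred : {pred A} := fun x => f x == 0.
Fact ker_submod : submod_closed ker_pred.
Proof.
split=> [|a x y]; rewrite !unfold_in /= ?linear0 // => /eqP fx /eqP fy.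
by rewrite linearP fx fy scaler0 addr0.
Qed.
HB.instance Definition _ := GRing.isSubmodClosed.Build S A ker_pred ker_submod.
Definition ker : lmodType S := submod ker_pred.

End Kernel.

Definition projective (S : pzRingType) (P : lmodType S) : Prop :=
  forall (A B : lmodType S) (g : {linear A -> B}) (f : {linear P -> B}),
    (forall b, exists a, g a = b) ->
    exists h : {linear P -> A}, forall x, g (h x) = f x.

Section Span.
Variables (R : pzRingType) (M : lmodType R^c) (J : eqType) (f : J -> M).

(* The subset \sum_j f_j A of M. *)
Definition rspan_in (A : R -> Prop) (x : M) : Prop :=
  exists (s : seq J) (r : J -> R),
    (forall j, A (r j)) /\ x = \sum_(j <- s) f j ** r j.

Definition rspan_pred : {pred M} := fun x => `[< rspan_in (fun=> True) x >].
Fact rspan_submod : submod_closed rspan_pred.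
Proof.
split=> [|a x y]; rewrite !unfold_in.
  by apply/asboolP; exists [::], (fun=> 0); rewrite big_nil.
move=> /asboolP[s [r [_ ->]]] /asboolP[s' [r' [_ ->]]]; apply/asboolP.
have actD z b c : z ** (b + c) = z ** b + z ** c :> M by exact: scalerDl.
have act0 z : z ** 0 = 0 :> M by exact: scale0r.
have single (t : seq J) j c :
    j \in t -> exists u, \sum_(i <- undup t) f i ** u i = f j ** c.
  move=> jt; exists (fun i => if i == j then c else 0).
  rewrite (bigD1_seq j) ?mem_undup ?undup_uniq //= eqxx big1 ?addr0 //.
  by move=> i /negPf->.
have collect (t t' : seq J) (u : J -> R) : {subset t <= t'} ->
    exists u', \sum_(i <- undup t') f i ** u' i = \sum_(i <- t) f i ** u i.
  elim: t => [|j t IH] sub.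
    by exists (fun=> 0); rewrite big_nil big1 // => i _.
  have [|u1 e1] := IH; first by move=> i it; apply: sub; rewrite inE it orbT.
  have [|u2 e2] := single t' j (u j); first by apply: sub; rewrite inE eqxx.
  exists (fun i => u2 i + u1 i).
  by rewrite big_cons -e2 -e1 -big_split; apply: eq_bigr => i _; rewrite actD.
have [|u eu] := collect s (s ++ s') (fun j => (r j : R) * (a : R)).
  by move=> i is_; rewrite mem_cat is_.
have [|u' eu'] := collect s' (s ++ s') r'.
  by move=> i is_; rewrite mem_cat is_ orbT.
exists (undup (s ++ s')), (fun i => u i + u' i); split=> //.
under [RHS]eq_bigr do rewrite actD.
rewrite big_split /= eu eu' scaler_sumr; congr (_ + _).
by apply: eq_bigr => j _; rewrite /ract scalerA.
Qed.
HB.instance Definition _ :=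
  GRing.isSubmodClosed.Build R^c M rspan_pred rspan_submod.

(* The submodule \sum_j f_j R; it is the coproduct \coprod_j f_j R when
   direct_family below holds. *)
Definition rspan : lmodType R^c := submod rspan_pred.

Definition direct_family : Prop :=
  forall (s : seq J) (r : J -> R), uniq s ->
    \sum_(j <- s) f j ** r j = 0 -> forall j, j \in s -> f j ** r j = 0.

End Span.

Section CoprodIdempotents.
Variables (R : pzRingType) (n : nat) (e : 'I_n -> R).

Definition rfree : lmodType R^c := {ffun 'I_n -> (R^c)^o}.

Definition cop_pred : {pred rfree} :=
  fun x => [forall i, e i * (x i : R) == (x i : R)].
Fact cop_submod : submod_closed cop_pred.
Proof.
split=> [|a x y]; rewrite !unfold_in.
  by apply/forallP=> i; rewrite ffunE; apply/eqP; exact: (@mulr0 R).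
move=> /forallP hx /forallP hy; apply/forallP=> i; apply/eqP; rewrite !ffunE.
have := mulrDr (e i) ((x i : R) * (a : R)) (y i : R).
by rewrite mulrA (eqP (hx i)) (eqP (hy i)).
Qed.
HB.instance Definition _ :=
  GRing.isSubmodClosed.Build R^c rfree cop_pred cop_submod.

(* \coprod_i e_i R, as the set of families (x_i) with e_i x_i = x_i. *)
Definition cop : lmodType R^c := submod cop_pred.

Definition cop_coord (x : cop) (i : 'I_n) : R := (val x : rfree) i.

End CoprodIdempotents.

Section Restriction.
Variables (R L : pzRingType) (pr : {rmorphism R -> L}) (M : lmodType L^c).

(* A Lambda-module M regarded as an R-module through pr. *)
Definition restr_of (_ : {rmorphism R -> L}) : Type := GRing.Lmodule.sort M.
Local Notation restrT := (restr_of pr).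
HB.instance Definition _ := GRing.Zmodule.on restrT.

Definition restr_scale (r : R^c) (x : restrT) : restrT :=
  (x : M) ** pr (r : R).
Fact restr_scaleA a b x :
  restr_scale a (restr_scale b x) = restr_scale (a * b) x.
Proof.
rewrite /restr_scale /ract scalerA.
by congr (_ *: _); exact: (esym (rmorphM pr b a)).
Qed.
Fact restr_scale1 : left_id 1 restr_scale.
Proof. by move=> x; rewrite /restr_scale /ract rmorph1 scale1r. Qed.
Fact restr_scaleDr : right_distributive restr_scale +%R.
Proof. by move=> a x y; exact: scalerDr. Qed.
Fact restr_scaleDl x : {morph restr_scale^~ x : a b / a + b}.
Proof. by move=> a b; rewrite /restr_scale /ract rmorphD; exact: scalerDl. Qed.
HB.instance Definition _ := GRing.Zmodule_isLmodule.Build R^c restrT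
  restr_scaleA restr_scale1 restr_scaleDr restr_scaleDl.

Definition restr : lmodType R^c := restrT.

End Restriction.
Arguments restr {R L} pr M.

(* L is R/I with canonical projection pr. *)
Definition is_quotient_ring (R L : pzRingType) (I : R -> Prop)
    (pr : {rmorphism R -> L}) : Prop :=
  (forall y, exists x, pr x = y) /\ (forall x, pr x = 0 <-> I x).

Structure gmod (L : pzRingType) := GMod {
  gmod_sort :> lmodType L^c;
  gdeg : int -> gmod_sort -> Prop }.

Section Graded.
Variables (k : fieldType) (Q : quiver) (L : pzRingType).
Variable pr : {rmorphism pathalg k Q -> L}.

(* The grading of Lambda induced by path length, and the graded radical. *)
Definition quot_deg (n : int) (y : L) : Prop := exists2 x, pa_deg n x & pr x = y.

Definition quot_rad (y : L) : Prop :=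
  exists (n : nat) (c : 'I_n -> L),
    (forall i : 'I_n, quot_deg i.+1 (c i)) /\ y = \sum_i c i.

Definition is_graded (M : gmod L) : Prop :=
  [/\ (forall n, gdeg n (0 : M) /\
         forall x y : M, gdeg n x -> gdeg n y -> gdeg n (x - y)),
      (forall n m (x : M) a, gdeg n x -> quot_deg m a -> gdeg (n + m) (x ** a)),
      (forall x : M, exists (s : seq int) (c : int -> M),
         (forall n, gdeg n (c n)) /\ x = \sum_(n <- s) c n) &
      (forall (s : seq int) (c : int -> M), uniq s -> (forall n, gdeg n (c n)) ->
         \sum_(n <- s) c n = 0 -> forall n, n \in s -> c n = 0)].

Definition bounded_below (M : gmod L) : Prop :=
  exists N : int, forall n (x : M), (n < N)%R -> gdeg n x -> x = 0.

Definition fin_gen_in_degree (n : int) (M : gmod L) : Prop :=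
  exists (m : nat) (g : 'I_m -> M), (forall i, gdeg n (g i)) /\
    forall x, exists a : 'I_m -> L, x = \sum_i g i ** a i.

Definition degree0 (M N : gmod L) (f : M -> N) : Prop :=
  forall n x, gdeg n x -> gdeg n (f x).

Definition mul_rad (M : lmodType L^c) (x : M) : Prop :=
  exists (n : nat) (y : 'I_n -> M) (a : 'I_n -> L),
    (forall i, quot_rad (a i)) /\ x = \sum_i y i ** a i.

Section Resolution.
Variables (M : gmod L) (P : nat -> gmod L).
Variables (e : forall n, {linear P n.+1 -> P n}) (aug : {linear P 0%N -> M}).

Definition graded_projective_resolution : Prop :=
  [/\ (forall n, is_graded (P n) /\ projective (P n)),
      degree0 aug /\ (forall n : nat, degree0 (e n)),
      (forall y, exists x, aug x = y),
      (forall x, aug x = 0 <-> exists y, e 0%N y = x) &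
      (forall n x, e n x = 0 <-> exists y, e n.+1 y = x)].

Definition minimal_linear_resolution : Prop :=
  [/\ is_graded M /\ bounded_below M,
      graded_projective_resolution,
      (forall n x, mul_rad (e n x)) &
      (forall n : nat, fin_gen_in_degree n%:Z (P n))].

End Resolution.

Definition linear_module (M : gmod L) : Prop :=
  exists P e aug, @minimal_linear_resolution M P e aug.

Definition splice (P0 P1 : gmod L) (T : nat -> gmod L) (n : nat) : gmod L :=
  match n with 0 => P0 | 1 => P1 | m.+2 => T m end.

(* P1 -> P0 -> M -> 0 is the beginning of a minimal projective linear
   resolution of M. *)
Definition linear_resolution_start (M P0 P1 : gmod L)
    (d1 : {linear P1 -> P0}) (d0 : {linear P0 -> M}) : Prop :=
  exists (T : nat -> gmod L)
         (e : forall n, {linear splice P0 P1 T n.+1 -> splice P0 P1 T n}),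
    e 0%N =1 d1 /\ @minimal_linear_resolution M (splice P0 P1 T) e d0.

(* Lambda_0 is Lambda / rad as a right Lambda-module, placed in degree 0. *)
Definition koszul : Prop :=
  exists (S : lmodType L^c) (q : {linear (L^c)^o -> S}),
    [/\ (forall y, exists x, q x = y), (forall x, q x = 0 <-> quot_rad x) &
        linear_module (GMod (fun n (x : S) => n = 0 \/ x = 0))].

(* \coprod_i v_i R and \coprod_i v_i Lambda, the latter with the v_i in
   degree s. *)
Definition copR (t : nat) (v : 'I_t -> Q) : lmodType (pathalg k Q)^c :=
  cop (fun i => vtx k (v i)).
Definition copL (t : nat) (v : 'I_t -> Q) : lmodType L^c :=
  cop (fun i => pr (vtx k (v i))).
Definition copL_deg (t : nat) (v : 'I_t -> Q) (s n : int) (x : copL v) : Prop :=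
  forall i, quot_deg (n - s) (cop_coord x i).
Definition copL_gmod (t : nat) (v : 'I_t -> Q) (s : int) : gmod L :=
  GMod (@copL_deg t v s).

(* y is the image of x under \coprod_i v_i R -> \coprod_i v_i Lambda. *)
Definition reduces_to (t : nat) (v : 'I_t -> Q) (x : copR v) (y : copL v) : Prop :=
  forall i, cop_coord y i = pr (cop_coord x i).

(* The entry mx l i of the matrix is the (unique, as I is contained in J^2)
   linear element of kQ lifting the entry of d1 in v_i Lambda w_l. *)
Definition is_matrix (t0 t1 : nat) (v : 'I_t0 -> Q) (w : 'I_t1 -> Q)
    (d1 : {linear copL w -> copL v}) (mx : 'I_t1 -> 'I_t0 -> terms k Q) : Prop :=
  (forall l i, linear_elt (pa_of_terms (mx l i)) /\
     vtx k (v i) * pa_of_terms (mx l i) * vtx k (w l) = pa_of_terms (mx l i)) /\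
  (forall x i, cop_coord (d1 x) i = \sum_l pr (pa_of_terms (mx l i)) * cop_coord x l).

(* P, with projection q, is \coprod_j f_j R / \coprod_j f_j I. *)
Definition is_coprod_quotient (I : pathalg k Q -> Prop)
    (V : lmodType (pathalg k Q)^c) (t : nat) (f : 'I_t -> V)
    (P : lmodType L^c) (q : {linear rspan f -> restr pr P}) : Prop :=
  (forall y, exists x, q x = y) /\ (forall x, q x = 0 <-> rspan_in f I (val x)).

(* The grading of such a quotient in which the f_j have degree s. *)
Definition coprod_quotient_gmod (V : lmodType (pathalg k Q)^c) (t : nat)
    (f : 'I_t -> V) (P : lmodType L^c) (q : {linear rspan f -> restr pr P})
    (s : int) : gmod L :=
  @GMod L P (fun n y => exists (x : rspan f) (r : 'I_t -> pathalg k Q),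
    [/\ forall j, pa_deg (n - s) (r j), val x = \sum_j f j ** r j & y = q x]).

(* Ker d0, with its degrees lowered by 1. *)
Definition syzygy (t : nat) (v : 'I_t -> Q) (M : lmodType L^c)
    (d0 : {linear copL v -> M}) : gmod L :=
  @GMod L (ker d0) (fun n x => copL_deg 0 (n + 1) (val x)).

End Graded.

Section Tips.
Variables (k : fieldType) (Q : quiver) (lt : rel (qpath Q)).

Definition right_uniform (V : lmodType (pathalg k Q)^c) (x : V) : Prop :=
  x <> 0 /\ exists u, x ** vtx k u = x.

Variables (t : nat) (v : 'I_t -> Q).

(* (i, p) stands for the basis element eps_i p. *)
Definition eps_lt (b c : 'I_t * qpath Q) : bool :=
  lt b.2 c.2 || (b.2 == c.2) && (b.1 < c.1)%N.

Definition occurs (x : copR k v) (b : 'I_t * qpath Q) : Prop :=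
  (cop_coord x b.1)@_(b.2) != 0.

Definition is_tip (x : copR k v) (b : 'I_t * qpath Q) : Prop :=
  occurs x b /\ forall c, occurs x c -> c <> b -> eps_lt c b.

Definition left_divides (b c : 'I_t * qpath Q) : Prop :=
  b.1 = c.1 /\ exists s, pcat b.2 s = Some c.2.

Definition right_tip_reduced (J : Type) (f : J -> copR k v) : Prop :=
  (forall j, right_uniform (f j)) /\
  forall j j' b b', f j <> f j' -> is_tip (f j) b -> is_tip (f j') b' ->
    ~ left_divides b b'.

End Tips.

Definition sum_family (A B T : Type) (f : A -> T) (g : B -> T) (j : A + B) : T :=
  match j with inl a => f a | inr b => g b end.

(* Programs compute on binary trees whose leaves are nil, elements of k and
   paths. Apart from tree manipulation, branching and unbounded loops, the
   elementary operations are arithmetic and equality test in k, and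
   concatenation and comparison of paths. A program mentions neither k, nor Q,
   nor the order. *)

Inductive tree (k P : Type) :=
  | Nil | Node of tree k P & tree k P | Scalar of k | Path of P.
Arguments Nil {k P}.
Arguments Scalar {k P}.
Arguments Path {k P}.

Inductive elem_op :=
  | OpId | OpNil | OpHead | OpTail
  | OpOne | OpAdd | OpOpp | OpMul | OpInv | OpEq
  | OpCat | OpLt.

Inductive prog :=
  | Elem of elem_op
  | Seq of prog & prog
  | Pair of prog & prog
  | If of prog & prog & prog
  | While of prog & prog.

Section Semantics.
Variables (k : fieldType) (Q : quiver) (lt : rel (qpath Q)).
Local Notation T := (tree k (qpath Q)).

Definition of_bool (b : bool) : T := if b then Node Nil Nil else Nil.
Definition is_nil (x : T) : bool := if x is Nil then true else false.

(* Ill-typed arguments give Nil, as does the product 0 of two paths. *)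
Definition elem_sem (o : elem_op) (x : T) : T :=
  match o, x with
  | OpId, _ => x
  | OpHead, Node y _ => y
  | OpTail, Node _ y => y
  | OpOne, _ => Scalar 1
  | OpAdd, Node (Scalar a) (Scalar b) => Scalar (a + b)
  | OpOpp, Scalar a => Scalar (- a)
  | OpMul, Node (Scalar a) (Scalar b) => Scalar (a * b)
  | OpInv, Scalar a => Scalar a^-1
  | OpEq, Node (Scalar a) (Scalar b) => of_bool (a == b)
  | OpCat, Node (Path p) (Path q) => if pcat p q is Some r then Path r else Nil
  | OpLt, Node (Path p) (Path q) => of_bool (lt p q)
  | _, _ => Nil
  end.

(* run A x y: on input x the program A stops, with result y. *)
Inductive run : prog -> T -> T -> Prop :=
  | RunElem o x : run (Elem o) x (elem_sem o x)
  | RunSeq A B x y z : run A x y -> run B y z -> run (Seq A B) x z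
  | RunPair A B x y z : run A x y -> run B x z -> run (Pair A B) x (Node y z)
  | RunThen C A B x c y :
      run C x c -> ~~ is_nil c -> run A x y -> run (If C A B) x y
  | RunElse C A B x c y :
      run C x c -> is_nil c -> run B x y -> run (If C A B) x y
  | RunStop C A x c : run C x c -> is_nil c -> run (While C A) x x
  | RunLoop C A x c y z :
      run C x c -> ~~ is_nil c -> run A x y -> run (While C A) y z ->
      run (While C A) x z.

Lemma run_functional A x y z : run A x y -> run A x z -> y = z.
Proof.
move=> r; elim: r z => {A x y}.
all: intros; match goal with H : run _ _ ?z |- _ = ?z => inversion H; subst end.
all: repeat match goal with
  | IH : forall z, run ?A ?x z -> _ = z, H : run ?A ?x _ |- _ =>
      move: (IH _ H) => ?; subst; clear IH
  end.
all: try by [].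
all: match goal with H : is_true (~~ ?b), H' : is_true ?b |- _ =>
       by rewrite H' in H end.
Qed.

Definition enc_seq (X : Type) (enc : X -> T) (s : seq X) : T :=
  foldr (fun a => Node (enc a)) Nil s.
Definition enc_fam (X : Type) (enc : X -> T) (n : nat) (f : 'I_n -> X) : T :=
  enc_seq enc [seq f i | i <- enum 'I_n].

Definition enc_vertex (u : Q) : T := Path (vertex_path u).
Definition enc_arrow (a : arrow Q) : T :=
  Node (Path (arrow_path a)) (Node (enc_vertex (src a)) (enc_vertex (tgt a))).
Definition enc_quiver : T :=
  Node (enc_seq enc_vertex (enum Q)) (enc_seq enc_arrow (enum (arrow Q))).
Definition enc_terms : terms k Q -> T :=
  enc_seq (fun t => Node (Scalar t.1) (Path t.2)).
Definition enc_matrix (n m : nat) (a : 'I_n -> 'I_m -> terms k Q) : T :=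
  enc_fam (fun row : 'I_m -> terms k Q => enc_fam enc_terms row) a.

Definition enc_input (gens : seq (terms k Q)) (t0 t1 : nat) (v : 'I_t0 -> Q)
    (w : 'I_t1 -> Q) (mx : 'I_t1 -> 'I_t0 -> terms k Q) : T :=
  Node enc_quiver
    (Node (enc_seq enc_terms gens)
       (Node (enc_matrix mx) (Node (enc_fam enc_vertex v) (enc_fam enc_vertex w)))).

End Semantics.

(* Main.v *)
Require Import Defs.
From HB Require Import structures.
From mathcomp Require Import all_boot all_order all_algebra.
From Stdlib Require List.
From mathcomp Require Import finmap.
From mathcomp.multinomials Require Import monalg.
From mathcomp.classical Require Import boolp.

(* The entries of the matrix of d1 are linear and its columns are independent
   over k, since d1 is injective in degree 1. Gaussian elimination with the
   arrows in decreasing order turns the columns into a tip-reduced family f^1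
   with the same span. If K is the kernel of pi, then K = N + I', where N is
   generated by f^1 and I' by I in every coordinate. The elements of K having
   neither a vertex term nor a term divisible by a tip of f^1 form a submodule
   complementary to N, as the tips of f^1 are arrows. A tip basis g of it can be
   corrected by elements of N to lie in I' without losing independence modulo
   N, and f^1' is a tip basis of the submodule generated by the corrections.

   For (b), the linear second syzygies are the combinations of the products
   f^1_l a, with a an arrow, which lie in I in degree 2; that part of I is
   spanned by the elements y g x, with g a generator and x, y vertices. Only
   finite-dimensional linear algebra is needed, and no Groebner basis of I. The
   graded Nakayama lemma identifies the modules generated by f^1 and f^2 with
   the first two terms of the given linear resolution of the syzygy, and the
   remaining terms are kept. *)

Set Implicit Arguments.
Unset Strict Implicit.
Unset Printing Implicit Defensive.
Import GRing.Theory.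
Local Open Scope ring_scope.

(** * The path algebra *)

(** A tip basis of K would be direct at once, but nothing places its members outside N in I. The
    correction that achieves this leaves the tips uncontrolled, which is why a tip basis is taken a
    second time; directness of f^1' together with f^1 then rests on a trivial intersection with N
    and not on tips. Rows of the elimination carry no terminus, yet the output must be right
    uniform. A multiple of a pivot is subtracted only when pivot and row have a nonzero coefficient
    at the same path, so their termini agree and uniformity is never lost. All tips of the computed
    families are arrows; distinct ones cannot divide one another, so independence over k becomes
    directness over R. This serves for f^1 and for the coefficient vectors of f^2; the family f^2
    inherits directness through the embedding of the coproduct of the u_l R that sends the l-th
    generator to f^1_l, where u_l is the terminus of f^1_l. The u_l need not be the w_l in the given
    order, so the modules generated by f^1 and f^2 have to be compared with the given terms through
    constructed isomorphisms. *)

Section PathLemmas.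
Variable Q : quiver.
Implicit Types (p q r : qpath Q) (u : Q).

Lemma qpath_eqP p q : orig p = orig q -> arrows p = arrows q -> p = q.
Proof.
move=> op ap; apply: val_inj; case: p op ap => -[u s] hp; case: q => -[u' s'] hq.
by rewrite /orig /arrows /= => -> ->.
Qed.

Lemma orig_pcat p q r : pcat p q = Some r -> orig r = orig p.
Proof. by case/pcatE=> _; rewrite /orig => ->. Qed.

Lemma arrows_pcat p q r : pcat p q = Some r -> arrows r = arrows p ++ arrows q.
Proof. by case/pcatE=> _; rewrite /arrows => ->. Qed.

Lemma plen_pcat p q r : pcat p q = Some r -> plen r = (plen p + plen q)%N.
Proof. by move/arrows_pcat; rewrite /plen => ->; rewrite size_cat. Qed.

Lemma terminus_pcat p q r : pcat p q = Some r -> terminus r = terminus q.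
Proof.
move=> h; rewrite /terminus (arrows_pcat h) (orig_pcat h) map_cat last_cat.
by case/pcatE: h => + _; rewrite /terminus => ->.
Qed.

Lemma pcat_composable p q : terminus p = orig q -> exists r, pcat p q = Some r.
Proof. by case e: (pcat p q) => [r|]; [exists r | move/pcat_None: e]. Qed.

Lemma pcat_injl p q q' r : pcat p q = Some r -> pcat p q' = Some r -> q = q'.
Proof.
move=> h h'; apply: qpath_eqP.
  by case/pcatE: h => <- _; case/pcatE: h'.
have /eqP := arrows_pcat h; rewrite (arrows_pcat h') eqseq_cat // eqxx /=.
by move/eqP.
Qed.

Lemma plen0 p : plen p = 0%N -> p = vertex_path (orig p).
Proof. by move=> /size0nil h; apply: qpath_eqP. Qed.

Lemma plen1 p : plen p = 1%N -> exists a, p = arrow_path a.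
Proof.
case: p => -[u [|a [|b s]]] //= h _; exists a; apply: qpath_eqP => //.
by have /andP[/eqP] := h.
Qed.

Lemma is_walk_take u (s : seq (arrow Q)) i : is_walk u s -> is_walk u (take i s).
Proof. by rewrite -{1}(cat_take_drop i s) is_walk_cat => /andP[]. Qed.

Lemma is_walk_drop u (s : seq (arrow Q)) i :
  is_walk u s -> is_walk (last u (map tgt (take i s))) (drop i s).
Proof. by rewrite -{1}(cat_take_drop i s) is_walk_cat => /andP[]. Qed.

Lemma walkP p : is_walk (orig p) (arrows p).
Proof. by case: p => -[]. Qed.

Definition ptake i r : qpath Q :=
  @QPath Q (orig r, take i (arrows r)) (is_walk_take i (walkP r)).

Definition pdrop i r : qpath Q :=
  @QPath Q (last (orig r) (map tgt (take i (arrows r))), drop i (arrows r))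
    (is_walk_drop i (walkP r)).

Lemma pcat_take_drop i r : pcat (ptake i r) (pdrop i r) = Some r.
Proof.
apply/pcatE; split=> //; rewrite /= /arrows /= cat_take_drop.
by case: r => -[].
Qed.

Lemma pcat_ptake p q r : pcat p q = Some r ->
  ptake (plen p) r = p /\ pdrop (plen p) r = q.
Proof.
move=> h; have ar := arrows_pcat h; have o := orig_pcat h.
have e : ptake (plen p) r = p.
  by apply: qpath_eqP => //; rewrite {1}/arrows /= ar take_size_cat.
by split=> //; have := pcat_take_drop (plen p) r; rewrite e => /pcat_injl; apply.
Qed.

End PathLemmas.

(** * Coefficients of products in the path algebra *)

Section Coefficients.
Variables (k : fieldType) (Q : quiver).
Implicit Types (x y z : pathalg k Q) (p q r : qpath Q) (u : Q).

Definition mono (c : k) p : pathalg k Q := << c *g p >>.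

Lemma coef_mono c p q : (mono c p)@_q = if p == q then c else 0.
Proof. by rewrite mcoeffU; case: eqP. Qed.

Lemma coef_mono_neq0 c p q : (mono c p)@_q != 0 -> p = q.
Proof. by rewrite coef_mono; case: (p =P q) => //; rewrite eqxx. Qed.

Lemma coefD x y p : (x + y)@_p = x@_p + y@_p.
Proof. exact: mcoeffD. Qed.

Lemma coefN x p : (- x)@_p = - x@_p.
Proof. exact: mcoeffN. Qed.

Lemma coef0 p : (0 : pathalg k Q)@_p = 0.
Proof. exact: mcoeff0. Qed.

Lemma coefZ c x p : (c *: x)@_p = c * x@_p.
Proof. exact: mcoeffZ. Qed.

Lemma coefP c x y p : (c *: x + y)@_p = c * x@_p + y@_p.
Proof. by rewrite coefD coefZ. Qed.

Lemma coef_sum (J : Type) (s : seq J) (P : pred J) (F : J -> pathalg k Q) p :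
  (\sum_(j <- s | P j) F j)@_p = \sum_(j <- s | P j) (F j)@_p.
Proof. exact: (big_morph (fun x : pathalg k Q => x@_p) (fun x y => coefD x y p) (coef0 p)). Qed.

Lemma pa_eqP x y : (forall p, x@_p = y@_p) -> x = y.
Proof. by move=> h; apply/malgP. Qed.

Lemma pa_mulE x y :
  x * y = \sum_(p <- msupp x) \sum_(q <- msupp y) pa_term (x@_p * y@_q) (pcat p q).
Proof. by []. Qed.

Lemma coef_pa_term (c : k) (o : option (qpath Q)) r : (pa_term c o)@_r = if o == Some r then c else 0.
Proof.
case: o => [p|] /=; last by rewrite coef0.
by rewrite [LHS]coef_mono; have -> : (Some p == Some r) = (p == r) by [].
Qed.

Lemma sum_supp_pred1 x p : \sum_(q <- msupp x) (if q == p then x@_q else 0) = x@_p.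
Proof.
rewrite -big_mkcond /=; case: (boolP (p \in msupp x)) => hp.
  by rewrite -big_filter (bigD1_seq p) ?mem_filter ?eqxx ?filter_uniq ?fset_uniq //= big_filter_cond big1 ?addr0 // => q /andP[/eqP ->]; rewrite eqxx.
rewrite (mcoeff_outdom hp) big1_seq // => q /andP[/eqP -> hq].
by rewrite hq in hp.
Qed.

(* A path r has exactly one factorization r = pq for each length of p. *)
Lemma mcoeffM x y r :
  (x * y)@_r = \sum_(i < (plen r).+1) x@_(ptake i r) * y@_(pdrop i r).
Proof.
pose G p q i := (p == ptake i r) && (q == pdrop i r).
have key p q (c : k) : (pa_term c (pcat p q))@_r = \sum_(i < (plen r).+1) (if G p q i then c else 0).
  rewrite (coef_pa_term c) -big_mkcond /=; case: eqP => [e|ne].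
    have lp : (plen p < (plen r).+1)%N by rewrite (plen_pcat e) ltnS leq_addr.
    have [e1 e2] := pcat_ptake e.
    rewrite (big_pred1 (Ordinal lp)) // => i; rewrite /G.
    apply/andP/eqP => [[/eqP ep _]|->]; last by rewrite /= e1 e2 !eqxx.
    apply: val_inj => /=; rewrite ep /plen /ptake /arrows /= size_takel //.
    by rewrite -ltnS (ltn_ord i).
  rewrite big1 // => i /andP[/eqP ep /eqP eq]; case: ne.
  by rewrite ep eq pcat_take_drop.
rewrite pa_mulE coef_sum.
under eq_bigr => p _ do rewrite coef_sum.
under eq_bigr => p _ do under eq_bigr => q _ do rewrite key.
under eq_bigr => p _ do rewrite exchange_big /=.
rewrite exchange_big /=; apply: eq_bigr => i _.
rewrite -[X in _ = X * _]sum_supp_pred1 mulr_suml; apply: eq_bigr => p _.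
rewrite -[X in _ = _ * X]sum_supp_pred1 mulr_sumr; apply: eq_bigr => q _.
by rewrite /G; case: eqP => _ /=; rewrite ?mul0r //; case: eqP; rewrite ?mulr0.
Qed.

Lemma mcoeffM_pcat x y r : (x * y)@_r != 0 ->
  exists p q, [/\ pcat p q = Some r, x@_p != 0 & y@_q != 0].
Proof.
rewrite mcoeffM => h.
case: (boolP [exists i : 'I_(plen r).+1, x@_(ptake i r) * y@_(pdrop i r) != 0]).
  case/existsP=> i; rewrite mulf_eq0 negb_or => /andP[hx hy].
  by exists (ptake i r), (pdrop i r); rewrite pcat_take_drop.
rewrite negb_exists => /forallP h0; case/eqP: h; apply: big1 => i _.
by move: (h0 i); rewrite negbK => /eqP.
Qed.

(** The form of the product formula used for leading terms: if a single factorization of [r] meets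
    both supports, nothing can cancel at [r]. *)
Lemma mcoeffM_unique x y p q r : pcat p q = Some r ->
  (forall p' q', pcat p' q' = Some r -> x@_p' != 0 -> y@_q' != 0 -> p' = p) ->
  (x * y)@_r = x@_p * y@_q.
Proof.
move=> h uni; have [e1 e2] := pcat_ptake h.
have lp : (plen p < (plen r).+1)%N by rewrite (plen_pcat h) ltnS leq_addr.
rewrite mcoeffM (bigD1 (Ordinal lp)) //= e1 e2 big1 ?addr0 // => i ne.
case: (eqVneq (x@_(ptake i r)) 0) => [->|hx]; first by rewrite mul0r.
case: (eqVneq (y@_(pdrop i r)) 0) => [->|hy]; first by rewrite mulr0.
have := uni _ _ (pcat_take_drop i r) hx hy => /(congr1 (@plen Q)) ei.
case/eqP: ne; apply: val_inj => /=; rewrite -ei /plen /ptake /arrows /= size_takel //.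
by rewrite -ltnS (ltn_ord i).
Qed.

Lemma coef_mulU x p c q r : pcat q p = Some r ->
  (x * mono c p)@_r = x@_q * c.
Proof.
move=> h; rewrite (mcoeffM_unique h) ?coef_mono ?eqxx // => p' q' h' _.
move=> /coef_mono_neq0 eq.
subst q'; apply: qpath_eqP; first by rewrite -(orig_pcat h') (orig_pcat h).
have /eqP := arrows_pcat h'; rewrite (arrows_pcat h) => /eqP e.
have es : size (arrows q) = size (arrows p').
  by have /eqP := congr1 size e; rewrite !size_cat eqn_add2r => /eqP.
by move/eqP: e; rewrite eqseq_cat // => /andP[/eqP ->].
Qed.

Lemma coef_Umul y p c q r : pcat p q = Some r ->
  (mono c p * y)@_r = c * y@_q.
Proof.
move=> h; rewrite (mcoeffM_unique h) ?coef_mono ?eqxx // => p' q' _.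
by move/coef_mono_neq0=> ->.
Qed.

Lemma pa_mulU (a b : k) p q :
  mono a p * mono b q = pa_term (a * b) (pcat p q).
Proof. exact: pa_mulUU. Qed.

Lemma vtxE u : vtx k u = mono 1 (vertex_path u).
Proof. by []. Qed.

Lemma vtxM u u' : vtx k u * vtx k u' = if u == u' then vtx k u else 0.
Proof.
rewrite !vtxE pa_mulU mulr1; case: eqP => [<-|ne].
  by have := pcat1p (vertex_path u); rewrite /= => ->.
by have /pcat_None -> : terminus (vertex_path u) <> orig (vertex_path u').
Qed.

Lemma vtxMM u : vtx k u * vtx k u = vtx k u.
Proof. by rewrite vtxM eqxx. Qed.

Lemma coef_vtxM u x p : (vtx k u * x)@_p = if orig p == u then x@_p else 0.
Proof.
case: eqP => [<-|ne]; first by rewrite vtxE (coef_Umul _ _ (pcat1p p)) mul1r.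
apply/eqP; apply: contraT => /mcoeffM_pcat[p' [q' [h]]].
move=> /coef_mono_neq0 e _.
by case: ne; rewrite (orig_pcat h) -e.
Qed.

Lemma coef_Mvtx u x p : (x * vtx k u)@_p = if terminus p == u then x@_p else 0.
Proof.
case: eqP => [<-|ne]; first by rewrite vtxE (coef_mulU _ _ (pcatp1 p)) mulr1.
apply/eqP; apply: contraT => /mcoeffM_pcat[p' [q' [h _]]].
move=> /coef_mono_neq0 e.
by case: ne; rewrite (terminus_pcat h) -e.
Qed.

Lemma vtxM_orig u x p : vtx k u * x = x -> x@_p != 0 -> orig p = u.
Proof.
by move=> <-; rewrite coef_vtxM; case: (orig p =P u) => // _; rewrite eqxx.
Qed.

Lemma Mvtx_terminus u x p : x * vtx k u = x -> x@_p != 0 -> terminus p = u.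
Proof.
by move=> <-; rewrite coef_Mvtx; case: (terminus p =P u) => // _; rewrite eqxx.
Qed.

Lemma scale_pathalgAl (c : k) x y : c *: (x * y) = (c *: x) * y.
Proof.
apply: pa_eqP => r; rewrite coefZ [RHS]mcoeffM [X in _ * X = _]mcoeffM mulr_sumr.
by apply: eq_bigr => i _; rewrite coefZ mulrA.
Qed.

Lemma scale_pathalgAr (c : k) x y : c *: (x * y) = x * (c *: y).
Proof.
apply: pa_eqP => r; rewrite coefZ [RHS]mcoeffM [X in _ * X = _]mcoeffM mulr_sumr.
by apply: eq_bigr => i _; rewrite coefZ mulrCA.
Qed.

Lemma pa_mulrP x (c : k) y z : x * (c *: y + z) = c *: (x * y) + x * z.
Proof. by rewrite mulrDr -[X in X + _ = _]scale_pathalgAr. Qed.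

Lemma pa_mullP (c : k) y z x : (c *: y + z) * x = c *: (y * x) + z * x.
Proof. by rewrite mulrDl -[X in X + _ = _]scale_pathalgAl. Qed.

End Coefficients.

(** * The length grading and homogeneous components *)

Section Degrees.
Variables (k : fieldType) (Q : quiver).
Implicit Types (x y z : pathalg k Q) (p q r : qpath Q) (u : Q) (n m : int).

Lemma pa_degP n x :
  pa_deg n x <-> forall p, x@_p != 0 -> (plen p)%:Z = n.
Proof.
case: n => n /=; last first.
  split=> [->|h]; first by move=> p; rewrite coef0 eqxx.
  apply: pa_eqP => p; rewrite coef0; apply/eqP; apply: contraT => /h; done.
by split=> h p; [rewrite mcoeff_neq0 => /h -> | rewrite -mcoeff_neq0 => /h[]].
Qed.

Lemma pa_deg0 n : pa_deg n (0 : pathalg k Q).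
Proof. by apply/pa_degP => p; rewrite coef0 eqxx. Qed.

Lemma pa_degD n x y : pa_deg n x -> pa_deg n y -> pa_deg n (x + y).
Proof.
move=> /pa_degP hx /pa_degP hy; apply/pa_degP => p; rewrite coefD.
by case: (eqVneq (x@_p) 0) => [->|/hx //]; rewrite add0r; apply: hy.
Qed.

Lemma pa_degZ n c x : pa_deg n x -> pa_deg n (c *: x).
Proof.
move=> /pa_degP hx; apply/pa_degP => p; rewrite coefZ mulf_eq0 negb_or.
by case/andP=> _ /hx.
Qed.

Lemma pa_degN n x : pa_deg n x -> pa_deg n (- x).
Proof. by rewrite -scaleN1r; apply: pa_degZ. Qed.

Lemma pa_degB n x y : pa_deg n x -> pa_deg n y -> pa_deg n (x - y).
Proof. by move=> hx hy; apply: pa_degD => //; apply: pa_degN. Qed.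

Lemma pa_deg_sum n (J : Type) (s : seq J) (P : pred J) (F : J -> pathalg k Q) :
  (forall j, P j -> pa_deg n (F j)) -> pa_deg n (\sum_(j <- s | P j) F j).
Proof. by move=> h; apply: (big_ind (pa_deg n)); [exact: pa_deg0| exact: pa_degD|]. Qed.

Lemma pa_degM n m x y : pa_deg n x -> pa_deg m y -> pa_deg (n + m) (x * y).
Proof.
move=> /pa_degP hx /pa_degP hy; apply/pa_degP => r /mcoeffM_pcat[p [q [h]]].
by move=> /hx <- /hy <-; rewrite (plen_pcat h) PoszD.
Qed.

Lemma pa_degU (c : k) p : pa_deg (plen p)%:Z (mono c p).
Proof.
by apply/pa_degP => q /coef_mono_neq0 ->.
Qed.

Lemma pa_deg_vtx u : pa_deg 0 (vtx k u).
Proof. exact: pa_degU. Qed.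

Definition hcomp (n : int) x : pathalg k Q :=
  \sum_(p <- msupp x | (plen p)%:Z == n) mono (x@_p) p.

Lemma coef_hcomp n x p : (hcomp n x)@_p = if (plen p)%:Z == n then x@_p else 0.
Proof.
rewrite /hcomp coef_sum; case: ifP => h; last first.
  by rewrite big1 // => q hq; rewrite coef_mono; case: eqP => // e; rewrite e h in hq.
rewrite -[RHS]sum_supp_pred1 big_mkcond; apply: eq_bigr => q _.
by rewrite coef_mono; case: (q =P p) => [->|]; rewrite ?h // if_same.
Qed.

Lemma hcompP n a x y : hcomp n (a *: x + y) = a *: hcomp n x + hcomp n y.
Proof.
apply: pa_eqP => p; rewrite [RHS]coefP [LHS]coef_hcomp coefP.
rewrite [X in _ = a * X + _]coef_hcomp [X in _ = _ + X]coef_hcomp.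
by case: ifP; rewrite // mulr0 addr0.
Qed.

Lemma hcomp_sumE n (J : Type) (s : seq J) (P : pred J) (F : J -> pathalg k Q) :
  hcomp n (\sum_(j <- s | P j) F j) = \sum_(j <- s | P j) hcomp n (F j).
Proof.
apply: pa_eqP => p; rewrite [LHS]coef_hcomp [RHS]coef_sum [X in if _ then X else _]coef_sum.
by under [RHS]eq_bigr => j _ do rewrite coef_hcomp; case: ifP; rewrite // big1.
Qed.

Lemma pa_deg_hcomp n x : pa_deg n (hcomp n x).
Proof.
by apply/pa_degP => p; rewrite coef_hcomp; case: (_ =P n) => // _; rewrite eqxx.
Qed.

Lemma hcomp_id n x : pa_deg n x -> hcomp n x = x.
Proof.
move=> /pa_degP h; apply: pa_eqP => p; rewrite coef_hcomp; case: eqP => // ne.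
by apply/esym/eqP; apply: contraT => /h.
Qed.

Lemma hcomp_out n m x : pa_deg n x -> n != m -> hcomp m x = 0.
Proof.
move=> /pa_degP h ne; apply: pa_eqP => p; rewrite coef_hcomp coef0.
case: eqP => // e; apply/eqP; apply: contraT => /h.
by rewrite e => e'; rewrite e' eqxx in ne.
Qed.

Lemma hcomp_neg n x : (n < 0)%R -> hcomp n x = 0.
Proof. by case: n => // n _; exact: (pa_deg_hcomp (Negz n) x). Qed.

(** Stated for every larger range, because comparing two ranges later yields the vanishing of the
    high components in the quotient. *)
Lemma hcomp_sum x : exists N : nat, forall N', (N <= N')%N ->
  x = \sum_(i < N') hcomp i x.
Proof.
exists (\max_(p <- msupp x) plen p).+1 => N' hN; apply: pa_eqP => p; rewrite coef_sum.
under eq_bigr => i _ do rewrite coef_hcomp.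
case: (boolP (p \in msupp x)) => hp; last first.
  by rewrite (mcoeff_outdom hp) big1 // => i _; rewrite if_same.
have lp : (plen p < N')%N.
  by apply: leq_trans hN; rewrite ltnS (big_rem p) //= leq_maxl.
rewrite (bigD1 (Ordinal lp)) //= eqxx big1 ?addr0 // => i; rewrite -val_eqE /=.
by rewrite eqz_nat eq_sym => /negPf ->.
Qed.

Lemma hcompM_homl n m g x : pa_deg m g -> hcomp n (g * x) = g * hcomp (n - m) x.
Proof.
move=> hg; have [N /(_ N (leqnn N)) hN] := hcomp_sum x.
rewrite {1}hN {2}hN mulr_sumr !hcomp_sumE mulr_sumr; apply: eq_bigr => i _.
have hi : pa_deg (m + i%:Z) (g * hcomp i x) by apply: pa_degM (pa_deg_hcomp _ _).
have [e|ne] := eqVneq (n - m) i%:Z.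
  rewrite e [LHS]hcomp_id; last by rewrite -(subrK m n) e addrC.
  by rewrite [X in _ = _ * X](hcomp_id (pa_deg_hcomp _ _)).
rewrite [LHS](hcomp_out hi); last by apply: contra ne => /eqP <-; rewrite addrAC subrr add0r.
by rewrite (hcomp_out (pa_deg_hcomp i x)) ?mulr0 // eq_sym.
Qed.

Lemma hcompM_homr n m g x : pa_deg m g -> hcomp n (x * g) = hcomp (n - m) x * g.
Proof.
move=> hg; have [N /(_ N (leqnn N)) hN] := hcomp_sum x.
rewrite {1}hN {2}hN mulr_suml !hcomp_sumE mulr_suml; apply: eq_bigr => i _.
have hi : pa_deg (i%:Z + m) (hcomp i x * g) by apply: pa_degM (pa_deg_hcomp _ _) _.
have [e|ne] := eqVneq (n - m) i%:Z.
  rewrite e [LHS]hcomp_id; last by rewrite -(subrK m n) e.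
  by rewrite [X in _ = X * _](hcomp_id (pa_deg_hcomp _ _)).
rewrite [LHS](hcomp_out hi); last by apply: contra ne => /eqP <-; rewrite addrK.
by rewrite (hcomp_out (pa_deg_hcomp i x)) ?mul0r // eq_sym.
Qed.

End Degrees.

(** * Programs *)

(* Programs are read as expressions evaluated in an environment, a
   right-nested list of trees; Foldl, Foldr, Map and Filter bind the current
   element (and accumulator) at the head of the environment of their body. *)
Definition Id := Elem OpId.
Definition Empty := Elem OpNil.
Definition Fst (e : prog) := Seq e (Elem OpHead).
Definition Snd (e : prog) := Seq e (Elem OpTail).
Fixpoint Var (n : nat) : prog :=
  if n is n'.+1 then Seq (Elem OpTail) (Var n') else Elem OpHead.
Fixpoint Up (n : nat) : prog :=
  if n is n'.+1 then Seq (Elem OpTail) (Up n') else Id.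
Arguments Var : simpl never.
Arguments Up : simpl never.
Definition Op2 (o : elem_op) (e1 e2 : prog) := Seq (Pair e1 e2) (Elem o).
Definition Let (e b : prog) := Seq (Pair e Id) b.
Definition True_ := Pair Empty Empty.
(** The only scalar constant among the elementary operations is 1, so 0 is computed as 1 - 1. *)
Definition Zero := Op2 OpAdd (Elem OpOne) (Seq (Elem OpOne) (Elem OpOpp)).

(** The loop state is the pair of (remaining list, accumulator) and the outer environment. A
    nonempty list is a [Node], so the remaining list itself is the loop condition. *)
Definition Foldl (l a b : prog) : prog :=
  Seq (Pair (Pair l a) Id)
  (Seq (While (Seq (Elem OpHead) (Elem OpHead))
    (Pair (Pair (Snd (Seq (Elem OpHead) (Elem OpHead)))
             (Seq (Pair (Fst (Seq (Elem OpHead) (Elem OpHead)))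
                     (Pair (Snd (Elem OpHead)) (Elem OpTail))) b))
       (Elem OpTail)))
  (Snd (Elem OpHead))).
Definition Rev (l : prog) := Foldl l Empty (Pair (Var 0) (Var 1)).
Definition Foldr (l a b : prog) := Foldl (Rev l) a b.
Definition Cat (l m : prog) := Foldr l m (Pair (Var 0) (Var 1)).
Definition Map (l b : prog) :=
  Foldr l Empty (Pair (Seq (Pair (Var 0) (Up 2)) b) (Var 1)).
Definition Filter (l b : prog) :=
  Foldr l Empty (If (Seq (Pair (Var 0) (Up 2)) b) (Pair (Var 0) (Var 1)) (Var 1)).
Definition FlatMap (l b : prog) :=
  Foldr l Empty (Cat (Seq (Pair (Var 0) (Up 2)) b) (Var 1)).
(** The second list is consumed inside the accumulator, next to the pairs found so far; these are
    collected backwards, whence the final reversal. *)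
Definition Zip (l m : prog) :=
  Rev (Snd (Foldl l (Pair m Empty)
    (If (Fst (Var 1))
        (Pair (Snd (Fst (Var 1)))
              (Pair (Pair (Var 0) (Fst (Fst (Var 1)))) (Snd (Var 1))))
        (Var 1)))).

Section RunLemmas.
Variables (k : fieldType) (Q : quiver) (lt : rel (qpath Q)).
Local Notation T := (tree k (qpath Q)).
Local Notation TNil := (@Defs.Nil k (qpath Q)).
Local Notation run := (run lt).
Implicit Types (x y z env : T) (e b : prog).

Definition enc_pair (X Y : Type) (eX : X -> T) (eY : Y -> T) (p : X * Y) : T :=
  Node (eX p.1) (eY p.2).
Definition enc_term : k * qpath Q -> T := enc_pair (@Scalar k _) (@Path k _).

Lemma run_id x : run Id x x. Proof. exact: RunElem. Qed.
Lemma run_empty x : run Empty x TNil. Proof. exact: RunElem. Qed.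
Lemma run_fst e x y z : run e x (Node y z) -> run (Fst e) x y.
Proof. by move=> h; apply: (RunSeq h); apply: RunElem. Qed.
Lemma run_snd e x y z : run e x (Node y z) -> run (Snd e) x z.
Proof. by move=> h; apply: (RunSeq h); apply: RunElem. Qed.
Lemma run_var0 x y : run (Var 0) (Node x y) x. Proof. exact: RunElem. Qed.
Lemma run_varS n x y z : run (Var n) y z -> run (Var n.+1) (Node x y) z.
Proof. by move=> h; apply: RunSeq h; apply: RunElem. Qed.
Lemma run_up0 x : run (Up 0) x x. Proof. exact: RunElem. Qed.
Lemma run_upS n x y z : run (Up n) y z -> run (Up n.+1) (Node x y) z.
Proof. by move=> h; apply: RunSeq h; apply: RunElem. Qed.
Lemma run_let e b x y z : run e x y -> run b (Node y x) z -> run (Let e b) x z.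
Proof. by move=> h; apply: RunSeq; apply: RunPair => //; apply: RunElem. Qed.
Lemma run_true x : run True_ x (of_bool _ _ true).
Proof. by apply: RunPair; apply: RunElem. Qed.

Lemma run_op2 o e1 e2 x y z : run e1 x y -> run e2 x z ->
  run (Op2 o e1 e2) x (elem_sem lt o (Node y z)).
Proof. by move=> h1 h2; apply: RunSeq (RunPair h1 h2) (RunElem _ _ _). Qed.

Lemma run_add e1 e2 x (c d : k) : run e1 x (Scalar c) -> run e2 x (Scalar d) ->
  run (Op2 OpAdd e1 e2) x (Scalar (c + d)).
Proof. exact: run_op2. Qed.
Lemma run_mul e1 e2 x (c d : k) : run e1 x (Scalar c) -> run e2 x (Scalar d) ->
  run (Op2 OpMul e1 e2) x (Scalar (c * d)).
Proof. exact: run_op2. Qed.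
Lemma run_opp e x (c : k) : run e x (Scalar c) ->
  run (Seq e (Elem OpOpp)) x (Scalar (- c)).
Proof. by move=> h; apply: RunSeq h (RunElem _ _ _). Qed.
Lemma run_inv e x (c : k) : run e x (Scalar c) ->
  run (Seq e (Elem OpInv)) x (Scalar c^-1).
Proof. by move=> h; apply: RunSeq h (RunElem _ _ _). Qed.
Lemma run_eq e1 e2 x (c d : k) : run e1 x (Scalar c) -> run e2 x (Scalar d) ->
  run (Op2 OpEq e1 e2) x (of_bool _ _ (c == d)).
Proof. exact: run_op2. Qed.
Lemma run_lt e1 e2 x p q : run e1 x (Path p) -> run e2 x (Path q) ->
  run (Op2 OpLt e1 e2) x (of_bool _ _ (lt p q)).
Proof. exact: run_op2. Qed.
Lemma run_cat_path e1 e2 x p q : run e1 x (Path p) -> run e2 x (Path q) ->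
  run (Op2 OpCat e1 e2) x (if pcat p q is Some r then Path r else TNil).
Proof. exact: run_op2. Qed.
Lemma run_zero x : run Zero x (Scalar 0).
Proof.
rewrite -(subrr (1 : k)); apply: run_add; first exact: RunElem.
by apply: run_opp; apply: RunElem.
Qed.
Lemma run_one x : run (Elem OpOne) x (Scalar 1). Proof. exact: RunElem. Qed.

Lemma run_if c A B x (t : bool) z : run c x (of_bool _ _ t) ->
  (t -> run A x z) -> (~~ t -> run B x z) -> run (If c A B) x z.
Proof.
case: t => h hA hB; first by apply: RunThen h _ (hA _).
by apply: RunElse h _ (hB _).
Qed.

(** A zero product of paths is returned as [Nil], so the result of a concatenation doubles as the
    test whether it is defined. *)
Lemma run_if_cat c A B x (o : option (qpath Q)) z :
  run c x (if o is Some r then Path r else TNil) ->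
  (forall r, o = Some r -> run A x z) -> (o = None -> run B x z) -> run (If c A B) x z.
Proof.
case: o => [r|] h hA hB; first by apply: RunThen h _ (hA r _).
by apply: RunElse h _ (hB _).
Qed.

Lemma run_if_seq (X : Type) (eX : X -> T) c A B x s z : run c x (enc_seq eX s) ->
  (forall (y : X) s', s = y :: s' -> run A x z) -> (s = [::] -> run B x z) ->
  run (If c A B) x z.
Proof.
case: s => [|y s] h hA hB; first by apply: RunElse h _ (hB _).
by apply: RunThen h _ (hA y s _).
Qed.

Lemma run_foldl (X Acc : Type) (eX : X -> T) (eA : Acc -> T) l a b env s a0
    (step : Acc -> X -> Acc) :
  run l env (enc_seq eX s) -> run a env (eA a0) ->
  (forall v w, run b (Node (eX v) (Node (eA w) env)) (eA (step w v))) ->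
  run (Foldl l a b) env (eA (foldl step a0 s)).
Proof.
move=> hl ha hb; apply: RunSeq.
  by apply: RunPair; [apply: RunPair hl ha | apply: RunElem].
apply: (@RunSeq _ _ _ _ _ _ (Node (Node TNil (eA (foldl step a0 s))) env)); last first.
  by apply: RunSeq; apply: RunElem.
elim: s a0 {hl ha} => [|v s IH] a0 /=.
  by apply: (@RunStop _ _ _ _ _ _ TNil) => //; apply: RunSeq; apply: RunElem.
apply: (RunLoop (c := Node (eX v) (enc_seq eX s))) (IH _) => //.
  by apply: RunSeq; apply: RunElem.
apply: RunPair; last exact: RunElem.
apply: RunPair.
  by apply: (run_snd (y := eX v)); apply: RunSeq; apply: RunElem.
apply: RunSeq (hb _ _); apply: RunPair.
  by apply: (run_fst (z := enc_seq eX s)); apply: RunSeq; apply: RunElem.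
apply: RunPair; last exact: RunElem.
by apply: RunSeq; apply: RunElem.
Qed.

Lemma run_rev (X : Type) (eX : X -> T) l env s :
  run l env (enc_seq eX s) -> run (Rev l) env (enc_seq eX (rev s)).
Proof.
move=> h; have -> : rev s = foldl (fun w v => v :: w) [::] s.
  by rewrite -{2}(revK s) foldl_rev; elim: (rev s) => //= v w <-.
apply: run_foldl h (run_empty _) _ => v w.
by apply: RunPair; [apply: run_var0 | apply: run_varS (run_var0 _ _)].
Qed.

Lemma run_foldr (X Acc : Type) (eX : X -> T) (eA : Acc -> T) l a b env s a0
    (step : X -> Acc -> Acc) :
  run l env (enc_seq eX s) -> run a env (eA a0) ->
  (forall v w, run b (Node (eX v) (Node (eA w) env)) (eA (step v w))) ->
  run (Foldr l a b) env (eA (foldr step a0 s)).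
Proof.
move=> hl ha hb; rewrite -foldl_rev.
by apply: run_foldl (run_rev hl) ha _ => v w; apply: hb.
Qed.

Lemma run_cons (X : Type) (eX : X -> T) e1 e2 env v s : run e1 env (eX v) ->
  run e2 env (enc_seq eX s) -> run (Pair e1 e2) env (enc_seq eX (v :: s)).
Proof. exact: RunPair. Qed.

Lemma run_cat (X : Type) (eX : X -> T) l m env s t :
  run l env (enc_seq eX s) -> run m env (enc_seq eX t) ->
  run (Cat l m) env (enc_seq eX (s ++ t)).
Proof.
move=> hl hm; have -> : s ++ t = foldr cons t s by elim: s {hl} => //= v s ->.
apply: run_foldr hl hm _ => v w.
by apply: run_cons; [apply: run_var0 | apply: run_varS (run_var0 _ _)].
Qed.

(** Inside a fold the environment starts with the element and the accumulator; [Up 2] hides the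
    accumulator from the body of [Map], [Filter], [FlatMap] and [Diag]. *)
Lemma run_under b v w env z : run b (Node v env) z ->
  run (Seq (Pair (Var 0) (Up 2)) b) (Node v (Node w env)) z.
Proof.
apply: RunSeq; apply: RunPair; first exact: run_var0.
by do 2!apply: run_upS; apply: run_up0.
Qed.

Lemma run_map (X Y : Type) (eX : X -> T) (eY : Y -> T) l b env s (f : X -> Y) :
  run l env (enc_seq eX s) ->
  (forall v, run b (Node (eX v) env) (eY (f v))) ->
  run (Map l b) env (enc_seq eY (map f s)).
Proof.
move=> hl hb; have -> : map f s = foldr (fun v => cons (f v)) [::] s by [].
apply: run_foldr hl (run_empty _) _ => v w.
by apply: run_cons; [apply: run_under | apply: run_varS (run_var0 _ _)].
Qed.

Lemma run_filter (X : Type) (eX : X -> T) l b env s (f : X -> bool) :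
  run l env (enc_seq eX s) ->
  (forall v, run b (Node (eX v) env) (of_bool _ _ (f v))) ->
  run (Filter l b) env (enc_seq eX (filter f s)).
Proof.
move=> hl hb.
have -> : filter f s = foldr (fun v w => if f v then v :: w else w) [::] s.
  by elim: s {hl} => //= v s ->.
apply: run_foldr hl (run_empty _) _ => v w.
apply: run_if (run_under _ (hb v)) _ _ => [->|/negPf->]; last first.
  exact: run_varS (run_var0 _ _).
by apply: run_cons; [apply: run_var0 | apply: run_varS (run_var0 _ _)].
Qed.

Lemma run_flatmap (X Y : Type) (eX : X -> T) (eY : Y -> T) l b env s (f : X -> seq Y) :
  run l env (enc_seq eX s) ->
  (forall v, run b (Node (eX v) env) (enc_seq eY (f v))) ->
  run (FlatMap l b) env (enc_seq eY (flatten (map f s))).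
Proof.
move=> hl hb.
have -> : flatten (map f s) = foldr (fun v w => f v ++ w) [::] s.
  by elim: s {hl} => //= v s ->.
apply: run_foldr hl (run_empty _) _ => v w.
by apply: run_cat; [apply: run_under | apply: run_varS (run_var0 _ _)].
Qed.

Lemma run_zip (X Y : Type) (eX : X -> T) (eY : Y -> T) l m env s t :
  run l env (enc_seq eX s) -> run m env (enc_seq eY t) ->
  run (Zip l m) env (enc_seq (enc_pair eX eY) (zip s t)).
Proof.
move=> hl hm; pose eA := enc_pair (enc_seq eY) (enc_seq (enc_pair eX eY)).
pose step (a : seq Y * seq (X * Y)) v :=
  if a.1 is y :: t' then (t', (v, y) :: a.2) else a.
have E u : rev (foldl step (t, u) s).2 = rev u ++ zip s t.
  elim: s t u {hl hm} => [|v s IH] [|y t] u; rewrite /= ?cats0 //.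
    by rewrite IH; case: (s); rewrite /= ?cats0.
  by rewrite /step /= -/step IH rev_cons cat_rcons.
rewrite -[zip s t]/(rev [::] ++ zip s t) -E; apply: run_rev.
apply: (@run_snd _ _ (enc_seq eY (foldl step (t, [::]) s).1)).
apply: (run_foldl (eA := eA) (step := step) hl).
  by apply: RunPair hm (run_empty _).
move=> v [[|y t'] u].
  apply: (@RunElse _ _ _ _ _ _ _ TNil) => //; last exact: run_varS (run_var0 _ _).
  by apply: run_fst; apply: run_varS (run_var0 _ _).
apply: (@RunThen _ _ _ _ _ _ _ (Node (eY y) (enc_seq eY t'))) => //.
  by apply: run_fst; apply: run_varS (run_var0 _ _).
have h1 : run (Fst (Var 1)) (Node (eX v) (Node (eA (y :: t', u)) env))
   (Node (eY y) (enc_seq eY t')) by apply: run_fst; apply: run_varS (run_var0 _ _).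
apply: RunPair; first exact: run_snd h1.
apply: RunPair; last by apply: run_snd; apply: run_varS (run_var0 _ _).
by apply: RunPair; [apply: run_var0 | apply: run_fst h1].
Qed.

End RunLemmas.

(** * Program text of the elimination and of the syzygy algorithm *)

Definition Call1 P e1 := Seq (Pair e1 Id) P.
Definition Call2 P e1 e2 := Seq (Pair e1 (Pair e2 Id)) P.
Definition Call3 P e1 e2 e3 := Seq (Pair e1 (Pair e2 (Pair e3 Id))) P.

(** Paths can only be compared by the order; by totality, two paths are equal when neither is below
    the other. *)
Definition PathEq e1 e2 :=
  If (Op2 OpLt e1 e2) Empty (If (Op2 OpLt e2 e1) Empty True_).
Definition Coef := Foldr (Var 1) Zero
  (If (PathEq (Var 2) (Snd (Var 0))) (Op2 OpAdd (Fst (Var 0)) (Var 1)) (Var 1)).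
(** The coordinates are read backwards because [eps_lt] breaks ties in favour of the larger index:
    for a decreasing list of paths the columns then form a decreasing list of basis elements, and a
    first nonzero entry is a tip. *)
Definition Dense :=
  FlatMap (Var 0) (Map (Rev (Var 2)) (Call2 Coef (Var 1) (Var 0))).
Definition ScaleT :=
  Map (Var 1) (Pair (Op2 OpMul (Var 1) (Fst (Var 0))) (Snd (Var 0))).
Definition VSub := Map (Zip (Var 1) (Var 2))
  (Op2 OpAdd (Fst (Var 0)) (Seq (Op2 OpMul (Var 1) (Snd (Var 0))) (Elem OpOpp))).
Definition TSub := Map (Zip (Var 1) (Var 2))
  (Cat (Fst (Var 0)) (Call2 ScaleT (Seq (Var 1) (Elem OpOpp)) (Snd (Var 0)))).
Definition Reduce :=
  If (Fst (Var 0))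
    (If (Op2 OpEq (Fst (Fst (Var 0))) Zero)
      (Pair (Fst (Var 1)) (Pair (Pair (Snd (Fst (Var 0))) (Snd (Var 0))) (Snd (Var 1))))
      (If (Fst (Var 1))
        (Pair (Fst (Var 1))
          (Pair (Let (Op2 OpMul (Fst (Fst (Var 0)))
                        (Seq (Fst (Fst (Fst (Var 1)))) (Elem OpInv)))
                  (Pair (Call3 VSub (Var 0) (Snd (Fst (Var 1)))
                           (Fst (Snd (Fst (Fst (Var 2))))))
                        (Call3 TSub (Var 0) (Snd (Var 1))
                           (Snd (Snd (Fst (Fst (Var 2))))))))
                (Snd (Var 1))))
        (Pair (Pair (Pair (Fst (Fst (Var 0))) (Pair (Snd (Fst (Var 0))) (Snd (Var 0))))
                    Empty)
              (Snd (Var 1)))))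
    (Var 1).
Definition Step :=
  Let (Foldr (Snd (Var 0)) (Pair Empty Empty) Reduce)
    (Pair (Cat (Map (Fst (Var 0)) (Snd (Snd (Var 0)))) (Fst (Var 1))) (Snd (Var 0))).
(** The coefficients of the first row serve only as a counter: one step is made per column. *)
Definition Elim :=
  Foldr (Fst (Fst (Var 0))) (Pair Empty (Var 0)) (Call1 Step (Var 1)).
(** Each family is its own tag, so the tags of the pivots are the reduced families; the rows left
    over are dropped. *)
Definition Echelon := Fst (Call1 Elim
  (Map (Var 1) (Pair (Call2 Dense (Var 1) (Var 0)) (Var 0)))).
Definition Insert := Cat (Filter (Var 1) (Op2 OpLt (Var 1) (Var 0)))
  (Pair (Var 0) (Filter (Var 1) (If (Op2 OpLt (Var 1) (Var 0)) Empty True_))).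
Definition Sort := Foldr (Var 0) Empty (Call2 Insert (Var 0) (Var 1)).
Definition MulR := FlatMap (Var 0) (Let (Op2 OpCat (Snd (Var 0)) (Var 2))
  (If (Var 0) (Pair (Pair (Fst (Var 1)) (Var 0)) Empty) Empty)).
Definition MulL := FlatMap (Var 1) (Let (Op2 OpCat (Var 1) (Snd (Var 0)))
  (If (Var 0) (Pair (Pair (Fst (Var 1)) (Var 0)) Empty) Empty)).
Definition Comp2 := FlatMap (Var 0) (FlatMap (Var 1)
  (Let (Op2 OpCat (Var 1) (Var 0)) (If (Var 0) (Pair (Var 0) Empty) Empty))).
Definition NonZero :=
  Foldr (Var 0) Empty (If (Op2 OpEq (Var 0) Zero) (Var 1) True_).
Definition Diag l b := Snd (Foldr l (Pair Empty Empty)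
  (Pair (Pair Empty (Fst (Var 1)))
    (Cat (Map (Seq (Pair (Var 0) (Up 2)) b)
            (Pair (Fst (Var 0)) (Pair (Snd (Var 0)) (Fst (Var 2)))))
         (Map (Snd (Var 1)) (Pair (Fst (Var 0)) (Pair Empty (Snd (Var 0)))))))).

(* The pairs (family over the v_i, family over the f^1_l) in which the
   elimination is carried out are y g x in a coordinate, for a generator g and
   vertices x, y, tagged with 0, and f^1_l a, for an arrow a, tagged with a in
   coordinate l. The tags of the combinations whose first component is 0 span
   the linear relations modulo I. *)
Definition SyzygyProgram :=
  Let (Map (Snd (Fst Id)) (Fst (Var 0)))
  (Let (Fst (Fst (Up 1)))
  (Let (Call1 Sort (Var 1))
  (Let (Call2 Echelon (Var 0) (Fst (Snd (Snd (Up 3)))))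
  (Let (Call1 Comp2 (Var 3))
  (Let (Map (Var 1) Empty)
  (Let (FlatMap (Fst (Snd (Up 6)))
         (FlatMap (Var 5)
           (Map (Var 6) (Call2 MulR (Call2 MulL (Var 1) (Var 2)) (Var 0)))))
  (Let (Map (Diag (Fst (Snd (Snd (Snd (Up 7))))) (Map (Var 1) (Pair (Var 3) (Var 0))))
         (Pair (Snd (Var 0)) (Fst (Var 0))))
  (Let (Diag (Var 4) (Map (Var 8)
         (Pair (Map (Var 1) (Call2 MulR (Var 0) (Var 1)))
               (Pair (Pair (Elem OpOne) (Var 0)) Empty))))
  (Let (Filter (Map (Cat (Var 1) (Var 0))
                 (Pair (Call2 Dense (Var 5) (Fst (Var 0))) (Snd (Var 0))))
         (Call1 NonZero (Fst (Var 0))))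
  (Pair (Var 6)
    (Call2 Echelon (Var 7) (Map (Snd (Call1 Elim (Var 0))) (Snd (Var 0)))))))))))))).

(** * List functions computed by the programs *)

Section Algorithm.
Variables (k : fieldType) (Q : quiver) (lt : rel (qpath Q)).
Local Notation T := (tree k (qpath Q)).
Local Notation TNil := (@Defs.Nil k (qpath Q)).
Local Notation run := (@Defs.run k Q lt).
Implicit Types (env : T) (e P : prog).
Local Notation eP := (@Path k (qpath Q)).
Local Notation eS := (@Scalar k (qpath Q)).
Local Notation eT := (@enc_terms k Q).
Local Notation eF := (enc_seq (@enc_terms k Q)).
Local Notation fam := (seq (terms k Q)).

Definition same_path (p q : qpath Q) := ~~ lt p q && ~~ lt q p.

Definition coefs (p : qpath Q) (s : terms k Q) : k :=
  foldr (fun t c => if same_path p t.2 then t.1 + c else c) 0 s.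

Definition dense (ps : seq (qpath Q)) (x : fam) : seq k :=
  flatten [seq [seq coefs p s | s <- rev x] | p <- ps].

Definition scale_terms (c : k) (s : terms k Q) : terms k Q :=
  [seq (c * t.1, t.2) | t <- s].

Definition vsub (c : k) (u v : seq k) : seq k :=
  [seq xy.1 - c * xy.2 | xy <- zip u v].

(** Like terms are not collected. Only the value under [pa_of_terms] matters, and [coefs] adds up
    all occurrences of a path. *)
Definition tsub (c : k) (s t : fam) : fam :=
  [seq xy.1 ++ scale_terms (- c) xy.2 | xy <- zip s t].

Definition row := (seq k * fam)%type.

(* One column of Gaussian elimination: a row is a list of coefficients
   together with a tag carried along by the row operations; the accumulator
   holds the pivot row, if one has been met, and the remaining rows. *)
Definition reduce (r : row) (a : seq (k * row) * seq row) : seq (k * row) * seq row :=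
  if r.1 is h :: v then
    if h == 0 then (a.1, (v, r.2) :: a.2)
    else if a.1 is q :: _ then
      (a.1, (vsub (h * q.1^-1) v q.2.1, tsub (h * q.1^-1) r.2 q.2.2) :: a.2)
    else ([:: (h, (v, r.2))], a.2)
  else a.

Definition step (st : seq fam * seq row) : seq fam * seq row :=
  let a := foldr reduce ([::], [::]) st.2 in
  ([seq q.2.2 | q <- a.1] ++ st.1, a.2).

Definition elim (rows : seq row) : seq fam * seq row :=
  foldr (fun _ st => step st) ([::], rows) (head ([::], [::]) rows).1.

Definition echelon (ps : seq (qpath Q)) (xs : seq fam) : seq fam :=
  (elim [seq (dense ps x, x) | x <- xs]).1.

Definition insert (p : qpath Q) (s : seq (qpath Q)) : seq (qpath Q) :=
  [seq q <- s | lt p q] ++ p :: [seq q <- s | ~~ lt p q].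

Definition sort_paths (s : seq (qpath Q)) : seq (qpath Q) := foldr insert [::] s.

Definition mulr_terms (s : terms k Q) (a : qpath Q) : terms k Q :=
  flatten [seq (if pcat t.2 a is Some r then [:: (t.1, r)] else [::]) | t <- s].

Definition mull_terms (a : qpath Q) (s : terms k Q) : terms k Q :=
  flatten [seq (if pcat a t.2 is Some r then [:: (t.1, r)] else [::]) | t <- s].

Definition paths2 (s : seq (qpath Q)) : seq (qpath Q) :=
  flatten [seq flatten [seq (if pcat a b is Some r then [:: r] else [::]) | b <- s]
          | a <- s].

Definition diag_step (X Y : Type) (f : X -> seq (Y * terms k Q)) (x : X)
    (a : fam * seq (Y * fam)) : fam * seq (Y * fam) :=
  ([::] :: a.1,
   [seq (z.1, z.2 :: a.1) | z <- f x] ++ [seq (r.1, [::] :: r.2) | r <- a.2]).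

(* All families supported at one index, the entry at the index of x being
   taken from f x. *)
Definition diag (X Y : Type) (f : X -> seq (Y * terms k Q)) (s : seq X) :
    seq (Y * fam) :=
  (foldr (diag_step f) ([::], [::]) s).2.

Definition relations (V : seq (qpath Q)) (gens : seq (terms k Q)) : seq (terms k Q) :=
  flatten [seq flatten [seq [seq mulr_terms (mull_terms y g) x | x <- V] | y <- V]
          | g <- gens].

Definition relation_rows (X : Type) (V : seq (qpath Q)) (gens : seq (terms k Q))
    (z : fam) (v : seq X) : seq (fam * fam) :=
  [seq (r.2, r.1) | r <- diag (fun=> [seq (z, t) | t <- relations V gens]) v].

Definition product_rows (ars : seq (qpath Q)) (F : seq fam) : seq (fam * fam) :=
  diag (fun x => [seq ([seq mulr_terms s a | s <- x], [:: (1, a)]) | a <- ars]) F.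

(** If the arrow a does not start at the terminus of f^1_l, the product f^1_l a is zero, and its row
    would put the tag a into the kernel although a is not an admissible coefficient of f^1_l.
    Discarding the zero rows removes these tags; a zero relation row has zero tag and is no loss. *)
Definition syzygy_rows (ars : seq (qpath Q)) (rs : seq (fam * fam)) : seq row :=
  [seq r <- [seq (dense (paths2 ars) x.1, x.2) | x <- rs] | has (fun c => c != 0) r.1].

(** The tags of the kernel rows may be zero or dependent. The second elimination makes their tips
    distinct, which is what gives directness of f^2. *)
Definition syzygies (X : Type) (V ars : seq (qpath Q)) (gens : seq (terms k Q))
    (v : seq X) (F : seq fam) : seq fam :=
  echelon (sort_paths ars)
    [seq r.2 | r <- (elim (syzygy_rows ars
       (relation_rows V gens [seq [::] | _ <- F] v ++ product_rows ars F))).2].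

Ltac rv := repeat first [exact: run_var0 | exact: run_id | exact: run_up0
  | apply: run_varS | apply: run_upS | apply: run_fst | apply: run_snd].

Lemma run_call1 P e1 (x y z : T) : run e1 x y -> run P (Node y x) z -> run (Call1 P e1) x z.
Proof. by move=> h; apply: RunSeq; apply: RunPair (run_id _ _). Qed.

Lemma run_call2 P e1 e2 (x y1 y2 z : T) : run e1 x y1 -> run e2 x y2 ->
  run P (Node y1 (Node y2 x)) z -> run (Call2 P e1 e2) x z.
Proof.
by move=> h1 h2; apply: RunSeq; apply: RunPair => //; apply: RunPair (run_id _ _).
Qed.

Lemma run_call3 P e1 e2 e3 (x y1 y2 y3 z : T) : run e1 x y1 -> run e2 x y2 -> run e3 x y3 ->
  run P (Node y1 (Node y2 (Node y3 x))) z -> run (Call3 P e1 e2 e3) x z.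
Proof.
move=> h1 h2 h3; apply: RunSeq; do 2!apply: RunPair => //.
by apply: RunPair (run_id _ _).
Qed.

Lemma run_path_eq e1 e2 (x : T) p q : run e1 x (Path p) -> run e2 x (Path q) ->
  run (PathEq e1 e2) x (of_bool _ _ (same_path p q)).
Proof.
move=> h1 h2; rewrite /same_path; apply: run_if (run_lt h1 h2) _ _ => [->|->].
  exact: run_empty.
apply: run_if (run_lt h2 h1) _ _ => [->|->]; first exact: run_empty.
exact: run_true.
Qed.

Lemma run_coef p s env : run Coef (Node (eP p) (Node (eT s) env)) (eS (coefs p s)).
Proof.
apply: (run_foldr (eX := @enc_term k Q) (eA := eS)); [rv | exact: run_zero |].
move=> t c; apply: run_if (run_path_eq (p := p) (q := t.2) _ _) _ _; [rv | | |].
- by apply: (run_snd (y := eS t.1)); rv.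
- move=> ->; apply: run_add; last rv.
  by apply: (run_fst (z := eP t.2)); rv.
- by move=> /negPf ->; rv.
Qed.

Lemma run_dense ps x env :
  run Dense (Node (enc_seq eP ps) (Node (eF x) env)) (enc_seq eS (dense ps x)).
Proof.
apply: run_flatmap; first rv; move=> p.
apply: run_map; first by apply: run_rev; rv.
by move=> s; apply: run_call2 (run_coef _ _ _); rv.
Qed.

Lemma run_scale_terms c s env :
  run ScaleT (Node (eS c) (Node (eT s) env)) (eT (scale_terms c s)).
Proof.
apply: (run_map (eX := @enc_term k Q)); first rv; move=> t.
apply: RunPair; last by apply: (run_snd (y := eS t.1)); rv.
by apply: run_mul; [rv | apply: (run_fst (z := eP t.2)); rv].
Qed.

Lemma run_vsub c u v env :
  run VSub (Node (eS c) (Node (enc_seq eS u) (Node (enc_seq eS v) env)))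
    (enc_seq eS (vsub c u v)).
Proof.
apply: run_map; first by apply: run_zip; rv.
move=> [a b]; apply: run_add; first by apply: (run_fst (z := eS b)); rv.
by apply: run_opp; apply: run_mul; [rv | apply: (run_snd (y := eS a)); rv].
Qed.

Lemma run_tsub c s t env :
  run TSub (Node (eS c) (Node (eF s) (Node (eF t) env))) (eF (tsub c s t)).
Proof.
apply: run_map; first by apply: run_zip; rv.
move=> [a b]; apply: run_cat; first by apply: (run_fst (z := eT b)); rv.
apply: run_call2 (run_scale_terms _ _ _); first by apply: run_opp; rv.
by apply: (run_snd (y := eT a)); rv.
Qed.

Definition enc_row : row -> T := enc_pair (enc_seq eS) eF.
Definition enc_acc : seq (k * row) * seq row -> T :=
  enc_pair (enc_seq (enc_pair eS enc_row)) (enc_seq enc_row).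
Definition enc_state : seq fam * seq row -> T :=
  enc_pair (enc_seq eF) (enc_seq enc_row).

Lemma run_reduce r a env :
  run Reduce (Node (enc_row r) (Node (enc_acc a) env)) (enc_acc (reduce r a)).
Proof.
case: r a => [v t] [pv out].
have hr x : run (Var 0) (Node (enc_row (v, t)) x) (Node (enc_seq eS v) (eF t)) by rv.
have ha y x : run (Var 1) (Node y (Node (enc_acc (pv, out)) x))
  (Node (enc_seq (enc_pair eS enc_row) pv) (enc_seq enc_row out)) by rv.
apply: run_if_seq (run_fst (hr _)) _ _ => [h v' ev|ev]; last by rewrite ev; exact: ha.
rewrite ev /reduce /= in hr *.
apply: run_if (run_eq (run_fst (run_fst (hr _))) (run_zero _ _)) _ _ => [->|/negPf ->].
  apply: RunPair; first exact: run_fst (ha _ _).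
  apply: RunPair; last exact: run_snd (ha _ _).
  by apply: RunPair; [exact: run_snd (run_fst (hr _)) | exact: run_snd (hr _)].
case: pv ha => [|[h' [v0 t0]] pv'] ha.
  apply: (@RunElse _ _ _ _ _ _ _ TNil) => //; first exact: run_fst (ha _ _).
  apply: RunPair; last exact: run_snd (ha _ _).
  apply: RunPair; last exact: run_empty.
  apply: RunPair; first exact: run_fst (run_fst (hr _)).
  by apply: RunPair; [exact: run_snd (run_fst (hr _)) | exact: run_snd (hr _)].
apply: (@RunThen _ _ _ _ _ _ _
  (enc_seq (enc_pair eS enc_row) ((h', (v0, t0)) :: pv'))) => //.
  exact: run_fst (ha _ _).
apply: RunPair; first exact: run_fst (ha _ _).
apply: RunPair; last exact: run_snd (ha _ _).
apply: run_let.
  apply: run_mul; first exact: run_fst (run_fst (hr _)).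
  by apply: run_inv; apply: run_fst (run_fst (run_fst (ha _ _))).
apply: RunPair.
  apply: run_call3 (run_vsub _ _ _ _); first exact: run_var0.
    by apply: run_snd; apply: run_fst; apply: run_varS (hr _).
  by apply: run_fst; apply: run_snd; do 2!apply: run_fst; apply: run_varS (ha _ _).
apply: run_call3 (run_tsub _ _ _ _); first exact: run_var0.
  by apply: run_snd; apply: run_varS (hr _).
by do 2!apply: run_snd; do 2!apply: run_fst; apply: run_varS (ha _ _).
Qed.

Lemma run_step st env : run Step (Node (enc_state st) env) (enc_state (step st)).
Proof.
case: st => pivs rows.
have hs x : run (Var 0) (Node (enc_state (pivs, rows)) x)
  (Node (enc_seq eF pivs) (enc_seq enc_row rows)) by rv.
apply: run_let.
  apply: (run_foldr (eX := enc_row) (eA := enc_acc) (a0 := ([::], [::]))) => [||r a].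
  - exact: run_snd (hs _).
  - by apply: RunPair; exact: run_empty.
  - exact: run_reduce.
rewrite /step /=; set a := foldr _ _ _.
have ha x : run (Var 0) (Node (enc_acc a) x)
  (Node (enc_seq (enc_pair eS enc_row) a.1) (enc_seq enc_row a.2)) by rv.
apply: RunPair; last exact: run_snd (ha _).
apply: run_cat; last by apply: run_fst; apply: run_varS (hs _).
apply: run_map (run_fst (ha _)) _ => -[h [v t]].
by apply: (run_snd (y := enc_seq eS v)); apply: (run_snd (y := eS h)); rv.
Qed.

Lemma run_elim rows env :
  run Elim (Node (enc_seq enc_row rows) env) (enc_state (elim rows)).
Proof.
apply: (run_foldr (eX := eS) (eA := enc_state) (a0 := ([::], rows))) => [||c st].
(* On the empty list of rows [OpHead] applied to [Nil] gives [Nil], in agreement with the default of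
   [head]: no step is made. *)
- by case: rows => [|[v t] rows]; do ?apply: RunSeq; apply: RunElem.
- by apply: RunPair; [exact: run_empty | rv].
- by apply: run_call1 (run_step _ _); rv.
Qed.

Lemma run_echelon ps xs env :
  run Echelon (Node (enc_seq eP ps) (Node (enc_seq eF xs) env))
    (enc_seq eF (echelon ps xs)).
Proof.
rewrite /echelon; set rows := map _ _.
apply: (@run_fst _ _ _ _ _ _ (enc_seq enc_row (elim rows).2)).
apply: run_call1 (run_elim _ _); apply: run_map; first rv.
by move=> x; apply: RunPair; [apply: run_call2 (run_dense _ _ _); rv | rv].
Qed.

Lemma run_insert p s env :
  run Insert (Node (eP p) (Node (enc_seq eP s) env)) (enc_seq eP (insert p s)).
Proof.
apply: run_cat; first by apply: run_filter => [|q]; [rv | apply: run_lt; rv].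
apply: run_cons; first rv.
apply: run_filter => [|q]; first rv.
by apply: run_if (run_lt (p := p) (q := q) _ _) _ _; [rv | rv | move=> ->; exact: run_empty
  | move=> ->; exact: run_true].
Qed.

Lemma run_sort s env :
  run Sort (Node (enc_seq eP s) env) (enc_seq eP (sort_paths s)).
Proof.
apply: (run_foldr (eX := eP) (eA := enc_seq eP)); [rv | exact: run_empty |].
by move=> p t; apply: run_call2 (run_insert _ _ _); rv.
Qed.

Lemma run_mulr_terms s a env :
  run MulR (Node (eT s) (Node (eP a) env)) (eT (mulr_terms s a)).
Proof.
apply: (run_flatmap (eX := @enc_term k Q) (eY := @enc_term k Q)); first rv.
move=> [c p]; apply: run_let.
  apply: (run_cat_path (p := p) (q := a)); last rv.
  by apply: (run_snd (y := eS c)); rv.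
apply: run_if_cat; first rv; last by move=> ->; exact: run_empty.
move=> r -> /=; apply: RunPair; last exact: run_empty.
apply: RunPair; last rv.
by apply: (run_fst (z := eP p)); rv.
Qed.

Lemma run_mull_terms a s env :
  run MulL (Node (eP a) (Node (eT s) env)) (eT (mull_terms a s)).
Proof.
apply: (run_flatmap (eX := @enc_term k Q) (eY := @enc_term k Q)); first rv.
move=> [c p]; apply: run_let.
  apply: (run_cat_path (p := a) (q := p)); first rv.
  by apply: (run_snd (y := eS c)); rv.
apply: run_if_cat; first rv; last by move=> ->; exact: run_empty.
move=> r -> /=; apply: RunPair; last exact: run_empty.
apply: RunPair; last rv.
by apply: (run_fst (z := eP p)); rv.
Qed.

Lemma run_paths2 s env :
  run Comp2 (Node (enc_seq eP s) env) (enc_seq eP (paths2 s)).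
Proof.
apply: (run_flatmap (eX := eP)); first rv; move=> a.
apply: (run_flatmap (eX := eP)); first rv; move=> b.
apply: run_let; first by apply: (run_cat_path (p := a) (q := b)); rv.
apply: run_if_cat; first rv; last by move=> ->; exact: run_empty.
by move=> r -> /=; apply: RunPair; [rv | exact: run_empty].
Qed.

Lemma run_nonzero u env :
  run NonZero (Node (enc_seq eS u) env) (of_bool _ _ (has (fun c => c != 0) u)).
Proof.
have -> : has (fun c => c != 0) u = foldr (fun c b => if c == 0 then b else true) false u.
  by elim: u => //= c u ->; case: eqP.
apply: (run_foldr (eX := eS) (eA := of_bool _ _)); [rv | exact: run_empty |].
move=> c b; apply: run_if (run_eq (c := c) _ (run_zero _ _)) _ _; first rv.
  by move=> ->; rv.
by move=> /negPf ->; exact: run_true.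
Qed.

Lemma run_diag (X Y : Type) (eX : X -> T) (eY : Y -> T) f l b env s :
  run l env (enc_seq eX s) ->
  (forall x, run b (Node (eX x) env) (enc_seq (enc_pair eY eT) (f x))) ->
  run (Diag l b) env (enc_seq (enc_pair eY eF) (diag f s)).
Proof.
move=> hl hb; rewrite /diag; set a := foldr _ _ _.
apply: (@run_snd _ _ _ _ _ (eF a.1)).
pose eA := enc_pair eF (enc_seq (enc_pair eY eF)).
rewrite -[Node _ _]/(eA a).
apply: (run_foldr (eA := eA) (a0 := ([::], [::])) hl).
  by apply: RunPair; exact: run_empty.
move=> x [zs R].
have ha y : run (Var 1) (Node y (Node (eA (zs, R)) env))
  (Node (eF zs) (enc_seq (enc_pair eY eF) R)) by rv.
apply: RunPair.
  by apply: RunPair; [exact: run_empty | exact: run_fst (ha _)].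
apply: run_cat.
  apply: run_map (run_under _ (hb x)) _ => -[y t].
  apply: RunPair; first by apply: (run_fst (z := eT t)); rv.
  apply: run_cons; first by apply: (run_snd (y := eY y)); rv.
  by apply: run_fst; apply: run_varS (ha _).
apply: run_map (run_snd (ha _)) _ => -[y t].
apply: RunPair; first by apply: (run_fst (z := eF t)); rv.
by apply: RunPair; [exact: run_empty | apply: (run_snd (y := eY y)); rv].
Qed.

Lemma enc_seq_map (X Y : Type) (eY : Y -> T) (f : X -> Y) s :
  enc_seq eY (map f s) = enc_seq (fun x => eY (f x)) s.
Proof. by elim: s => //= x s ->. Qed.

Lemma run_syzygy_program (gens : seq (terms k Q)) (t0 t1 : nat) (v : 'I_t0 -> Q)
    (w : 'I_t1 -> Q) (mx : 'I_t1 -> 'I_t0 -> terms k Q) :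
  let ars := [seq arrow_path a | a <- enum (arrow Q)] in
  let V := [seq vertex_path u | u <- enum Q] in
  let F := echelon (sort_paths ars) [seq [seq mx l i | i <- enum 'I_t0] | l <- enum 'I_t1] in
  run SyzygyProgram (enc_input gens v w mx)
    (Node (enc_seq eF F)
      (enc_seq eF (syzygies V ars gens [seq v i | i <- enum 'I_t0] F))).
Proof.
move=> ars V F; rewrite /enc_input; set inp := Node _ _.
have hq e : run e inp inp -> run (Fst e) inp (enc_quiver k Q).
  by move=> h; apply: run_fst h.
pose mxs := [seq [seq mx l i | i <- enum 'I_t0] | l <- enum 'I_t1].
have emx : enc_matrix mx = enc_seq eF mxs.
  by rewrite /enc_matrix /enc_fam enc_seq_map [RHS]enc_seq_map.
apply: (run_let (y := enc_seq eP ars)).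
  apply: (run_map (eX := @enc_arrow k Q)).
    by apply: run_snd; apply: hq; exact: run_id.
  move=> a; apply: run_fst; exact: run_var0.
apply: (run_let (y := enc_seq eP V)).
  have -> : enc_seq eP V = enc_seq (@enc_vertex k Q) (enum Q) by exact: enc_seq_map.
  by apply: run_fst; apply: run_fst; rv.
apply: (run_let (y := enc_seq eP (sort_paths ars))).
  by apply: run_call1 (run_sort _ _); rv.
apply: (run_let (y := enc_seq eF F)).
  by apply: run_call2 (run_echelon _ mxs _); [rv | rewrite -emx; rv].
apply: (run_let (y := enc_seq eP (paths2 ars))).
  by apply: run_call1 (run_paths2 _ _); rv.
apply: (run_let (y := eF [seq [::] | _ <- F])).
  by apply: (run_map (eX := eF)); [rv | move=> x; exact: run_empty].
apply: (run_let (y := enc_seq eT (relations V gens))).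
  apply: (run_flatmap (eX := eT)); first rv; move=> g.
  apply: (run_flatmap (eX := eP)); first rv; move=> y.
  apply: (run_map (eX := eP)); first rv; move=> x.
  apply: run_call2 (run_mulr_terms _ _ _); last rv.
  by apply: run_call2 (run_mull_terms _ _ _); rv.
apply: (run_let (y := enc_seq (enc_pair eF eF) (relation_rows V gens [seq [::] | _ <- F]
   [seq v i | i <- enum 'I_t0]))).
  apply: (run_map (eX := enc_pair eF eF)); last first.
    move=> [x z]; apply: RunPair; first by apply: (run_snd (y := eF x)); rv.
    by apply: (run_fst (z := eF z)); rv.
  apply: (run_diag (eX := @enc_vertex k Q)).
    by rv.
  move=> u; apply: (run_map (eX := eT)); first rv.
  by move=> t; apply: RunPair; rv.
apply: (run_let (y := enc_seq (enc_pair eF eF) (product_rows ars F))).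
  apply: (run_diag (eX := eF)); first rv.
  move=> x; apply: (run_map (eX := eP)); first rv; move=> a.
  apply: RunPair.
    apply: (run_map (eX := eT)); first rv; move=> s.
    by apply: run_call2 (run_mulr_terms _ _ _); rv.
  apply: (run_cons (eX := @enc_term k Q) (v := (1, a))); last exact: run_empty.
  by apply: RunPair; [exact: run_one | rv].
set rs1 := relation_rows _ _ _ _; set rs2 := product_rows _ _.
apply: (run_let (y := enc_seq enc_row (syzygy_rows ars (rs1 ++ rs2)))).
  apply: (run_filter (eX := enc_row)); last first.
    move=> [u x]; apply: run_call1 (run_nonzero _ _).
    by apply: (run_fst (z := eF x)); rv.
  apply: (run_map (eX := enc_pair eF eF)); first by apply: run_cat; rv.
  move=> [x z]; apply: RunPair; last by apply: (run_snd (y := eF x)); rv.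
  apply: run_call2 (run_dense _ _ _); first rv.
  by apply: (run_fst (z := eF z)); rv.
apply: RunPair; first rv.
apply: run_call2 (run_echelon _ _ _); first rv.
rewrite -/rs1 -/rs2; set rows := syzygy_rows _ _.
apply: (run_map (eX := enc_row)).
  apply: (@run_snd _ _ _ _ _ (enc_seq eF (elim rows).1)).
  by apply: run_call1 (run_elim _ _); rv.
by move=> [u x]; apply: (run_snd (y := enc_seq eS u)); rv.
Qed.

End Algorithm.

Notation Forall2 := List.Forall2.

Lemma Forall2_cat (A B : Type) (R : A -> B -> Prop) s1 s2 t1 t2 :
  Forall2 R s1 t1 -> Forall2 R s2 t2 -> Forall2 R (s1 ++ s2) (t1 ++ t2).
Proof. by elim=> //= x y s t xy _ IH h; constructor; auto. Qed.

Lemma Forall2_size (A B : Type) (R : A -> B -> Prop) s t :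
  Forall2 R s t -> size s = size t.
Proof. by elim=> //= x y s' t' _ _ ->. Qed.

Lemma Forall2_nth (A B : Type) (R : A -> B -> Prop) x0 y0 s t i :
  Forall2 R s t -> (i < size s)%N -> R (nth x0 s i) (nth y0 t i).
Proof. by move=> h; elim: h i => //= x y s' t' xy _ IH [|i] //=; apply: IH. Qed.

Lemma Forall2_map (A B A' B' : Type) (R : A -> B -> Prop) (R' : A' -> B' -> Prop)
    (f : A' -> A) (g : B' -> B) s t :
  (forall x y, R' x y -> R (f x) (g y)) -> Forall2 R' s t -> Forall2 R (map f s) (map g t).
Proof. by move=> h; elim=> //= x y s' t' xy _ IH; constructor; auto. Qed.

(** * Gaussian elimination *)

Section Elimination.
Variables (k : fieldType) (Q : quiver) (W : lmodType k).
Implicit Types (s t : seq W) (x y z p : W).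

Definition linear_closed_pred (P : W -> Prop) : Prop :=
  P 0 /\ forall (a : k) x y, P x -> P y -> P (a *: x + y).

(** The span as the intersection of all subspaces containing [s]; applying a hypothesis of this form
    is an induction over the span, with no coefficients to name. *)
Definition inspan s y : Prop :=
  forall P : W -> Prop, linear_closed_pred P -> (forall x, x \in s -> P x) -> P y.

Lemma inspan_closed s : linear_closed_pred (inspan s).
Proof.
split=> [P [] //|a x y hx hy P hP hs]; have [_ PD] := hP.
by apply: PD; [exact: hx | exact: hy].
Qed.

Lemma inspan_mem s x : x \in s -> inspan s x.
Proof. by move=> xs P _; apply. Qed.

Lemma inspan_trans s t y :
  (forall x, x \in s -> inspan t x) -> inspan s y -> inspan t y.
Proof. by move=> h; apply=> //; exact: inspan_closed. Qed.

Lemma inspan_sub s t y : {subset s <= t} -> inspan s y -> inspan t y.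
Proof. by move=> h; apply: inspan_trans => x /h; exact: inspan_mem. Qed.

Lemma inspanD s a x y : inspan s x -> inspan s y -> inspan s (a *: x + y).
Proof. by have [_] := inspan_closed s; apply. Qed.

Lemma inspan0 s : inspan s 0.
Proof. by have [] := inspan_closed s. Qed.

Lemma inspan_cons p s z : inspan (p :: s) z -> exists a z', inspan s z' /\ z = a *: p + z'.
Proof.
move=> h; apply: (h (fun z => exists a z', inspan s z' /\ z = a *: p + z')); first split.
- by exists 0, 0; rewrite scale0r add0r; split=> //; exact: inspan0.
- move=> a x y [b [x' [hx ->]]] [c [y' [hy ->]]].
  exists (a * b + c), (a *: x' + y'); split; first exact: inspanD.
  by rewrite scalerDl scalerDr scalerA addrACA.
- move=> x; rewrite inE => /predU1P[->|xs].
    by exists 1, 0; rewrite scale1r addr0; split=> //; exact: inspan0.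
  by exists 0, x; rewrite scale0r add0r; split=> //; exact: inspan_mem.
Qed.

Variables (I : eqType) (phi : I -> W -> k).
Hypothesis phiP : forall i a x y, phi i (a *: x + y) = a * phi i x + phi i y.

Let phi0 i : phi i 0 = 0.
Proof. by have := phiP i (- 1) 0 0; rewrite scaler0 addr0 mulN1r addNr. Qed.

Let phiB i a x y : phi i (x - a *: y) = phi i x - a * phi i y.
Proof. by rewrite addrC -scaleNr phiP mulNr addrC. Qed.

Lemma inspan_phi0 s i z : (forall x, x \in s -> phi i x = 0) -> inspan s z -> phi i z = 0.
Proof.
move=> hs h; apply: (h (fun z => phi i z = 0)) => //; split=> // a x y hx hy.
by rewrite phiP hx hy mulr0 addr0.
Qed.

Variable tagrep : seq (terms k Q) -> W -> Prop.
Hypothesis tagrepB : forall c u v x y, tagrep u x -> tagrep v y ->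
  tagrep (tsub c u v) (x - c *: y).
Variable U : W -> Prop.
Hypothesis UB : forall i c x y, U x -> U y -> phi i x != 0 -> phi i y != 0 ->
  U (x - c *: y).

(** The tag is tied to the vector by an abstract relation, so that it may be the vector itself or
    only one of its components. The invariant [U] is required to survive a subtraction only when
    both vectors are nonzero in a common column, the one case that occurs; this is what makes
    uniformity an admissible choice. *)
Definition rowrep (cols : seq I) (r : seq k * seq (terms k Q)) (y : W) : Prop :=
  [/\ r.1 = [seq phi i y | i <- cols], tagrep r.2 y & U y].

Lemma vsub_rep c cols x y :
  vsub c [seq phi i x | i <- cols] [seq phi i y | i <- cols] =
  [seq phi i (x - c *: y) | i <- cols].
Proof. by elim: cols => //= i cols IH; rewrite /vsub /= -/(vsub _ _ _) IH phiB. Qed.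

(** Passing from [y] to [y - c *: p] is invertible as long as [p] is kept, so the span is unchanged.
    Either the column is zero, or exactly one vector leaves the list as the pivot. *)
Lemma reduce_rep i cols rows ys : Forall2 (rowrep (i :: cols)) rows ys ->
  let a := foldr (@reduce k Q) ([::], [::]) rows in
  [/\ a.1 = [::], Forall2 (rowrep cols) a.2 ys & forall y, y \in ys -> phi i y = 0] \/
  exists r p ys',
  [/\ a.1 = [:: (phi i p, r)], rowrep cols r p /\ phi i p != 0,
      Forall2 (rowrep cols) a.2 ys' /\ size ys = (size ys').+1,
      forall y, y \in ys' -> phi i y = 0 &
      forall z, inspan ys z <-> inspan (p :: ys') z].
Proof.
elim=> [|[u t] y rows' ys' [/= eu ht hU] _ IH] /=; first by left.
move: (foldr _ _ _) IH => a IH; rewrite /reduce /= eu /=.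
case: eqP => [e0|/eqP ne0] /=.
  case: IH => [[e1 h2 h3]|[r [p [zs [e1 h2 [h3 h3'] h4 h5]]]]].
    left; split=> //; first by constructor.
    by move=> z; rewrite inE => /predU1P[->//|/h3].
  right; exists r, p, (y :: zs); split=> //=.
  - by split; [constructor | rewrite h3'].
  - by move=> z; rewrite inE => /predU1P[->//|/h4].
  move=> z; split; apply: inspan_trans => x; rewrite ?inE.
    case/predU1P=> [->|/inspan_mem/h5]; first by apply: inspan_mem; rewrite !inE eqxx orbT.
    by apply: inspan_sub => x'; rewrite !inE; case/orP=> ->; rewrite ?orbT.
  have sub x' : inspan (p :: zs) x' -> inspan (y :: ys') x'.
    by move/h5; apply: inspan_sub => w; rewrite inE => ->; rewrite orbT.
  case/predU1P=> [->|]; first by apply: sub; apply: inspan_mem; rewrite inE eqxx.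
  case/predU1P=> [->|xz]; first by apply: inspan_mem; rewrite inE eqxx.
  by apply: sub; apply: inspan_mem; rewrite inE xz orbT.
case: IH => [[e1 h2 h3]|[r [p [zs [e1 [h2 pne] [h3 h3'] h4 h5]]]]].
  (* No pivot has been met so far, so the current row becomes it. *)
  by rewrite e1; right; exists ([seq phi j y | j <- cols], t), y, ys'.
(* The factor is the one that cancels the entry of [y] in column [i] against that of the pivot. *)
rewrite e1; right; exists r, p, ((y - (phi i y * (phi i p)^-1) *: p) :: zs).
have [er tr Ur] := h2.
split=> //=.
- split; last by rewrite h3'.
  constructor=> //; split=> /=; [by rewrite er vsub_rep | exact: tagrepB | exact: (UB (i := i))].
- by move=> z; rewrite inE => /predU1P[->|/h4 //]; rewrite phiB divfK // subrr.
set c := _ * _; move=> z; split; apply: inspan_trans => x; rewrite ?inE.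
  case/predU1P=> [->|/inspan_mem/h5].
    have m1 : p \in p :: y - c *: p :: zs by rewrite inE eqxx.
    have m2 : y - c *: p \in p :: y - c *: p :: zs by rewrite !inE eqxx orbT.
    by have := inspanD c (inspan_mem m1) (inspan_mem m2); rewrite [c *: p + _]addrC subrK.
  by apply: inspan_sub => x'; rewrite !inE; case/orP=> ->; rewrite ?orbT.
have sub x' : inspan (p :: zs) x' -> inspan (y :: ys') x'.
  by move/h5; apply: inspan_sub => w; rewrite inE => ->; rewrite orbT.
case/predU1P=> [->|]; first by apply: sub; apply: inspan_mem; rewrite inE eqxx.
case/predU1P=> [->|xz]; last by apply: sub; apply: inspan_mem; rewrite inE xz orbT.
have m1 : p \in p :: zs by rewrite inE eqxx.
have m2 : y \in y :: ys' by rewrite inE eqxx.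
by have := inspanD (- c) (sub _ (inspan_mem m1)) (inspan_mem m2); rewrite scaleNr [- _ + _]addrC.
Qed.

Definition pivot_of (cols : seq I) (q : nat * W) : Prop :=
  (q.1 < size cols)%N /\
  forall i0, phi (nth i0 cols q.1) q.2 != 0 /\
    forall j, (j < q.1)%N -> phi (nth i0 cols j) q.2 = 0.

(** A pivot is stored with the position of its first nonzero column. For decreasing columns these
    positions are the tips; the clause on [kers] is the one that yields the syzygies. *)
Definition elim_spec (cols : seq I) ys (ps : seq (nat * W)) (kers : seq W) : Prop :=
  [/\ uniq (map fst ps) /\ (forall q, q \in ps -> pivot_of cols q),
      forall z, inspan ys z <-> inspan (map snd ps ++ kers) z,
      forall z, inspan kers z <-> inspan ys z /\ forall i, i \in cols -> phi i z = 0 &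
      (size ps + size kers)%N = size ys].

(** A step never inspects the pivots already collected, so later pivots are simply put in front of
    earlier ones. *)
Lemma iter_step n pv rows : exists new out, forall pv',
  iter n (@step k Q) (pv' ++ pv, rows) = (new ++ pv' ++ pv, out).
Proof.
elim: n => [|n [new [out IH]]]; first by exists [::], rows.
rewrite /= ; exists ([seq q.2.2 | q <- (foldr (@reduce k Q) ([::], [::]) out).1] ++ new).
exists (foldr (@reduce k Q) ([::], [::]) out).2 => pv'.
by rewrite /= IH /step /= catA.
Qed.

Lemma iter_step_rep cols rows ys : Forall2 (rowrep cols) rows ys ->
  exists ps kers, let st := iter (size cols) (@step k Q) ([::], rows) in
  [/\ Forall2 (fun u x => tagrep u x /\ U x) st.1 (map snd ps),
      Forall2 (rowrep [::]) st.2 kers & elim_spec cols ys ps kers].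
Proof.
elim: cols rows ys => [|i cols IH] rows ys h.
  exists [::], ys; split=> //; split=> // z; split=> //; by case.
pose a := foldr (@reduce k Q) ([::], [::]) rows.
have Est : iter (size (i :: cols)) (@step k Q) ([::], rows) =
    iter (size cols) (@step k Q) ([seq q.2.2 | q <- a.1] ++ [::], a.2).
  by rewrite [LHS]iterSr.
rewrite Est; have [] := reduce_rep h; rewrite -/a.
  move=> [e1 h2 h3]; have [ps [kers [f1 f2 [[g1 g1'] g2 g3 g4]]]] := IH _ _ h2.
  (* The positions found for [cols] move up by one because column [i] stands before them. *)
  rewrite e1 /=; exists [seq (q.1.+1, q.2) | q <- ps], kers.
  have es : map snd [seq (q.1.+1, q.2) | q <- ps] = map snd ps by rewrite -map_comp.
  split; rewrite ?es //; split; rewrite ?es ?size_map //.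
  - split; first by rewrite -map_comp (map_comp succn) map_inj_uniq //; exact: succn_inj.
    move=> _ /mapP[q hq ->]; have [l1 l2] := g1' _ hq; split=> //= i0.
    have [m1 m2] := l2 i0; split=> // -[_|j] /=; last exact: m2.
    apply: (inspan_phi0 h3); apply/g2; apply: inspan_mem.
    by rewrite mem_cat; apply/orP; left; apply/mapP; exists q.
  - move=> z; rewrite g3; split=> -[hz hc]; split=> // j; last first.
      by move=> hj; apply: hc; rewrite inE hj orbT.
    by rewrite inE => /predU1P[->|/hc //]; apply: inspan_phi0 hz.
move=> [r [p [ys' [e1 [[_ tr Ur] pne] [h3 h3'] h4 h5]]]].
have [ps [kers [f1 f2 [[g1 g1'] g2 g3 g4]]]] := IH _ _ h3.
(* The pivot of the first column comes last, as the later pivots are put in front of it. *)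
rewrite e1 /=; exists (rcons [seq (q.1.+1, q.2) | q <- ps] (0%N, p)), kers.
have [new [out E]] := iter_step (size cols) [::] a.2.
have := E [::]; have := E [:: r.2]; rewrite /= => -> E0.
rewrite E0 /= cats0 in f1 f2.
have es : map snd (rcons [seq (q.1.+1, q.2) | q <- ps] (0%N, p)) = rcons (map snd ps) p.
  by rewrite map_rcons -map_comp.
have hps x : inspan (map snd ps ++ kers) x -> inspan (rcons (map snd ps) p ++ kers) x.
  by apply: inspan_sub => w; rewrite !mem_cat mem_rcons inE => /orP[] ->; rewrite ?orbT.
split; rewrite ?es //.
  by rewrite -cats1; apply: Forall2_cat => //; constructor.
split; rewrite ?es ?size_rcons ?size_map /= ?h3' -?g4 ?addSn //.
- split.
    rewrite map_rcons rcons_uniq -map_comp; apply/andP; split.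
      by apply/mapP => -[q _].
    by rewrite (map_comp succn) map_inj_uniq //; exact: succn_inj.
  move=> q; rewrite mem_rcons inE => /predU1P[->|/mapP[q' hq ->]]; first by [].
  have [l1 l2] := g1' _ hq; split=> //= i0.
  have [m1 m2] := l2 i0; split=> // -[_|j] /=; last exact: m2.
  apply: (inspan_phi0 h4); apply/g2; apply: inspan_mem.
  by rewrite mem_cat; apply/orP; left; apply/mapP; exists q'.
- move=> z; rewrite h5; split; apply: inspan_trans => x.
    rewrite inE => /predU1P[->|/inspan_mem/g2/hps //].
    by apply: inspan_mem; rewrite mem_cat mem_rcons inE eqxx.
  rewrite mem_cat mem_rcons inE -orbA => /predU1P[->|hx].
    by apply: inspan_mem; rewrite inE eqxx.
  apply: (inspan_sub (s := ys')); first by move=> w hw; rewrite inE hw orbT.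
  by apply/g2; apply: inspan_mem; rewrite mem_cat.
- move=> z; rewrite g3 h5; split=> [[hz hc]|[/inspan_cons[c [z' [hz' ez]]] hc]].
    split; first by apply: inspan_sub hz => w hw; rewrite inE hw orbT.
    by move=> j; rewrite inE => /predU1P[->|/hc //]; apply: inspan_phi0 hz.
  split; last by move=> j hj; apply: hc; rewrite inE hj orbT.
  (* Only [p] has a nonzero entry in column [i], so its coefficient in [z] must vanish. *)
  have := hc i; rewrite inE eqxx => /(_ isT).
  rewrite ez phiP (inspan_phi0 h4 hz') addr0 => /eqP; rewrite mulf_eq0 (negPf pne) orbF.
  by move=> /eqP ->; rewrite scale0r add0r.
Qed.

Lemma elim_rep cols rows ys : Forall2 (rowrep cols) rows ys ->
  exists ps kers,
  [/\ Forall2 (fun u x => tagrep u x /\ U x) (elim rows).1 (map snd ps),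
      Forall2 (fun r x => tagrep r.2 x /\ U x) (elim rows).2 kers & elim_spec cols ys ps kers].
Proof.
case: rows => [|r rows] h.
  exists [::], [::]; inversion h; split; try by constructor.
  by split=> // z; split=> [hz|[] //]; split=> // i _; apply: inspan_phi0 hz.
have iterE st n (u : seq k) : size u = n ->
    foldr (fun _ => @step k Q) st u = iter n (@step k Q) st.
  by move=> <-; elim: u => //= c u ->.
rewrite /elim /= (iterE _ (size cols)); last first.
  by inversion h as [|? ? ? ? hr]; case: hr => ->; rewrite size_map.
have [ps [kers [f1 f2 f3]]] := iter_step_rep h; exists ps, kers; split=> //.
by elim: f2 => // r' x s t [_ h1 h2] _; constructor.
Qed.

End Elimination.

(** * Term lists, echelon forms and tips *)

Section TermLists.
Variables (k : fieldType) (Q : quiver) (lt : rel (qpath Q)).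
Hypothesis lt_order : strict_well_order lt.
Implicit Types (s t : terms k Q) (p q : qpath Q).
Local Notation PA := (pathalg k Q).
Local Notation fam := (seq (terms k Q)).
Local Notation pot := (@pa_of_terms k Q).

Lemma same_pathP p q : same_path lt p q = (p == q).
Proof.
have [irr tr tot _] := lt_order; rewrite /same_path; apply/andP/eqP => [[h1 h2]|->].
  by have [h|//|h] := tot p q; [rewrite h in h1 | rewrite h in h2].
by rewrite irr.
Qed.

Lemma pot_nil : pot [::] = 0.
Proof. by rewrite /pa_of_terms big_nil. Qed.

Lemma pot_cons (t0 : k * qpath Q) s : pot (t0 :: s) = mono t0.1 t0.2 + pot s.
Proof. by rewrite /pa_of_terms big_cons. Qed.

Lemma pot_cat s t : pot (s ++ t) = pot s + pot t.
Proof. by rewrite /pa_of_terms big_cat. Qed.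

Lemma pot_scale c s : pot (scale_terms c s) = c *: pot s.
Proof.
elim: s => [|t0 s IH]; first by rewrite pot_nil scaler0.
rewrite /scale_terms /= -/(scale_terms c s) 2!pot_cons IH scalerDr; congr (_ + _).
by apply: pa_eqP => p; rewrite [LHS]coef_mono [RHS]coefZ [X in _ = c * X]coef_mono; case: eqP; rewrite ?mulr0.
Qed.

Lemma coefsE p s : coefs lt p s = (pot s)@_p.
Proof.
elim: s => [|t0 s IH] /=; first by rewrite pot_nil coef0.
rewrite pot_cons coefD coef_mono same_pathP IH eq_sym.
by case: eqP; rewrite ?add0r.
Qed.

Lemma pot_mulr s a : pot (mulr_terms s a) = pot s * mono 1 a.
Proof.
elim: s => [|t0 s IH]; first by rewrite pot_nil mul0r.
rewrite /mulr_terms /= -/(mulr_terms s a) pot_cat IH pot_cons mulrDl; congr (_ + _).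
rewrite pa_mulU mulr1; case: (pcat t0.2 a) => [r|]; last by rewrite pot_nil.
by rewrite pot_cons pot_nil addr0.
Qed.

Lemma pot_mull a s : pot (mull_terms a s) = mono 1 a * pot s.
Proof.
elim: s => [|t0 s IH]; first by rewrite pot_nil mulr0.
rewrite /mull_terms /= -/(mull_terms a s) pot_cat IH pot_cons mulrDr; congr (_ + _).
rewrite pa_mulU mul1r; case: (pcat a t0.2) => [r|]; last by rewrite pot_nil.
by rewrite pot_cons pot_nil addr0.
Qed.

Definition fv n (x : fam) : {ffun 'I_n -> PA} := [ffun i : 'I_n => pot (nth [::] x i)].

Lemma fv_tsub n c (x y : fam) : size x = n -> size y = n ->
  size (tsub c x y) = n /\ fv n (tsub c x y) = fv n x - c *: fv n y.
Proof.
move=> sx sy; split; first by rewrite size_map size_zip sx sy minnn.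
apply/ffunP => i; rewrite !ffunE /tsub (nth_map ([::], [::])) ?size_zip ?sx ?sy ?minnn //.
by rewrite nth_zip ?sx ?sy //= pot_cat pot_scale scaleNr.
Qed.

(** The basis elements in the order in which [dense] lists their coefficients. *)
Definition columns n (ps : seq (qpath Q)) : seq ('I_n * qpath Q) :=
  flatten [seq [seq (i, p) | i <- rev (enum 'I_n)] | p <- ps].

Lemma mem_columns n ps (b : 'I_n * qpath Q) : (b \in columns n ps) = (b.2 \in ps).
Proof.
apply/flatten_mapP/idP => [[p pp /mapP[i _ ->]] //|h].
exists b.2 => //; apply/mapP; exists b.1; first by rewrite mem_rev mem_enum.
by case: b {h}.
Qed.

Lemma dense_columns n ps (x : fam) (y : 'I_n -> PA) : size x = n ->
  (forall i, y i = pot (nth [::] x i)) ->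
  dense lt ps x = [seq (y b.1)@_(b.2) | b <- columns n ps].
Proof.
move=> sx hy; rewrite /dense /columns map_flatten -map_comp; congr flatten.
apply: eq_map => p /=; rewrite -map_comp !map_rev; congr rev.
apply: (@eq_from_nth _ 0) => [|j].
  by rewrite [LHS]size_map [RHS]size_map size_enum_ord.
rewrite [size _]size_map sx => lj.
rewrite (nth_map [::]) ?sx // coefsE (nth_map (Ordinal lj)) ?size_enum_ord //= hy.
by rewrite nth_enum_ord.
Qed.

Lemma perm_insert p (s : seq (qpath Q)) : perm_eq (insert lt p s) (p :: s).
Proof.
by rewrite /insert -cat1s perm_catCA /= perm_cons; apply/permPl/perm_filterC.
Qed.

Lemma perm_sort_paths (s : seq (qpath Q)) : perm_eq (sort_paths lt s) s.
Proof.
elim: s => //= p s IH; apply: perm_trans (perm_insert _ _) _.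
by rewrite perm_cons.
Qed.

Lemma pairwise_insert p (s : seq (qpath Q)) : p \notin s ->
  pairwise (fun b c => lt c b) s -> pairwise (fun b c => lt c b) (insert lt p s).
Proof.
have [irr tr tot _] := lt_order.
move=> ps h; rewrite /insert pairwise_cat /= !pairwise_filter // !andbT.
apply/andP; split.
  apply/allrelP => x y; rewrite mem_filter => /andP[px _].
  rewrite inE => /predU1P[-> //|]; rewrite mem_filter => /andP[npy ys].
  have [h1|e|h1] := tot p y; [by rewrite h1 in npy | by rewrite e ys in ps |].
  exact: tr h1 px.
apply/allP => y; rewrite mem_filter => /andP[npy ys].
by have [h1|e|h1] := tot p y; [rewrite h1 in npy | rewrite e ys in ps |].
Qed.

Lemma pairwise_sort_paths (s : seq (qpath Q)) : uniq s ->
  pairwise (fun b c => lt c b) (sort_paths lt s).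
Proof.
elim: s => //= p s IH /andP[ps us]; apply: pairwise_insert (IH us).
by rewrite (perm_mem (perm_sort_paths s)).
Qed.

Lemma pairwise_columns n (ps : seq (qpath Q)) : pairwise (fun b c => lt c b) ps ->
  pairwise (fun b c => eps_lt lt c b) (columns n ps).
Proof.
elim: ps => //= p ps IH /andP[h1 h2]; rewrite /columns /= -/(columns n ps) pairwise_cat.
rewrite IH // andbT; apply/andP; split.
  apply/allrelP => _ c /mapP[i _ ->]; rewrite mem_columns => hc.
  by rewrite /eps_lt /= (allP h1 _ hc).
rewrite pairwise_map -sorted_pairwise; last first.
  have [irr _ _ _] := lt_order; move=> j i l; rewrite /relpre /eps_lt /= !eqxx !irr /=.
  by move=> l1 l2; exact: ltn_trans l2 l1.
rewrite rev_sorted.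
have : sorted ltn (map val (enum 'I_n)) by rewrite val_enum_ord; exact: iota_ltn_sorted.
rewrite sorted_map; apply: sub_sorted => i j ij.
by have ij' : (i < j)%N := ij; rewrite /relpre /eps_lt /= eqxx ij' orbT.
Qed.

Definition fam_deg n (d : int) (y : {ffun 'I_n -> PA}) : Prop := forall i, pa_deg d (y i).

Definition fam_unif n (y : {ffun 'I_n -> PA}) : Prop :=
  exists u, forall i, y i * vtx k u = y i.

(** [is_tip] for a family that is not yet known to lie in a coproduct of vertex modules. *)
Definition fam_tip n (y : {ffun 'I_n -> PA}) (b : 'I_n * qpath Q) : Prop :=
  (y b.1)@_(b.2) != 0 /\
  forall c, (y c.1)@_(c.2) != 0 -> c <> b -> eps_lt lt c b.

Lemma fam_deg_closed n d : linear_closed_pred (@fam_deg n d).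
Proof.
split=> [i|a x y hx hy i]; rewrite !ffunE; first exact: pa_deg0.
by apply: pa_degD => //; apply: pa_degZ.
Qed.

Lemma fam_coefP n (b : 'I_n * qpath Q) (a : k) (x y : {ffun 'I_n -> PA}) :
  ((a *: x + y) b.1)@_(b.2) = a * (x b.1)@_(b.2) + (y b.1)@_(b.2).
Proof. by rewrite !ffunE coefP. Qed.

(** The common path with nonzero coefficient forces both families to have its terminus as their
    vertex. *)
Lemma fam_unifB n (b : 'I_n * qpath Q) c (x y : {ffun 'I_n -> PA}) :
  fam_unif x -> fam_unif y -> (x b.1)@_(b.2) != 0 -> (y b.1)@_(b.2) != 0 ->
  fam_unif (x - c *: y).
Proof.
move=> [u hu] [u' hu'] nx ny; exists u => i.
have e : u' = u by rewrite -(Mvtx_terminus (hu' b.1) ny) (Mvtx_terminus (hu b.1) nx).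
by rewrite !ffunE mulrBl hu -scale_pathalgAl -e hu'.
Qed.

Variable ars : seq (qpath Q).
Hypotheses (ars_uniq : uniq ars) (ars_mem : forall p, (p \in ars) = (plen p == 1%N)).

Lemma deg1_eq0 n (y : {ffun 'I_n -> PA}) : fam_deg 1 y ->
  (forall b, b \in columns n (sort_paths lt ars) -> (y b.1)@_(b.2) = 0) -> y = 0.
Proof.
move=> dy h; apply/ffunP => i; rewrite ffunE; apply: pa_eqP => p; rewrite coef0.
apply/eqP; apply: contraT => np.
have /pa_degP/(_ _ np) [lp] := dy i.
have := h (i, p); rewrite mem_columns /= (perm_mem (perm_sort_paths ars)) ars_mem lp.
by move=> /(_ isT)/eqP; rewrite (negPf np).
Qed.

(** The columns exhaust the basis in degree 1, so a vector vanishing in all of them is zero and the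
    pivots alone span. As the columns decrease, the column of a pivot is its tip, and distinct
    positions give distinct tips. *)
Lemma echelonP n (xs : seq fam) :
  (forall x, x \in xs -> [/\ size x = n, fam_deg 1 (fv n x) & fam_unif (fv n x)]) ->
  let out := echelon lt (sort_paths lt ars) xs in
  [/\ forall x, x \in out -> [/\ size x = n, fam_deg 1 (fv n x) & fam_unif (fv n x)],
      forall z, inspan (map (fv n) xs) z <-> inspan (map (fv n) out) z &
      exists b : seq ('I_n * qpath Q), [/\ size b = size out, uniq b &
        Forall2 (fun x c => fam_tip (fv n x) c) out b]].
Proof.
move=> hxs out; pose W := {ffun 'I_n -> PA} : lmodType k.
pose tagrep (t : fam) (y : W) := size t = n /\ y = fv n t.
pose phi (b : 'I_n * qpath Q) (y : W) := (y b.1)@_(b.2).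
pose cols := columns n (sort_paths lt ars).
have tB c u v x y : tagrep u x -> tagrep v y -> tagrep (tsub c u v) (x - c *: y).
  by move=> [su ->] [sv ->]; have [h1 h2] := fv_tsub c su sv; split.
have hrep : Forall2 (rowrep phi tagrep (@fam_unif n) cols)
    [seq (dense lt (sort_paths lt ars) x, x) | x <- xs] (map (fv n) xs).
  rewrite /out; elim: xs hxs {out} => [|x xs IH] hxs; constructor.
    have [h1 h2 h3] := hxs x (mem_head _ _); split=> //=.
    by apply: dense_columns => // i; rewrite ffunE.
  by apply: IH => y hy; apply: hxs; rewrite inE hy orbT.
have := elim_rep (@fam_coefP n) tB (@fam_unifB n) hrep.
rewrite -/(echelon _ _ xs) -/out => -[ps [kers [f1 _ [[g1 g1'] g2 g3 _]]]].
have dspan z : inspan (map (fv n) xs) z -> fam_deg 1 z.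
  by apply; [exact: fam_deg_closed | move=> _ /mapP[x /hxs[_ ? _] ->]].
have ker0 z : z \in kers -> z = 0.
  by move=> /inspan_mem /g3[/dspan h1 h2]; exact: deg1_eq0 h1 h2.
have g2' z : inspan (map (fv n) xs) z <-> inspan (map snd ps) z.
  rewrite g2; split; last by apply: inspan_sub => w hw; rewrite mem_cat hw.
  apply: inspan_trans => x; rewrite mem_cat => /orP[/inspan_mem //|/ker0 ->].
  exact: inspan0.
have eout : map (fv n) out = map snd ps.
  by elim: f1 => //= x y s t [[_ ->] _] _ ->.
split.
- move=> x hx; have hz : fv n x \in map snd ps by rewrite -eout map_f.
  have d1 : fam_deg 1 (fv n x) by apply: dspan; apply/g2'; exact: inspan_mem.
  suff [h1 h2] : size x = n /\ fam_unif (fv n x) by [].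
  elim: f1 hx => //= x' y s t [[h1 ->] h2] _ IH; rewrite inE => /predU1P[-> //|/IH //].
- by move=> z; rewrite eout.
have so : size out = size ps by rewrite (Forall2_size f1) size_map.
(* The default of [nth] below has to be a column; without columns there is no pivot either. *)
case: (posnP (size cols)) => [c0|cpos].
  suff -> : out = [::] by exists [::].
  apply: size0nil; rewrite so; case: (ps) g1' => // q ps' /(_ q (mem_head _ _)) [].
  by rewrite c0.
have [b0 hb0] : exists b0, b0 \in cols by case: (cols) cpos => // b s _; exists b; exact: mem_head.
have pwc : pairwise (fun b c => eps_lt lt c b) cols.
  exact/pairwise_columns/pairwise_sort_paths.
have ucols : uniq cols.
  apply: pairwise_uniq pwc => b; have [irr _ _ _] := lt_order.
  by rewrite /eps_lt irr eqxx ltnn.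
exists [seq nth b0 cols j | j <- map fst ps]; split; first by rewrite !size_map so.
  rewrite map_inj_in_uniq // => j j' /mapP[q hq ->] /mapP[q' hq' ->] /eqP.
  have [l _] := g1' _ hq; have [l' _] := g1' _ hq'.
  by rewrite nth_uniq // => /eqP.
have : Forall2 (fun x (q : nat * W) => fv n x = q.2 /\ q \in ps) out ps.
  have aux (o : seq fam) (ps' : seq (nat * W)) : map (fv n) o = map snd ps' ->
      {subset ps' <= ps} -> Forall2 (fun x (q : nat * W) => fv n x = q.2 /\ q \in ps) o ps'.
    elim: o ps' => [|x o IH] [|q ps'] //=.
    move=> e12 sub; have e1 := congr1 (head 0) e12; have e2 := congr1 behead e12.
    constructor; first by split; [exact: e1 | apply: sub; exact: mem_head].
    by apply: IH => // w hw; apply: sub; rewrite inE hw orbT.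
  exact: aux.
move=> h; rewrite -map_comp -[out]map_id; apply: Forall2_map h => x q [eq hq].
have [lq hpiv] := g1' _ hq; have [nz zr] := hpiv b0.
have dq : fam_deg 1 (fv n x).
  by apply: dspan; apply/g2'; apply: inspan_mem; rewrite eq map_f.
rewrite eq in dq *; split=> // c nc ne.
have hc : c \in cols.
  rewrite mem_columns (perm_mem (perm_sort_paths ars)) ars_mem.
  by have /pa_degP/(_ _ nc) [->] := dq c.1.
have ic : (index c cols < size cols)%N by rewrite index_mem.
(* In a column before the pivot the coefficient is 0, and a later column is a smaller basis
   element. *)
case: (ltngtP (index c cols) q.1) => hi.
- by have := zr _ hi; rewrite nth_index // => /eqP; rewrite (negPf nc).
- have /(pairwiseP b0)/(_ _ _ lq ic hi) := pwc; rewrite nth_index //.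
- by case: ne => /=; rewrite -[LHS](nth_index b0 hc) hi.
Qed.

End TermLists.

(** * Families concentrated in one index *)

Section UnitFamilies.
Variables (k : fieldType) (Q : quiver).
Local Notation PA := (pathalg k Q).
Local Notation fam := (seq (terms k Q)).
Local Notation pot := (@pa_of_terms k Q).

Definition unitfam (n i : nat) (t : terms k Q) : fam :=
  nseq i [::] ++ t :: nseq (n - i.+1) [::].

Lemma size_unitfam n i t : (i < n)%N -> size (unitfam n i t) = n.
Proof. by move=> h; rewrite size_cat /= !size_nseq addnS -addSn subnKC. Qed.

Lemma nth_unitfam n i t j : nth [::] (unitfam n i t) j = if j == i then t else [::].
Proof.
rewrite nth_cat size_nseq; case: ltngtP => [h|h|->]; last by rewrite subnn.
- by rewrite nth_nseq h.
- by rewrite -(subnSK h) /= nth_nseq if_same.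
Qed.

Definition delta n (i : 'I_n) (y : PA) : {ffun 'I_n -> PA} :=
  locked [ffun j => if j == i then y else 0].

Lemma ffun_lin n (a : k) (f g : {ffun 'I_n -> PA}) i : (a *: f + g) i = a *: f i + g i.
Proof. by rewrite !ffunE. Qed.

Lemma deltaE n (i j : 'I_n) y : delta i y j = if j == i then y else 0.
Proof. by rewrite /delta -lock ffunE. Qed.

Lemma fv_unitfam n (i : 'I_n) t : fv n (unitfam n i t) = delta i (pot t).
Proof.
apply/ffunP => j; rewrite deltaE ffunE nth_unitfam val_eqE.
by case: eqP => // _; rewrite pot_nil.
Qed.

Lemma fv_zeros (X : Type) n (s : seq X) : fv n ([seq [::] | _ <- s] : fam) = 0.
Proof.
apply/ffunP => j; rewrite !ffunE; case: (ltnP j (size s)) => h.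
  by case: s h => // x s h; rewrite (nth_map x) // pot_nil.
by rewrite nth_default ?size_map // pot_nil.
Qed.

(** The first component of the accumulator is the zero padding for the indices to the right of the
    current one. *)
Lemma diag_fst (X Y : Type) (f : X -> seq (Y * terms k Q)) s :
  (foldr (diag_step f) ([::], [::]) s).1 = nseq (size s) [::].
Proof. by elim: s => //= x s ->. Qed.

Lemma mem_diag (X : Type) (Y : eqType) (f : X -> seq (Y * terms k Q)) s x0 r :
  reflect (exists i z, [/\ (i < size s)%N, z \in f (nth x0 s i)
                         & r = (z.1, unitfam (size s) i z.2)]) (r \in diag f s).
Proof.
rewrite /diag; elim: s r => [|x s IH] r /=.
  by constructor => -[i [z []]].
rewrite diag_fst mem_cat; apply: (iffP orP).
  case=> [/mapP[z hz ->]|/mapP[r' /IH[i [z [h1 h2 ->]]] ->]].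
    by exists 0%N, z; rewrite /unitfam /= subn1.
  by exists i.+1, z.
move=> [[|i] [z [h1 h2 ->]]]; [left | right]; apply/mapP.
  by exists z => //; rewrite /unitfam /= subn1.
by exists (z.1, unitfam (size s) i z.2) => //; apply/IH; exists i, z.
Qed.

Lemma delta_linear n (i : 'I_n) (a : k) x y :
  delta i (a *: x + y) = a *: delta i x + delta i y.
Proof. by apply/ffunP => j; rewrite ffun_lin !deltaE; case: eqP; rewrite // scaler0 addr0. Qed.

Lemma sum_delta n (x : {ffun 'I_n -> PA}) : x = \sum_i delta i (x i).
Proof.
apply/ffunP => j; rewrite sum_ffunE (bigD1 j) //= deltaE eqxx big1 ?addr0 // => i ne.
by rewrite deltaE eq_sym (negPf ne).
Qed.

Lemma inspan_sum (W : lmodType k) (s : seq W) (J : Type) (r : seq J) (P : pred J)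
    (E : J -> W) :
  (forall j, P j -> inspan s (E j)) -> inspan s (\sum_(j <- r | P j) E j).
Proof.
move=> h; apply: (big_ind (inspan s)) => //; first exact: inspan0.
by move=> x y hx hy; have := inspanD 1 hx hy; rewrite scale1r.
Qed.

Lemma pair_sum (W W' : lmodType k) (J : Type) (r : seq J) (P : pred J) (E : J -> W)
    (E' : J -> W') :
  \sum_(j <- r | P j) (E j, E' j) =
  (\sum_(j <- r | P j) E j, \sum_(j <- r | P j) E' j) :> (W * W')%type.
Proof.
by elim/big_rec3: _ => // j a b c _ ->.
Qed.

Lemma pair_lin (W W' : lmodType k) (a : k) (x x' : W) (y y' : W') :
  a *: (x, y) + (x', y') = (a *: x + x', a *: y + y') :> (W * W')%type.
Proof. by []. Qed.

Lemma pair_sndB (W W' : lmodType k) (a : k) (x y : W * W') :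
  (x - a *: y).2 = x.2 - a *: y.2.
Proof. by []. Qed.

Lemma inspanZ (W : lmodType k) (s : seq W) a x : inspan s x -> inspan s (a *: x).
Proof. by move=> h; have := inspanD a h (@inspan0 _ _ s); rewrite addr0. Qed.

Lemma inspanB (W : lmodType k) (s : seq W) x y :
  inspan s x -> inspan s y -> inspan s (x - y).
Proof. by move=> hx hy; rewrite addrC -scaleN1r; exact: inspanD. Qed.

Lemma inspan_img (W W' : lmodType k) (g : W -> W') (s : seq W) (t : seq W') x :
  (forall (a : k) x y, g (a *: x + y) = a *: g x + g y) ->
  (forall x, x \in s -> inspan t (g x)) -> inspan s x -> inspan t (g x).
Proof.
move=> lg hs h; apply: (h (fun x => inspan t (g x))) => //; split.
  have -> : g 0 = 0; last exact: inspan0.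
  by have := lg (- 1) 0 0; rewrite scaler0 addr0 scaleN1r addNr.
by move=> a y z hy hz; rewrite lg; exact: inspanD.
Qed.

End UnitFamilies.

(** * Linear relations found by elimination on pairs *)

Section Syzygies.
Variables (k : fieldType) (Q : quiver) (lt : rel (qpath Q)).
Hypothesis lt_order : strict_well_order lt.
Local Notation PA := (pathalg k Q).
Local Notation fam := (seq (terms k Q)).
Local Notation pot := (@pa_of_terms k Q).

Variable ars : seq (qpath Q).
Hypotheses (ars_uniq : uniq ars) (ars_mem : forall p, (p \in ars) = (plen p == 1%N)).
Variable V : seq (qpath Q).
Hypothesis V_mem : forall p, (p \in V) = (plen p == 0%N).
Variable gens : seq (terms k Q).
Hypothesis gens_deg : forall g, g \in gens -> pa_deg 2 (pot g).
Variables (X : Type) (v : seq X) (F : seq fam) (u : 'I_(size F) -> Q).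
Variable famv : 'I_(size F) -> {ffun 'I_(size v) -> PA}.
Local Notation n := (size v).
Local Notation m := (size F).

Hypothesis famvE : forall l : 'I_m, fv n (nth [::] F l) = famv l.
Hypothesis F_size : forall x, x \in F -> size x = n.
Hypothesis F_deg : forall l, fam_deg 1 (famv l).
Hypothesis F_unif : forall l i, famv l i * vtx k (u l) = famv l i.
Hypothesis F_neq0 : forall l, famv l <> 0.

(** When [gens] generate I, this is the degree-2 part of I: see [ideal_rel2] and [rel2_ideal]. *)
Definition rel2 : PA -> Prop := inspan (map pot (relations V gens) : seq PA).

Definition prodf (r : {ffun 'I_m -> PA}) : {ffun 'I_n -> PA} :=
  locked [ffun i => \sum_l famv l i * r l].

Lemma mem_paths2 p : plen p = 2%N -> p \in paths2 ars.
Proof.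
move=> lp; apply/flatten_mapP; exists (ptake 1 p).
  by rewrite ars_mem /plen /ptake /arrows /= size_take -/(arrows p) -/(plen p) lp.
apply/flatten_mapP; exists (pdrop 1 p).
  by rewrite ars_mem /plen /pdrop /arrows /= size_drop -/(arrows p) -/(plen p) lp.
by rewrite pcat_take_drop inE.
Qed.

Lemma relations_deg t : t \in relations V gens -> pa_deg 2 (pot t) /\
  exists u', pot t * vtx k u' = pot t.
Proof.
move=> /flatten_mapP[g hg /flatten_mapP[y hy /mapP[x hx ->]]].
have vx q : q \in V -> mono 1 q = vtx k (orig q).
  by rewrite V_mem => /eqP /plen0 ->.
rewrite pot_mulr pot_mull !vx //; split.
  have := pa_degM (pa_degM (@pa_deg_vtx k Q (orig y)) (gens_deg hg)) (@pa_deg_vtx k Q (orig x)).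
  by rewrite add0r addr0.
by exists (orig x); rewrite -[LHS]mulrA [X in _ * X = _]vtxMM.
Qed.

Lemma prodfE r i : prodf r i = \sum_l famv l i * r l.
Proof. by rewrite /prodf -lock ffunE. Qed.

Lemma prodf_linear (a : k) r r' : prodf (a *: r + r') = a *: prodf r + prodf r'.
Proof.
apply/ffunP => i; rewrite [RHS]ffun_lin [LHS]prodfE.
rewrite [X in _ = a *: X + _]prodfE [X in _ = _ + X]prodfE scaler_sumr -[RHS]big_split.
by apply: eq_bigr => l _; rewrite [X in _ * X]ffun_lin pa_mulrP.
Qed.

Lemma prodf0 : prodf 0 = 0.
Proof. by apply/ffunP => i; rewrite prodfE big1 ?ffunE // => l _; rewrite ffunE mulr0. Qed.

Lemma prodf_delta l a i : prodf (delta l a) i = famv l i * a.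
Proof.
rewrite prodfE (bigD1 l) //= deltaE eqxx big1 ?addr0 // => l' ne.
by rewrite deltaE (negPf ne) mulr0.
Qed.

(** Every path occurring in f^1_l ends at [u l] and can be prolonged by [a], and its coefficient
    reappears at the longer path. Hence a product row with matching arrow survives the removal of
    zero rows. *)
Lemma famv_mul_neq0 l a : plen a = 1%N -> orig a = u l ->
  [ffun i => famv l i * mono 1 a] <> 0.
Proof.
move=> la oa /ffunP h; apply: (F_neq0 (l := l)); apply/ffunP => i; rewrite [RHS]ffunE.
apply: pa_eqP => p; rewrite coef0; apply/eqP; apply: contraT => np.
have tp := Mvtx_terminus (F_unif l i) np.
have [r hr] := pcat_composable (etrans tp (esym oa)).
by have := h i; rewrite !ffunE => /(congr1 (mcoeff r)); rewrite (coef_mulU _ _ hr) mulr1 coef0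
  => /eqP; rewrite (negPf np).
Qed.

Lemma famv_mul_orig l a i : famv l i * mono 1 a <> 0 -> orig a = u l.
Proof.
move=> h; apply/eqP; apply: contraT => ne; case: h; apply: pa_eqP => r; rewrite coef0.
apply/eqP; apply: contraT => /mcoeffM_pcat[p [q [hr np /coef_mono_neq0 eq]]].
move: ne; rewrite eq; have [<- _] := (pcatE _ _ _).1 hr.
by rewrite (Mvtx_terminus (F_unif l i) np) eqxx.
Qed.

Let W : lmodType k := ({ffun 'I_n -> PA} * {ffun 'I_m -> PA})%type.
Let phi (b : 'I_n * qpath Q) (y : W) : k := (y.1 b.1)@_(b.2).
Let cols := columns n (paths2 ars).
Let wv (r : fam * fam) : W := (fv n r.1, fv m r.2).
Let rs := relation_rows V gens [seq [::] | _ <- F] v ++ product_rows ars F.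
Let nz (r : fam * fam) : bool := has (fun c => c != 0) (dense lt (paths2 ars) r.1).
(** One vertex serves both components: the elimination sees the terminus in the first, and the tag
    inherits it. *)
Let U (y : W) : Prop := exists u', (forall i, y.1 i * vtx k u' = y.1 i) /\
  (forall l, y.2 l * vtx k u' = y.2 l).
(** The last clause says that the first component and the value of the tag agree modulo the
    relations; once the first component is eliminated, the tag is a syzygy. *)
Let good (y : W) : Prop := [/\ fam_deg 2 y.1, fam_deg 1 y.2,
  forall l, vtx k (u l) * y.2 l = y.2 l & forall i, rel2 (y.1 i - prodf y.2 i)].

Lemma deg2_eq0 (y : {ffun 'I_n -> PA}) : fam_deg 2 y ->
  (forall b, b \in cols -> (y b.1)@_(b.2) = 0) -> y = 0.
Proof.
move=> dy h; apply/ffunP => i; rewrite ffunE; apply: pa_eqP => p; rewrite coef0.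
apply/eqP; apply: contraT => np; have /pa_degP/(_ _ np) [lp] := dy i.
by have := h (i, p); rewrite mem_columns /= mem_paths2 // => /(_ isT) /eqP; rewrite (negPf np).
Qed.

Lemma nzP r : size r.1 = n -> fam_deg 2 (fv n r.1) -> ~~ nz r -> fv n r.1 = 0.
Proof.
move=> sr dr; rewrite /nz (dense_columns lt_order _ sr (y := fv n r.1)); last first.
  by move=> i; rewrite ffunE.
rewrite -all_predC => /allP h; apply: deg2_eq0 => // b hb.
by have := h _ (map_f (fun b => (fv n r.1 b.1)@_(b.2)) hb); rewrite /= negbK => /eqP.
Qed.

Lemma nz_neq0 r : size r.1 = n -> nz r -> fv n r.1 <> 0.
Proof.
move=> sr; rewrite /nz (dense_columns lt_order _ sr (y := fv n r.1)); last first.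
  by move=> i; rewrite ffunE.
move=> /hasP[_ /mapP[b _ ->]] /eqP h e; apply: h.
by rewrite e ffunE coef0.
Qed.

Lemma relation_rowP r : r \in relation_rows V gens [seq [::] | _ <- F] v ->
  exists (i : 'I_n) t, [/\ t \in relations V gens, size r.1 = n, size r.2 = m &
    wv r = (delta i (pot t), 0)].
Proof.
move=> /mapP[s hs ->]; case: (posnP n) => [n0|npos].
  by exfalso; move: hs; rewrite (size0nil n0).
have x0 : X by case: (v) npos.
have /mem_diag-/(_ x0)[i [z [li /mapP[t ht ->] ->]]] := hs.
exists (Ordinal li), t; split=> //=; first exact: size_unitfam.
  by rewrite size_map.
by rewrite /wv /= (fv_unitfam (Ordinal li)) fv_zeros.
Qed.

Lemma relation_row (i : 'I_n) t : t \in relations V gens ->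
  exists2 r, r \in relation_rows V gens [seq [::] | _ <- F] v &
    size r.1 = n /\ wv r = (delta i (pot t), 0).
Proof.
move=> ht; pose z : fam := [seq [::] | _ <- F].
exists (unitfam n i t, z).
  apply/mapP; exists (z, unitfam n i t) => //.
  have x0 : X by case: (v) i => [[]|].
  by apply/(mem_diag _ _ x0); exists i, (z, t); rewrite map_f.
by rewrite /= size_unitfam // /wv /= fv_unitfam fv_zeros.
Qed.

Lemma fv_mulr (l : 'I_m) a : fv n [seq mulr_terms s a | s <- nth [::] F l] =
  [ffun i => famv l i * mono 1 a].
Proof.
apply/ffunP => i; rewrite -famvE !ffunE -pot_mulr; congr pot.
case: (ltnP i (size (nth [::] F l))) => h; first by rewrite (nth_map [::]).
by rewrite nth_default ?size_map // nth_default.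
Qed.

Lemma product_rowP r : r \in product_rows ars F ->
  exists (l : 'I_m) a, [/\ a \in ars, size r.1 = n, size r.2 = m &
    wv r = ([ffun i => famv l i * mono 1 a], delta l (mono 1 a))].
Proof.
move=> /(mem_diag _ _ [::])[i [z [li /mapP[a ha ->] ->]]].
exists (Ordinal li), a; split=> //=; last 1 first.
- rewrite /wv /= (fv_unitfam (Ordinal li)) (fv_mulr (Ordinal li)); congr (_, delta _ _).
  by rewrite pot_cons pot_nil addr0.
- by rewrite size_map F_size ?mem_nth.
- exact: size_unitfam.
Qed.

Lemma product_row (l : 'I_m) a : a \in ars ->
  exists2 r, r \in product_rows ars F &
    size r.1 = n /\ wv r = ([ffun i => famv l i * mono 1 a], delta l (mono 1 a)).
Proof.
move=> ha; pose x := [seq mulr_terms s a | s <- nth [::] F l].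
exists (x, unitfam m l [:: (1, a)]).
  by apply/(mem_diag _ _ [::]); exists l, (x, [:: (1, a)]); rewrite map_f.
rewrite size_map F_size ?mem_nth //; split=> //.
rewrite /wv /= fv_unitfam fv_mulr; congr (_, delta _ _).
by rewrite pot_cons pot_nil addr0.
Qed.

Lemma good_closed : linear_closed_pred good.
Proof.
split.
  have h0 : [/\ fam_deg 2 (0 : {ffun 'I_n -> PA}), fam_deg 1 (0 : {ffun 'I_m -> PA}),
      forall l, vtx k (u l) * (0 : {ffun 'I_m -> PA}) l = (0 : {ffun 'I_m -> PA}) l &
      forall i, rel2 ((0 : {ffun 'I_n -> PA}) i - prodf 0 i)].
    split=> [i|i|l|i]; rewrite ?prodf0 !ffunE ?mulr0 ?subrr //; try exact: pa_deg0.
    exact: inspan0.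
  exact: h0.
move=> a x y [x1 x2 x3 x4] [y1 y2 y3 y4].
have := fam_deg_closed k Q n 2; have := fam_deg_closed k Q m 1.
move=> [_ hm] [_ hn]; split=> /=; [exact: hn | exact: hm | |].
  by move=> l; rewrite ffun_lin pa_mulrP x3 y3.
move=> i; have := inspanD a (x4 i) (y4 i); rewrite prodf_linear.
by rewrite scalerBr addrACA -opprD 2!ffun_lin.
Qed.

(** For a product row, being nonzero is what forces the arrow to start at [u l], so that the tag is
    fixed by left multiplication with that vertex. *)
Lemma rs_good r : r \in rs -> nz r ->
  [/\ size r.1 = n, size r.2 = m, U (wv r) & good (wv r)].
Proof.
rewrite mem_cat => /orP[/relation_rowP[i [t [ht s1 s2 e]]] _
  |/product_rowP[l [a [ha s1 s2 e]]] hz].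
  have [dt [u' hu']] := relations_deg ht.
  rewrite s1 s2 e.
  have hU : (forall j, delta i (pot t) j * vtx k u' = delta i (pot t) j) /\
      (forall l, (0 : {ffun 'I_m -> PA}) l * vtx k u' = (0 : {ffun 'I_m -> PA}) l).
    split=> j; last by rewrite ffunE mul0r.
    by rewrite deltaE; case: ifP; rewrite ?mul0r.
  have hG : [/\ fam_deg 2 (delta i (pot t)), fam_deg 1 (0 : {ffun 'I_m -> PA}),
      forall l, vtx k (u l) * (0 : {ffun 'I_m -> PA}) l = (0 : {ffun 'I_m -> PA}) l &
      forall j, rel2 (delta i (pot t) j - prodf 0 j)].
    split=> j; rewrite ?prodf0 ?deltaE ?ffunE ?mulr0 //; last 1 first.
    - rewrite subr0; case: ifP => _; last exact: inspan0.
      by apply: inspan_mem; apply: map_f.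
    - by case: ifP => _; [exact: dt | exact: pa_deg0].
    - exact: pa_deg0.
  by split; [exact: erefl | exact: erefl | exists u'; exact: hU | exact: hG].
have la : plen a = 1%N by apply/eqP; rewrite -ars_mem.
have := nz_neq0 s1 hz; have -> : fv n r.1 = (wv r).1 by [].
rewrite e /= => nz0.
have oa : orig a = u l.
  apply/eqP; apply: contraT => /eqP ne; case: nz0; apply/ffunP => i; rewrite !ffunE.
  by apply/eqP; apply: contraT => /eqP h; case: ne; apply: (famv_mul_orig (i := i)).
rewrite s1 s2; have ht : mono 1 a * vtx k (terminus a) = mono 1 a :> PA.
  by rewrite vtxE pa_mulU pcatp1 mulr1.
have hU : (forall i, [ffun i => famv l i * mono 1 a] i * vtx k (terminus a) =
      [ffun i => famv l i * mono 1 a] i) /\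
    (forall l', delta l (mono 1 a) l' * vtx k (terminus a) = delta l (mono 1 a) l').
  split=> j; first by rewrite ffunE; exact: (etrans (esym (mulrA _ _ _)) (congr1 _ ht)).
  by rewrite deltaE; case: ifP; rewrite ?mul0r ?ht.
have hG : [/\ fam_deg 2 [ffun i => famv l i * mono 1 a], fam_deg 1 (delta l (mono 1 a)),
    forall l', vtx k (u l') * delta l (mono 1 a) l' = delta l (mono 1 a) l' &
    forall i, rel2 ([ffun i => famv l i * mono 1 a] i - prodf (delta l (mono 1 a)) i)].
  split=> j; rewrite ?prodf_delta ?deltaE ?ffunE.
  - rewrite -[2]/(1%:Z + 1%:Z); apply: pa_degM; first exact: F_deg.
    by rewrite -la; exact: pa_degU.
  - by case: ifP => _; [rewrite -[1]/(1%:Z) -la; exact: pa_degU | exact: pa_deg0].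
  - case: eqP => [->|]; last by rewrite mulr0.
    by rewrite -oa vtxE pa_mulU pcat1p mulr1.
  - by rewrite subrr; exact: inspan0.
by split; [exact: erefl | exact: erefl | exists (terminus a); exact: hU | exact: hG].
Qed.

Let rs' := [seq r <- rs | nz r].

Lemma mem_rs' r : (r \in rs') = nz r && (r \in rs).
Proof. exact: mem_filter. Qed.

Lemma phiW_linear b (a : k) (x y : W) : phi b (a *: x + y) = a * phi b x + phi b y.
Proof. by rewrite /phi /= !ffunE coefP. Qed.

Lemma UW_sub b c x y : U x -> U y -> phi b x != 0 -> phi b y != 0 -> U (x - c *: y).
Proof.
move=> [u1 [h1 h1']] [u2 [h2 h2']] nx ny; exists u1.
have e : u2 = u1.
  by rewrite -(Mvtx_terminus (h2 b.1) ny) (Mvtx_terminus (h1 b.1) nx).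
subst u2; split=> j; rewrite addrC -scaleNr /= ffun_lin pa_mullP.
  by rewrite h1 h2.
by rewrite h1' h2'.
Qed.

Lemma syzygy_rows_rep :
  Forall2 (rowrep phi (fun t (y : W) => size t = m /\ y.2 = fv m t) U cols)
    (syzygy_rows lt ars rs) (map wv rs').
Proof.
have -> : syzygy_rows lt ars rs = [seq (dense lt (paths2 ars) r.1, r.2) | r <- rs'].
  by rewrite /syzygy_rows filter_map.
have : forall r, r \in rs' -> r \in rs /\ nz r.
  by move=> r; rewrite mem_rs' => /andP[].
elim: rs' => //= r s IH hs; constructor; last first.
  by apply: IH => r' hr'; apply: hs; rewrite inE hr' orbT.
have [/rs_good h /h[s1 s2 hU _]] := hs _ (mem_head _ _); split=> //=.
by rewrite (dense_columns lt_order _ s1 (y := fv n r.1)) // => i; rewrite ffunE.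
Qed.

(** Each r_l is a combination of arrows starting at u_l, and the product rows of such arrows are not
    discarded. *)
Lemma inspan_products (r : {ffun 'I_m -> PA}) : fam_deg 1 r ->
  (forall l, vtx k (u l) * r l = r l) -> inspan (map wv rs') ((prodf r, r) : W).
Proof.
move=> dr hr.
have er l : r l = \sum_(a <- ars) (r l)@_a *: mono 1 a.
  apply: pa_eqP => p; rewrite coef_sum.
  under eq_bigr => a _ do rewrite coefZ coef_mono.
  case: (boolP (p \in ars)) => hp.
    rewrite (bigD1_seq p) //= eqxx mulr1 big1 ?addr0 // => a ne.
    by rewrite (negPf ne) mulr0.
  rewrite big1_seq => [|a /= ha].
    apply/eqP; apply: contraT => np; have /pa_degP/(_ _ np) [lp] := dr l.
    by rewrite ars_mem lp in hp.
  by case: eqP => [e|_]; [rewrite -e ha in hp | rewrite mulr0].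
have -> : (prodf r, r) = \sum_l \sum_(a <- ars)
    (r l)@_a *: ([ffun i => famv l i * mono 1 a], delta l (mono 1 a)) :> W.
  transitivity (\sum_l ([ffun i => famv l i * r l], delta l (r l)) : W).
    rewrite pair_sum; congr (_, _); last exact: sum_delta.
    by apply/ffunP => i; rewrite prodfE sum_ffunE; apply: eq_bigr => l _; rewrite ffunE.
  apply: eq_bigr => l _; rewrite {1 2}(er l) pair_sum; congr (_, _).
    apply/ffunP => i; rewrite ffunE sum_ffunE mulr_sumr; apply: eq_bigr => a _.
    by rewrite 2!ffunE; apply/esym/scale_pathalgAr.
  apply/ffunP => i; rewrite sum_ffunE deltaE; case: eqP => e.
    by apply: eq_bigr => a _; rewrite ffunE deltaE e eqxx.
  by rewrite big1 // => a _; rewrite ffunE deltaE; case: eqP => // _; rewrite scaler0.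
apply: inspan_sum => l _; rewrite big_seq; apply: inspan_sum => a ha.
case: (eqVneq (r l)@_a 0) => [->|na]; first by rewrite scale0r; exact: inspan0.
apply: inspanZ; have [s hs [ss es]] := product_row l ha.
rewrite -es; apply: inspan_mem; apply: map_f; rewrite mem_rs' mem_cat hs orbT andbT.
have oa : orig a = u l by apply: vtxM_orig (hr l) na.
have la : plen a = 1%N by apply/eqP; rewrite -ars_mem.
apply: contraT => /(nzP ss) h; case: (famv_mul_neq0 la oa).
have ew : fv n s.1 = [ffun i => famv l i * mono 1 a] by rewrite -[LHS]/((wv s).1) es.
rewrite ew in h; apply: h => i; rewrite ffunE -[2]/(1%:Z + 1%:Z).
by apply: pa_degM; [exact: F_deg | rewrite -la; exact: pa_degU].
Qed.

(** A relation row that was discarded is zero in both components, so it is in the span anyway. *)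
Lemma inspan_relations (x : {ffun 'I_n -> PA}) : (forall i, rel2 (x i)) ->
  inspan (map wv rs') ((x, 0) : W).
Proof.
move=> hx; have -> : (x, 0) = \sum_i (delta i (x i), 0) :> W.
  by rewrite pair_sum; congr (_, _); [exact: sum_delta | rewrite big1].
apply: inspan_sum => i _.
apply: (inspan_img (g := fun y => (delta i y, 0) : W)) (hx i).
  by move=> a y z; rewrite pair_lin delta_linear scaler0 addr0.
move=> _ /mapP[t ht ->]; have [s hs [ss es]] := relation_row i ht.
case: (boolP (nz s)) => hz.
  by rewrite -es; apply: inspan_mem; apply: map_f; rewrite mem_rs' hz mem_cat hs.
have e1 : fv n s.1 = delta i (pot t) by rewrite -[LHS]/((wv s).1) es.
have := nzP ss; rewrite e1 => /(_ _ hz) ->; first exact: inspan0.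
move=> j; rewrite deltaE; case: ifP => _; last exact: pa_deg0.
by have [] := relations_deg ht.
Qed.

(** If [prodf z] consists of relations, then (0, z) = ([prodf z], z) - ([prodf z], 0) is a
    combination of product rows minus one of relation rows. It vanishes in every column, so z lies
    in the span of the tags of the kernel; conversely [good] with first component 0 makes each such
    tag a relation. *)
Lemma syzygiesP : let C := syzygies lt V ars gens v F in
  [/\ forall x, x \in C -> [/\ size x = m, fam_deg 1 (fv m x) & fam_unif (fv m x)],
      exists b : seq ('I_m * qpath Q), [/\ size b = size C, uniq b &
        Forall2 (fun x c => fam_tip lt (fv m x) c) C b] &
      forall z, inspan (map (fv m) C) z <->
        [/\ fam_deg 1 z, forall l, vtx k (u l) * z l = z l & forall i, rel2 (prodf z i)]].
Proof.
have tB c (s t : fam) (x y : W) : size s = m /\ x.2 = fv m s -> size t = m /\ y.2 = fv m t ->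
    size (tsub c s t) = m /\ (x - c *: y).2 = fv m (tsub c s t).
  move=> [ss ex] [st ey]; have [h1 h2] := fv_tsub c ss st; split; first exact: h1.
    by rewrite (pair_sndB c x y) ex ey; exact/esym.
have := elim_rep phiW_linear tB UW_sub syzygy_rows_rep.
move=> [ps [kers [_ f2 [_ _ g3 _]]]].
rewrite /syzygies -/rs; set tags := [seq r.2 | r <- _].
have gspan z : inspan (map wv rs') z -> good z.
  move=> h; apply: h good_closed _ => _ /mapP[r hr ->].
  by move: hr; rewrite mem_rs' => /andP[h1 /rs_good/(_ h1)[]].
have kgood z : z \in kers -> [/\ z.1 = 0, good z & forall i, rel2 (prodf z.2 i)].
  move=> /inspan_mem/g3[/gspan gz h0]; have [d1 d2 d3 d4] := gz.
  have z0 : z.1 = 0 by exact: deg2_eq0.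
  split=> // i; have := inspanZ (- 1) (d4 i); rewrite z0 scaleN1r.
  by rewrite [(0 : {ffun _ -> _}) i]ffunE sub0r opprK.
have etags : map (fv m) tags = map snd kers.
  rewrite /tags; elim: f2 => //= r y s t [[_ ->] _] _ ->; by [].
have htags x : x \in tags -> [/\ size x = m, fam_deg 1 (fv m x) & fam_unif (fv m x)].
  move=> hx; have : fv m x \in map snd kers by rewrite -etags map_f.
  move=> /mapP[z hz ez]; have [_ [_ d1 _ _] _] := kgood z hz; rewrite -ez in d1.
  suff [h1 h2] : size x = m /\ fam_unif (fv m x) by [].
  move: hx {ez hz d1}; rewrite /tags; elim: f2 => //= r y s t [[h1 h2] [u' [_ h3]]] _ IH.
  rewrite inE => /predU1P[->|/IH //]; split=> //.
  by exists u' => i; rewrite -h2.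
have [c1 c2 c3] := echelonP lt_order ars_uniq ars_mem htags.
split=> // z; rewrite -c2 etags; split.
  have closed : linear_closed_pred (fun z : {ffun 'I_m -> PA} => [/\ fam_deg 1 z,
      forall l, vtx k (u l) * z l = z l & forall i, rel2 (prodf z i)]).
    split.
      split=> [i|l|i]; rewrite ?prodf0 ?ffunE ?mulr0 //; first exact: pa_deg0.
      exact: inspan0.
    move=> a x y [x1 x2 x3] [y1 y2 y3]; have [_ hm] := fam_deg_closed k Q m 1.
    split; [exact: hm | |].
      by move=> l; rewrite ffun_lin pa_mulrP x2 y2.
    move=> i; rewrite prodf_linear ffun_lin; exact: (inspanD a (x3 i) (y3 i)).
  move=> h; apply: (h _ closed) => _ /mapP[y hy ->].
  by have [_ [_ d2 d3 _] d4] := kgood y hy; split.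
move=> [h1 h2 h3].
have hz : inspan (map wv rs') ((0, z) : W).
  have e : ((0, z) : W) = (prodf z, z) - (prodf z, 0).
    by congr (_, _); rewrite ?subrr ?subr0.
  by rewrite e; exact: (inspanB (inspan_products h1 h2) (inspan_relations h3)).
have : inspan kers ((0, z) : W).
  apply/g3; split; first exact: hz.
  move=> b _; rewrite -[LHS]/(((0 : {ffun 'I_n -> PA}) b.1)@_(b.2)) ffunE; exact: coef0.
have lin2 (a : k) (x y : W) : (a *: x + y).2 = a *: x.2 + y.2 by [].
have mem2 (y : W) : y \in kers -> inspan (map snd kers) y.2.
  by move=> hy; exact: (inspan_mem (map_f snd hy)).
by move=> h; exact: (inspan_img lin2 mem2 h).
Qed.

End Syzygies.

(** * Right modules and coproducts *)

Section RightModules.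
Variable R : pzRingType.
Implicit Types (M N : lmodType R^c).

Lemma ractDl M (x y : M) (r : R) : ract (x + y) r = ract x r + ract y r.
Proof. exact: scalerDr. Qed.

Lemma ractDr M (x : M) (r s : R) : ract x (r + s) = ract x r + ract x s.
Proof. exact: scalerDl. Qed.

Lemma ractA M (x : M) (r s : R) : ract (ract x r) s = ract x (r * s).
Proof. exact: scalerA. Qed.

Lemma ract1 M (x : M) : ract x 1 = x.
Proof. exact: scale1r. Qed.

Lemma ractr0 M (x : M) : ract x 0 = 0.
Proof. exact: scale0r. Qed.

Lemma ract0r M (r : R) : ract (0 : M) r = 0.
Proof. exact: scaler0. Qed.

Lemma ractNr M (x : M) (r : R) : ract x (- r) = - ract x r.
Proof. exact: scaleNr. Qed.

Lemma ractN M (x : M) (r : R) : ract (- x) r = - ract x r.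
Proof. exact: scalerN. Qed.

Lemma ract_suml M (J : Type) (s : seq J) (P : pred J) (F : J -> M) (r : R) :
  ract (\sum_(j <- s | P j) F j) r = \sum_(j <- s | P j) ract (F j) r.
Proof. exact: scaler_sumr. Qed.

Lemma ract_sumr M (J : Type) (s : seq J) (P : pred J) (x : M) (F : J -> R) :
  ract x (\sum_(j <- s | P j) F j) = \sum_(j <- s | P j) ract x (F j).
Proof. exact: (big_morph (ract x) (fun r s => ractDr x r s) (ractr0 x)). Qed.

Lemma linear_ract M N (f : {linear M -> N}) x (r : R) : f (ract x r) = ract (f x) r.
Proof. exact: linearZ_LR. Qed.

Definition submodule M (C : M -> Prop) : Prop :=
  C 0 /\ forall (r : R) x y, C x -> C y -> C (ract x r + y).

Lemma submoduleD M (C : M -> Prop) x y : submodule C -> C x -> C y -> C (x + y).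
Proof. by move=> [_ h] hx hy; rewrite -(ract1 x); apply: h. Qed.

Lemma submodule_ract M (C : M -> Prop) x (r : R) : submodule C -> C x -> C (ract x r).
Proof. by move=> [h0 h] hx; rewrite -(addr0 (ract x r)); apply: h. Qed.

Lemma submoduleB M (C : M -> Prop) x y : submodule C -> C x -> C y -> C (x - y).
Proof.
move=> hC hx hy; apply: submoduleD => //.
by rewrite -(ract1 y) -ractNr; apply: submodule_ract.
Qed.

Lemma submodule_sum M (C : M -> Prop) (J : eqType) (s : seq J) (F : J -> M) :
  submodule C -> (forall j, j \in s -> C (F j)) -> C (\sum_(j <- s) F j).
Proof.
move=> hC h; rewrite big_seq; apply: (big_ind C) => //; first by case: hC.
by move=> x y; apply: submoduleD.
Qed.

Lemma mem_rspan M (J : eqType) (f : J -> M) x :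
  (x \in rspan_pred f) <-> rspan_in f (fun=> True) x.
Proof. by split=> /asboolP. Qed.

Lemma rspan_submodule M (J : eqType) (f : J -> M) : submodule (rspan_in f (fun=> True)).
Proof.
have [h0 h] := rspan_submod f; split=> [|r x y /mem_rspan hx /mem_rspan hy].
  exact/mem_rspan.
by apply/mem_rspan; exact: (h r).
Qed.

Lemma rspan_gen M (J : eqType) (f : J -> M) j : rspan_in f (fun=> True) (f j).
Proof. by exists [:: j], (fun=> 1); rewrite big_seq1 ract1. Qed.

Lemma rspan_min M (J : eqType) (f : J -> M) (C : M -> Prop) x : submodule C ->
  (forall j, C (f j)) -> rspan_in f (fun=> True) x -> C x.
Proof.
move=> hC h [s [r [_ ->]]]; apply: submodule_sum => // j _.
exact: submodule_ract.
Qed.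

(* Repeated indices are collected, so that directness applies. *)
Lemma rspan_uniq M (J : eqType) (f : J -> M) x : rspan_in f (fun=> True) x ->
  exists s (r : J -> R), uniq s /\ x = \sum_(j <- s) ract (f j) (r j).
Proof.
move=> [s [r [_ ->]]]; exists (undup s), (fun j => r j *+ count_mem j s).
rewrite undup_uniq; split=> //; rewrite -big_undup_iterop_count /=.
apply: eq_bigr => j _; rewrite -[iterop _ _ _ _]/(ract (f j) (r j) *+ count_mem j s).
by elim: (count_mem j s) => [|n IH]; rewrite ?mulr0n ?ractr0 // !mulrS ractDr IH.
Qed.

Lemma rspan_fin M n (f : 'I_n -> M) x : rspan_in f (fun=> True) x <->
  exists r : 'I_n -> R, x = \sum_j ract (f j) (r j).
Proof.
split=> [[s [r [_ ->]]]|[r ->]]; last by exists (index_enum 'I_n), r.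
elim: s => [|j s [r' IH]].
  by exists (fun=> 0); rewrite big_nil big1 // => j _; rewrite ractr0.
exists (fun i => (if i == j then r j else 0) + r' i).
rewrite big_cons IH; under [RHS]eq_bigr => i _ do rewrite ractDr.
rewrite big_split /=; congr (_ + _); rewrite (bigD1 j) //= eqxx big1 ?addr0 //.
by move=> i /negPf ->; rewrite ractr0.
Qed.

Lemma direct_fin M n (f : 'I_n -> M) : direct_family f ->
  forall r, \sum_j ract (f j) (r j) = 0 -> forall j, ract (f j) (r j) = 0.
Proof.
move=> hd r h j; apply: (hd (index_enum 'I_n) r (index_enum_uniq _) h).
exact: mem_index_enum.
Qed.

(** A direct sum of cyclic modules maps to [N] as soon as the images of the generators respect
    annihilators. The index set may be infinite, so an element is written over a chosen finite list;
    two such lists are compared on their union, with coefficients extended by 0. *)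
Lemma rspan_lift M N (J : eqType) (f : J -> M) (a : J -> N) :
  direct_family f -> (forall j r, ract (f j) r = 0 -> ract (a j) r = 0) ->
  exists h : {linear rspan f -> N}, forall (x : rspan f) s (r : J -> R), uniq s ->
    val x = \sum_(j <- s) ract (f j) (r j) -> h x = \sum_(j <- s) ract (a j) (r j).
Proof.
move=> hd ha.
have spanP (x : rspan f) : exists sr : seq J * (J -> R), uniq sr.1 /\
    val x = \sum_(j <- sr.1) ract (f j) (sr.2 j).
  have /mem_rspan/rspan_uniq[s [r hs]] := valP x; by exists (s, r).
pose c x := projT1 (cid (spanP x)).
have cP x : uniq (c x).1 /\ val x = \sum_(j <- (c x).1) ract (f j) ((c x).2 j).
  exact: (projT2 (cid (spanP x))).
have ext (g : J -> M) (s t : seq J) r : {subset s <= t} -> uniq s -> uniq t ->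
    \sum_(j <- s) ract (g j) (r j) =
    \sum_(j <- t) ract (g j) (if j \in s then r j else 0).
  move=> sub us ut; rewrite [RHS](bigID (mem s)) /= [X in _ + X]big1 ?addr0; last first.
    by move=> j /negPf ->; rewrite ractr0.
  under [RHS]eq_bigr => j -> do [].
  rewrite -[RHS]big_filter; apply: perm_big; apply: uniq_perm => //.
    exact: filter_uniq.
  by move=> j; rewrite mem_filter; case: (boolP (j \in s)) => // /sub ->.
have ext' (g : J -> N) (s t : seq J) r : {subset s <= t} -> uniq s -> uniq t ->
    \sum_(j <- s) ract (g j) (r j) =
    \sum_(j <- t) ract (g j) (if j \in s then r j else 0).
  move=> sub us ut; rewrite [RHS](bigID (mem s)) /= [X in _ + X]big1 ?addr0; last first.
    by move=> j /negPf ->; rewrite ractr0.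
  under [RHS]eq_bigr => j -> do [].
  rewrite -[RHS]big_filter; apply: perm_big; apply: uniq_perm => //.
    exact: filter_uniq.
  by move=> j; rewrite mem_filter; case: (boolP (j \in s)) => // /sub ->.
have zero (s : seq J) r : uniq s -> \sum_(j <- s) ract (f j) (r j) = 0 ->
    \sum_(j <- s) ract (a j) (r j) = 0.
  move=> us h; rewrite big_seq big1 // => j js; apply: ha.
  exact: hd us h j js.
pose h x := \sum_(j <- (c x).1) ract (a j) ((c x).2 j).
have wd (x : rspan f) s r : uniq s -> val x = \sum_(j <- s) ract (f j) (r j) ->
    h x = \sum_(j <- s) ract (a j) (r j).
  move=> us ex; have [uc ec] := cP x; rewrite /h.
  set t := undup (s ++ (c x).1).
  have ut : uniq t by exact: undup_uniq.
  have st : {subset s <= t} by move=> j js; rewrite mem_undup mem_cat js.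
  have ct : {subset (c x).1 <= t} by move=> j js; rewrite mem_undup mem_cat js orbT.
  rewrite (ext' _ _ t) // [RHS](ext' _ _ t) //; apply/eqP; rewrite -subr_eq0 -sumrB; apply/eqP.
  under eq_bigr => j _ do rewrite -ractNr -ractDr.
  apply: zero => //; under eq_bigr => j _ do rewrite ractDr ractNr.
  by rewrite sumrB -(ext _ _ t) // -(ext _ _ t) // -ec -ex subrr.
have hlin : linear h.
  move=> b x y; have [ux ex] := cP x; have [uy ey] := cP y.
  set t := undup ((c x).1 ++ (c y).1).
  have ut : uniq t by exact: undup_uniq.
  have xt : {subset (c x).1 <= t} by move=> j js; rewrite mem_undup mem_cat js.
  have yt : {subset (c y).1 <= t} by move=> j js; rewrite mem_undup mem_cat js orbT.
  rewrite (wd _ t (fun j => (if j \in (c x).1 then (c x).2 j else 0) * (b : R)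
                      + (if j \in (c y).1 then (c y).2 j else 0))) //.
    rewrite /h [X in _ = b *: X + _](ext' _ _ t) // [X in _ = _ + X](ext' _ _ t) //.
    rewrite -[b *: \sum_(_ <- _) _]/(ract _ (b : R)) ract_suml -big_split.
    by apply: eq_bigr => j _; rewrite ractDr ractA.
  rewrite linearP /= ex ey (ext _ _ t) // [X in _ + X = _](ext _ _ t) //.
  rewrite -[b *: \sum_(_ <- _) _]/(ract _ (b : R)) ract_suml -big_split.
  by apply: eq_bigr => j _; rewrite ractDr ractA.
by exists (HB.pack_for {linear rspan f -> N} h (GRing.isLinear.Build _ _ _ _ h hlin)) => x s r; apply: wd.
Qed.

(** The two conditions make f_j R isomorphic to e_j R. A preimage of the image of f_j, multiplied by
    e_j, is killed by everything that kills f_j, so it is an admissible image. *)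
Lemma projective_rspan M (J : eqType) (f : J -> M) (e : J -> R) :
  direct_family f -> (forall j, ract (f j) (e j) = f j) ->
  (forall j r, ract (f j) r = 0 -> e j * r = 0) -> projective (rspan f).
Proof.
move=> hd he ha A B g phi gsurj.
have fj j : f j \in rspan_pred f by apply/mem_rspan; exact: rspan_gen.
pose F j : rspan f := Submod (fj j).
have lifts j : exists a, g a = phi (F j) by apply: gsurj.
pose a j := ract (projT1 (cid (lifts j))) (e j).
have ga j : g (a j) = phi (F j).
  rewrite /a linear_ract (projT2 (cid (lifts j))) -linear_ract; congr (phi _).
  by apply: val_inj; exact: he.
have ann j r : ract (f j) r = 0 -> ract (a j) r = 0.
  by move=> /ha h; rewrite /a ractA h ractr0.
have [h hh] := rspan_lift hd ann; exists h => x.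
have /mem_rspan/rspan_uniq[s [r [us ex]]] := valP x.
rewrite (hh x s r us ex) linear_sum.
under eq_bigr => j _ do rewrite linear_ract ga -linear_ract.
rewrite -linear_sum; congr (phi _); apply: val_inj; rewrite [RHS]ex.
have sumval (t : seq J) (E : J -> rspan f) : val (\sum_(j <- t) E j) = \sum_(j <- t) val (E j).
  by elim: t => [|j t IH]; rewrite ?big_nil // !big_cons -IH.
by rewrite sumval.
Qed.

End RightModules.

(** * Coproducts of right ideals generated by idempotents *)

Section Coproducts.
Variables (R : pzRingType) (n : nat) (e : 'I_n -> R).
Implicit Types (x y : cop e).

Lemma cop_eqP x y : (forall i, cop_coord x i = cop_coord y i) -> x = y.
Proof. by move=> h; apply: val_inj; apply/ffunP. Qed.

Lemma coordD x y i : cop_coord (x + y) i = cop_coord x i + cop_coord y i.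
Proof. by rewrite /cop_coord /= ffunE. Qed.

Lemma coord0 i : cop_coord (0 : cop e) i = 0.
Proof. by rewrite /cop_coord /= ffunE. Qed.

Lemma coordN x i : cop_coord (- x) i = - cop_coord x i.
Proof. by rewrite /cop_coord /= ffunE. Qed.

Lemma coordB x y i : cop_coord (x - y) i = cop_coord x i - cop_coord y i.
Proof. by rewrite coordD coordN. Qed.

Lemma coordM x r i : cop_coord (ract x r) i = cop_coord x i * r.
Proof. by rewrite /cop_coord /= ffunE. Qed.

Lemma coord_sum (J : Type) (s : seq J) (P : pred J) (F : J -> cop e) i :
  cop_coord (\sum_(j <- s | P j) F j) i = \sum_(j <- s | P j) cop_coord (F j) i.
Proof. exact: (big_morph (fun x => cop_coord x i) (fun x y => coordD x y i) (coord0 i)). Qed.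

Lemma coord_id x i : e i * cop_coord x i = cop_coord x i.
Proof. by have := valP x; rewrite unfold_in => /forallP/(_ i)/eqP. Qed.

(** If some F_i is not fixed by e_i, the value is the default 0; [mkcopE] is the intended use. *)
Definition mkcop (F : 'I_n -> R) : cop e :=
  insubd (0 : cop e) ([ffun i => F i] : rfree R n).

Lemma mkcopE F i : (forall i, e i * F i = F i) -> cop_coord (mkcop F) i = F i.
Proof.
move=> h; rewrite /cop_coord /mkcop val_insubd.
have -> : ([ffun i => F i] : rfree R n) \in cop_pred e.
  by apply/forallP => j; rewrite ffunE; apply/eqP; exact: h.
by rewrite ffunE.
Qed.

Hypothesis ee : forall i, e i * e i = e i.

Definition eps (i : 'I_n) : cop e := mkcop (fun j => if j == i then e i else 0).

Lemma coord_eps i j : cop_coord (eps i) j = if j == i then e i else 0.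
Proof. by rewrite mkcopE // => l; case: eqP => [->|_]; rewrite ?ee ?mulr0. Qed.

Lemma cop_eps x : x = \sum_i ract (eps i) (cop_coord x i).
Proof.
apply: cop_eqP => j; rewrite coord_sum (bigD1 j) //= coordM coord_eps eqxx coord_id.
rewrite big1 ?addr0 // => i ne.
by rewrite coordM coord_eps eq_sym (negPf ne) mul0r.
Qed.

Lemma eps_id i : ract (eps i) (e i) = eps i.
Proof. by apply: cop_eqP => j; rewrite coordM coord_eps; case: eqP => _; rewrite ?ee ?mul0r. Qed.

Lemma cop_lift (N : lmodType R^c) (a : 'I_n -> N) :
  exists h : {linear cop e -> N}, forall x, h x = \sum_i ract (a i) (cop_coord x i).
Proof.
pose h x := \sum_i ract (a i) (cop_coord x i).
have hlin : linear h.
  move=> b x y; rewrite /h -[b *: \sum_i _]/(ract _ (b : R)) ract_suml -big_split.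
  by apply: eq_bigr => i _; rewrite coordD ractDr -[b *: x]/(ract x (b : R)) coordM ractA.
by exists (HB.pack_for {linear cop e -> N} h (GRing.isLinear.Build _ _ _ _ h hlin)).
Qed.

Lemma projective_cop : projective (cop e).
Proof.
move=> A B g phi gsurj; have lifts i : exists a, g a = phi (eps i) by apply: gsurj.
have [h hh] := cop_lift (fun i => projT1 (cid (lifts i))); exists h => x.
rewrite hh linear_sum [in RHS](cop_eps x) linear_sum; apply: eq_bigr => i _.
by rewrite !linear_ract (projT2 (cid (lifts i))).
Qed.

End Coproducts.

(** * Tips *)

Section TipTheory.
Variables (k : fieldType) (Q : quiver) (lt : rel (qpath Q)).
Hypothesis lt_adm : admissible lt.
Local Notation PA := (pathalg k Q).
Implicit Types (p q r s : qpath Q).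

Let lt_order : strict_well_order lt. Proof. by case: lt_adm. Qed.
Let lt_irr : irreflexive lt. Proof. by case: lt_order. Qed.
Let lt_trans : transitive lt. Proof. by case: lt_order. Qed.
Let lt_total p q : [\/ lt p q, p = q | lt q p]. Proof. by case: lt_order => _ _ h _; apply: h. Qed.
Let lt_wf : well_founded (fun p q => lt p q). Proof. by case: lt_order. Qed.

Lemma lt_catr p q r pr qr : lt q p -> pcat p r = Some pr -> pcat q r = Some qr -> lt qr pr.
Proof. by case: lt_adm => _ h _ _; apply: h. Qed.

Lemma lt_catl p q r rp rq : lt q p -> pcat r p = Some rp -> pcat r q = Some rq -> lt rq rp.
Proof. by case: lt_adm => _ _ h _; apply: h. Qed.

Definition lt_eq p q := p = q \/ lt p q.

(** The two products are compared through the mixed product p' q, which is nonzero because the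
    termini of p and p' agree. This is where right uniformity enters the theory of tips. *)
Lemma lt_eq_cat p q p' q' r r' : pcat p q = Some r -> pcat p' q' = Some r' ->
  lt_eq p p' -> lt_eq q q' -> terminus p = terminus p' ->
  (p = p' /\ q = q' /\ r = r') \/ lt r r'.
Proof.
move=> h h' hp hq et; have [e1 _] := (pcatE _ _ _).1 h; have [e2 _] := (pcatE _ _ _).1 h'.
have [m hm] := pcat_composable (etrans (esym et) e1).
case: hp => [ep|lp]; case: hq => [eq|lq].
- by left; subst; move: h'; rewrite h => -[].
- by right; subst p'; apply: lt_catl lq h' h.
- by right; subst q'; apply: lt_catr lp h' h.
- by right; apply: lt_trans (lt_catr lp hm h) (lt_catl lq h' hm).
Qed.

Lemma pathalg_top (y : PA) : y <> 0 ->
  exists s, y@_s != 0 /\ forall s', y@_s' != 0 -> lt_eq s' s.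
Proof.
move=> ny.
have [s0 hs0] : exists s0, y@_s0 != 0.
  apply: contrapT => h; apply: ny; apply: pa_eqP => p; rewrite coef0.
  by apply/eqP; apply: contraT => hp; case: h; exists p.
have aux (l : seq (qpath Q)) x : exists s, s \in x :: l /\ forall s', s' \in x :: l -> lt_eq s' s.
  elim: l => [|z l [s [hs ms]]].
    by exists x; split; [exact: mem_head | move=> s'; rewrite inE => /eqP; left].
  have [h|e|h] := lt_total z s.
  - exists s; split; first by move: hs; rewrite !inE => /orP[] ->; rewrite ?orbT.
    move=> s'; rewrite !inE => /or3P[h'|/eqP ->|h']; [|by right|]; apply: ms; rewrite inE h' ?orbT //.
  - exists s; split; first by move: hs; rewrite !inE => /orP[] ->; rewrite ?orbT.
    move=> s'; rewrite !inE => /or3P[h'|/eqP ->|h']; [|by left|]; apply: ms; rewrite inE h' ?orbT //.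
  - exists z; split; first by rewrite !inE eqxx orbT.
    have ms' w : w \in x :: l -> lt_eq w z.
      by move=> /ms [->|h']; right; [ | apply: lt_trans h' h].
    move=> s'; rewrite !inE => /or3P[h'|/eqP ->|h']; [|by left|]; apply: ms'; rewrite inE h' ?orbT //.
have [s [hs ms]] := aux (msupp y) s0; exists s; split.
  by move: hs; rewrite inE => /predU1P[-> //|]; rewrite -mcoeff_neq0.
by move=> s'; rewrite mcoeff_neq0 => hs'; apply: ms; rewrite inE hs' orbT.
Qed.

Variables (t : nat) (v : 'I_t -> Q).
Local Notation V := (copR k v).
Local Notation B := ('I_t * qpath Q)%type.
Local Notation elt := (@eps_lt Q lt t).
Implicit Types (x y z : V) (b c d : B).

(** Used in [tip_sum], where two tips dividing the same path must divide one another, and to shift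
    divisibility from a product to its left factor. *)
Lemma ptake_prefix p p' q q' r : pcat p q = Some r -> pcat p' q' = Some r ->
  (plen p <= plen p')%N -> ptake (plen p) p' = p.
Proof.
move=> h h' le; apply: qpath_eqP; first by rewrite -(orig_pcat h) (orig_pcat h').
have := arrows_pcat h; rewrite (arrows_pcat h') => /(congr1 (take (plen p))).
by rewrite take_cat -/(plen p') take_size_cat //; case: ltngtP le => // -> _;
  rewrite subnn take0 cats0 => <-; rewrite [LHS]take_size.
Qed.

Lemma elt_irr b : elt b b = false.
Proof. by rewrite /eps_lt lt_irr eqxx ltnn. Qed.

Lemma elt_trans c b d : elt b c -> elt c d -> elt b d.
Proof.
rewrite /eps_lt => /orP[h1|/andP[/eqP e1 h1]] /orP[h2|/andP[/eqP e2 h2]].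
- by rewrite (lt_trans h1 h2).
- by rewrite -e2 h1.
- by rewrite e1 h2.
- by rewrite e1 e2 eqxx (ltn_trans h1 h2) orbT.
Qed.

Lemma elt_total b c : [\/ elt b c, b = c | elt c b].
Proof.
case: b c => [i p] [j q]; rewrite /eps_lt /=; have [h|->|h] := lt_total p q.
- by constructor 1; rewrite h.
- rewrite eqxx lt_irr /=; case: (ltngtP i j) => h; [by constructor 1 | by constructor 3 |].
  by constructor 2; rewrite (val_inj h).
- by constructor 3; rewrite h.
Qed.

Lemma elt_wf : well_founded (fun b c => elt b c).
Proof.
move=> [i p]; elim/(well_founded_ind lt_wf): p i => p IHp i.
have [m hm] := ubnP (i : nat); elim: m i hm => [|m IHm] i hm.
  by exfalso; rewrite ltn0 in hm.
apply: Acc_intro => -[j q]; rewrite /eps_lt => /orP[h|/andP[/eqP e h]].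
  exact: (IHp q h j).
have lj : (j < m)%N := leq_trans h hm.
have e' : q = p := e.
by rewrite e'; exact: (IHm j lj).
Qed.

Lemma occurs_orig x b : occurs x b -> orig b.2 = v b.1.
Proof. exact: vtxM_orig (coord_id x b.1). Qed.

Lemma not_occurs0 b : ~ occurs (0 : V) b.
Proof. by rewrite /occurs coord0 coef0 eqxx. Qed.

Lemma occursB x y c : occurs (x - y) c -> occurs x c \/ occurs y c.
Proof.
rewrite /occurs coordB coefD coefN.
case: (eqVneq (cop_coord x c.1)@_(c.2) 0) => [->|]; last by left.
by rewrite add0r oppr_eq0; right.
Qed.

Lemma occursD x y c : occurs (x + y) c -> occurs x c \/ occurs y c.
Proof.
rewrite /occurs coordD coefD.
by case: (eqVneq (cop_coord x c.1)@_(c.2) 0) => [->|]; [rewrite add0r; right | left].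
Qed.

Lemma exists_tip x : x <> 0 -> exists b, is_tip lt x b.
Proof.
move=> nx.
have [b0 hb0] : exists b0, occurs x b0.
  apply: contrapT => h; apply: nx; apply: cop_eqP => i; apply: pa_eqP => p.
  by rewrite coord0 coef0; apply/eqP; apply: contraT => hp; case: h; exists (i, p).
have [m] : exists m : seq B, forall c, occurs x c -> c \in m.
  exists (flatten [seq [seq (i, p) | p <- msupp (cop_coord x i)] | i <- enum 'I_t]) => c hc.
  apply/flatten_mapP; exists c.1; first exact: mem_enum.
  by apply/mapP; exists c.2; [rewrite -mcoeff_neq0 | case: c {hc}].
have aux (l : seq B) : exists b, occurs x b /\ forall c, c \in l -> occurs x c -> c <> b -> elt c b.
  elim: l => [|z l [b [hb mb]]]; first by exists b0.
  case: (pselect (occurs x z)) => hz; last first.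
    exists b; split=> // c; rewrite inE => /predU1P[->|/mb //]; by move=> /hz.
  have [h|e|h] := elt_total z b.
  - by exists b; split=> // c; rewrite inE => /predU1P[-> //|/mb].
  - by exists b; split=> // c; rewrite inE => /predU1P[->|/mb //]; rewrite e.
  exists z; split=> // c; rewrite inE => /predU1P[-> //|hc] oc _.
  case: (pselect (c = b)) => [->|ne]; first exact: h.
  exact: elt_trans (mb c hc oc ne) h.
by have [b [hb mb]] := aux m => hm; exists b; split=> // c hc; apply: mb => //; exact: hm.
Qed.

Lemma tip_unique x b c : is_tip lt x b -> is_tip lt x c -> b = c.
Proof.
move=> [ob mb] [oc mc]; case: (pselect (b = c)) => // ne.
have h1 := mb _ oc (fun e => ne (esym e)); have h2 := mc _ ob ne.
by have := elt_trans h1 h2; rewrite elt_irr.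
Qed.

Lemma unif_terminus x u b : ract x (vtx k u) = x -> occurs x b -> terminus b.2 = u.
Proof.
move=> hx; apply: (Mvtx_terminus (x := cop_coord x b.1)).
by rewrite -[in RHS]hx coordM.
Qed.

(** All paths occurring in a right uniform x end at the same vertex, so the two largest paths can be
    composed and their product dominates every other one. It has only one factorization within the
    supports, so the leading coefficients multiply. *)
Lemma tip_mul x u b (y : PA) s : ract x (vtx k u) = x -> is_tip lt x b ->
  vtx k u * y = y -> y@_s != 0 -> (forall s', y@_s' != 0 -> lt_eq s' s) ->
  exists r, [/\ pcat b.2 s = Some r, is_tip lt (ract x y) (b.1, r) &
    (cop_coord (ract x y) b.1)@_r = (cop_coord x b.1)@_(b.2) * y@_s].
Proof.
move=> hx [ob mb] hy ns ms; have tb := unif_terminus hx ob; have os := vtxM_orig hy ns.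
have [r hr] := pcat_composable (etrans tb (esym os)); exists r.
have le c : occurs x c -> c = b \/ lt c.2 b.2 \/ (c.2 = b.2 /\ (c.1 < b.1)%N).
  move=> oc; case: (pselect (c = b)) => [|/(mb _ oc)]; first by left.
  by rewrite /eps_lt => /orP[h|/andP[/eqP h1 h2]]; right; [left | right].
have E : (cop_coord (ract x y) b.1)@_r = (cop_coord x b.1)@_(b.2) * y@_s.
  rewrite coordM; apply: (mcoeffM_unique hr) => p' q' h np nq.
  have oc : occurs x (b.1, p') by [].
  have lp : lt_eq p' b.2.
    by have [e|[h1|[e _]]] := le _ oc; [left; rewrite -e | right | left].
  have := lt_eq_cat h hr lp (ms _ nq).
  rewrite tb (unif_terminus hx oc) => /(_ erefl) [[]//|].
  by rewrite lt_irr.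
split=> //; split; first by rewrite /occurs /= E mulf_neq0.
move=> [i r'] /=; rewrite /occurs /= coordM => /mcoeffM_pcat[p' [q' [h np nq]]] ne.
have oc : occurs x (i, p') by [].
have tp : terminus p' = terminus b.2 by rewrite tb (unif_terminus hx oc).
have [e|h1] := le _ oc.
  have lp : lt_eq p' b.2 by left; rewrite -e.
  have := lt_eq_cat h hr lp (ms _ nq) tp; rewrite /eps_lt /=.
  case=> [[_ [_ er]]|->] //; case: ne.
  by rewrite -e er.
have lp : lt_eq p' b.2 by case: h1 => [h1|[h1 _]]; [right | left].
have := lt_eq_cat h hr lp (ms _ nq) tp; rewrite /eps_lt /=.
case=> [[ep [_ er]]|->] //; rewrite er eqxx.
case: h1 => [/= |[_ /= ->]]; last by rewrite orbT.
by rewrite ep lt_irr.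
Qed.

(** A nonzero u r would give x r a tip by [tip_mul]. In other words, x R is isomorphic to u R. *)
Lemma unif_cancel x u (r : PA) : x <> 0 -> ract x (vtx k u) = x -> ract x r = 0 ->
  vtx k u * r = 0.
Proof.
move=> nx hx h; apply: contrapT => nr; have [b hb] := exists_tip nx.
have [s [ns ms]] := pathalg_top nr.
have hy : vtx k u * (vtx k u * r) = vtx k u * r by rewrite [LHS]mulrA vtxMM.
have [r' [_ [+ _] _]] := tip_mul hx hb hy ns ms.
by rewrite -ractA hx h => /not_occurs0.
Qed.

Section Family.
Variables (J : eqType) (f : J -> V) (u : J -> Q) (b : J -> B).
Hypothesis f_unif : forall j, ract (f j) (vtx k (u j)) = f j.
Hypothesis f_tip : forall j, is_tip lt (f j) (b j).

Lemma fam_neq0 j : f j <> 0.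
Proof. by move=> e; have [] := f_tip j; rewrite e => /not_occurs0. Qed.

Lemma fam_cancel j (r : PA) : ract (f j) r = 0 -> vtx k (u j) * r = 0.
Proof. exact: unif_cancel (@fam_neq0 j) (f_unif j). Qed.

(** Two nonzero summands with the same tip would have the tips of two members of the family as
    prefixes of one path, and the shorter would divide the longer. So the largest tip among the
    summands is not cancelled. *)
Lemma tip_sum : (forall j j', j <> j' -> ~ left_divides (b j) (b j')) ->
  forall (s : seq J) (r : J -> PA) j0, uniq s -> j0 \in s -> ract (f j0) (r j0) <> 0 ->
  exists c j, occurs (\sum_(j <- s) ract (f j) (r j)) c /\ left_divides (b j) c.
Proof.
move=> hb s r j0 us js0 n0.
have tips j : ract (f j) (r j) <> 0 -> exists c, is_tip lt (ract (f j) (r j)) c /\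
    left_divides (b j) c.
  move=> nj; have nr : vtx k (u j) * r j <> 0.
    by move=> e; apply: nj; rewrite -(f_unif j) ractA e ractr0.
  have [q [nq mq]] := pathalg_top nr.
  have hy : vtx k (u j) * (vtx k (u j) * r j) = vtx k (u j) * r j by rewrite [LHS]mulrA vtxMM.
  have [c [h1 h2 _]] := tip_mul (f_unif j) (f_tip j) hy nq mq.
  have e : ract (f j) (vtx k (u j) * r j) = ract (f j) (r j) by rewrite -ractA f_unif.
  rewrite e in h2; exists ((b j).1, c); split; first exact: h2.
  by split; [exact: erefl | exists q].
have max (l : seq J) : {subset l <= s} -> (forall j, j \in l -> ract (f j) (r j) = 0) \/
    exists j c, [/\ j \in l, ract (f j) (r j) <> 0, is_tip lt (ract (f j) (r j)) c &
     forall j' c', j' \in l -> is_tip lt (ract (f j') (r j')) c' -> c' = c \/ elt c' c].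
  elim: l => [|j l IH] sub; first by left.
  have [|z0|IH'] := IH; first by move=> i hi; apply: sub; rewrite inE hi orbT.
    case: (pselect (ract (f j) (r j) = 0)) => [e|ne].
      by left=> i; rewrite inE => /predU1P[->|/z0].
    right; have [c [tc _]] := tips j ne; exists j, c; split=> //; first exact: mem_head.
    move=> j' c'; rewrite inE => /predU1P[-> h'|/z0 ->]; first by left; exact: tip_unique h' tc.
    by move=> [/not_occurs0].
  have [j1 [c1 [m1 nz1 t1 h1]]] := IH'; right.
  case: (pselect (ract (f j) (r j) = 0)) => [e|ne].
    exists j1, c1; split=> //; first by rewrite inE m1 orbT.
    move=> j' c'; rewrite inE => /predU1P[->|m']; last exact: h1 m'.
    by rewrite e => -[/not_occurs0].
  have [c [tc _]] := tips j ne; have [lc|ec|lc] := elt_total c c1.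
  - exists j1, c1; split=> //; first by rewrite inE m1 orbT.
    move=> j' c'; rewrite inE => /predU1P[-> h'|m']; last exact: h1 m'.
    by right; rewrite (tip_unique h' tc).
  - exists j1, c1; split=> //; first by rewrite inE m1 orbT.
    move=> j' c'; rewrite inE => /predU1P[-> h'|m']; last exact: h1 m'.
    by left; rewrite (tip_unique h' tc).
  - exists j, c; split=> //; first exact: mem_head.
    move=> j' c'; rewrite inE => /predU1P[-> h'|m' h'].
      by left; exact: tip_unique h' tc.
    by right; have [->|h''] := h1 _ _ m' h'; [exact: lc | exact: elt_trans h'' lc].
have [z0|[j [c [js nj tc hmax]]]] := max s (fun _ h => h).
  by case: n0; apply: z0.
have [c0 [tc0 dc0]] := tips j nj; rewrite (tip_unique tc0 tc) in dc0.
exists c, j; split=> //.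
rewrite /occurs coord_sum coef_sum (bigD1_seq j) //= big1_seq ?addr0; last first.
  move=> i /andP[/eqP ne is_]; apply/eqP; apply: contraT => oc.
  have nz : ract (f i) (r i) <> 0 by move=> e; move: oc; rewrite e coord0 coef0 eqxx.
  have [c' [tc' dc']] := tips i nz.
  have ec : c' = c.
    case: (pselect (c = c')) => // nc; have hc := tc'.2 c oc nc.
    have [//|hc'] := hmax i c' is_ tc'.
    by have := elt_trans hc hc'; rewrite elt_irr.
  rewrite ec in dc'; have [e1 [s1 p1]] := dc0; have [e2 [s2 p2]] := dc'.
  have [le|le] := leqP (plen (b j).2) (plen (b i).2).
    case: (hb j i) => [e|]; first by apply: ne.
    split; first by rewrite e1 e2.
    exists (pdrop (plen (b j).2) (b i).2).
    have e : ptake (plen (b j).2) (b i).2 = (b j).2 by exact: ptake_prefix p1 p2 le.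
    by rewrite -{1}e; exact: pcat_take_drop.
  case: (hb i j) => [e|]; first by apply: ne.
  split; first by rewrite e1 e2.
  exists (pdrop (plen (b i).2) (b j).2).
  have e : ptake (plen (b i).2) (b j).2 = (b i).2 by exact: ptake_prefix p2 p1 (ltnW le).
  by rewrite -{1}e; exact: pcat_take_drop.
by have [] := tc.
Qed.

Lemma tip_direct : (forall j j', j <> j' -> ~ left_divides (b j) (b j')) -> direct_family f.
Proof.
move=> hb s r us h j js; apply: contrapT => n0.
by have [c [j' [+ _]]] := tip_sum hb us js n0; rewrite h => /not_occurs0.
Qed.

Lemma rspan_tip : (forall j j', j <> j' -> ~ left_divides (b j) (b j')) ->
  forall x, rspan_in f (fun=> True) x -> x <> 0 -> exists c j, occurs x c /\ left_divides (b j) c.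
Proof.
move=> hb x /rspan_uniq[s [r [us ->]]] nx.
have [j [js nj]] : exists j, j \in s /\ ract (f j) (r j) <> 0.
  apply: contrapT => h; apply: nx; rewrite big_seq big1 // => j js.
  by apply: contrapT => nj; apply: h; exists j.
exact: (@tip_sum hb s r j us js nj).
Qed.

(** Well-founded induction on an upper bound [d] of the occurring basis elements, which need not
    itself occur. The term at [d] is either cancelled by a multiple of some f_j whose tip divides
    it, or moved to the remainder. *)
Lemma division x : exists n z, [/\ x = n + z, rspan_in f (fun=> True) n &
  forall c, occurs z c -> forall j, ~ left_divides (b j) c].
Proof.
have sub := rspan_submodule f.
case: (pselect (x = 0)) => [->|/exists_tip[d [_ hd]]].
  exists 0, 0; rewrite addr0; split=> //; first by case: sub.
  by move=> c /not_occurs0.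
have {}hd c : occurs x c -> c = d \/ elt c d.
  by move=> oc; case: (pselect (c = d)) => [|/(hd c oc)]; [left | right].
elim/(well_founded_ind elt_wf): d x hd => d IH x hd.
have smaller y : (forall c, occurs y c -> elt c d) -> exists n z,
    [/\ y = n + z, rspan_in f (fun=> True) n & forall c, occurs z c -> forall j, ~ left_divides (b j) c].
  move=> hy; case: (pselect (y = 0)) => [->|/exists_tip[d' [o' hd']]].
    exists 0, 0; rewrite addr0; split=> //; first by case: sub.
    by move=> c /not_occurs0.
  apply: (IH d') => [|c oc]; first exact: hy.
  by case: (pselect (c = d')) => [|/(hd' c oc)]; [left | right].
case: (pselect (occurs x d)) => od; last first.
  by apply: smaller => c oc; have [e|//] := hd c oc; rewrite e in oc.
set a := (cop_coord x d.1)@_(d.2).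
case: (pselect (exists j, left_divides (b j) d)) => [[j [e1 [s hs]]]|nd].
  pose lc := (cop_coord (f j) (b j).1)@_((b j).2).
  have nlc : lc != 0 by have [] := f_tip j.
  have na : a / lc != 0 by rewrite mulf_neq0 ?invr_eq0.
  have os : orig s = u j.
    by have [<- _] := (pcatE _ _ _).1 hs; rewrite (unif_terminus (f_unif j) (f_tip j).1).
  have hy : vtx k (u j) * mono (a / lc) s = mono (a / lc) s.
    by rewrite vtxE pa_mulU mul1r -os pcat1p.
  have ms s' : (mono (a / lc) s)@_s' != 0 -> lt_eq s' s by move=> /coef_mono_neq0 ->; left.
  have ns : (mono (a / lc) s)@_s != 0 by rewrite coef_mono eqxx.
  have [r [hr tr er]] := tip_mul (f_unif j) (f_tip j) hy ns ms.
  have rd : r = d.2 by move: hr; rewrite hs => -[].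
  set y := ract (f j) _ in tr er.
  have ed : ((b j).1, r) = d by rewrite e1 rd; case: (d).
  rewrite ed in tr.
  have [|n [z [ey hn hz]]] := smaller (x - y).
    move=> c oc; have ne : c <> d.
      move=> e; move: oc; rewrite e /occurs coordB coefD coefN.
      rewrite -e1 -rd er coef_mono eqxx -/lc e1 rd -/a mulrCA divff // mulr1 subrr eqxx //.
    have [/hd[] //|/(tr.2 c)] := occursB oc; exact.
  exists (n + y), z; split=> //; first by rewrite -(subrK y x) ey addrAC.
  by apply: submoduleD => //; apply: submodule_ract => //; exact: rspan_gen.
pose y : V := mkcop (fun i => vtx k (v i)) (fun i => if i == d.1 then mono a d.2 else 0).
have yE i : cop_coord y i = if i == d.1 then mono a d.2 else 0.
  rewrite mkcopE // => j; case: eqP => [->|]; last by rewrite mulr0.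
  by rewrite -(occurs_orig od) vtxE pa_mulU mul1r pcat1p.
have oy c : occurs y c -> c = d.
  rewrite /occurs yE; case: (c.1 =P d.1) => [e|_]; last by rewrite coef0 eqxx.
  by move=> /coef_mono_neq0 e'; case: (c) (d) e e' => i p [i' p'] /= -> ->.
have [|n [z [ey hn hz]]] := smaller (x - y).
  move=> c oc; have ne : c <> d.
    move=> e; move: oc; rewrite e /occurs coordB coefD coefN yE eqxx.
    by rewrite coef_mono eqxx -/a subrr eqxx.
  by have [/hd[] //|/oy //] := occursB oc.
exists n, (z + y); split=> //; first by rewrite -(subrK y x) ey addrA.
move=> c oc j; have [/hz //|/oy -> dj] : occurs z c \/ occurs y c.
  exact: occursD.
by apply: nd; exists j.
Qed.

End Family.

Lemma left_dividesI b c d : left_divides b c -> left_divides c d -> left_divides b d.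
Proof.
move=> [e1 [s hs]] [e2 [s' hs']]; split; first by rewrite e1.
have [m hm] : exists m, pcat s s' = Some m.
  apply: pcat_composable; rewrite -(terminus_pcat hs).
  by have [] := (pcatE _ _ _).1 hs'.
exists m; have := pcatA b.2 s s'; rewrite hm hs /= => ->; exact: hs'.
Qed.

Lemma left_divides_refl b : left_divides b b.
Proof. by split=> //; exists (vertex_path (terminus b.2)); exact: pcatp1. Qed.

Lemma left_divides_plen b c : left_divides b c -> (plen b.2 <= plen c.2)%N.
Proof. by move=> [_ [s /plen_pcat ->]]; exact: leq_addr. Qed.

Lemma left_divides_eq b c : left_divides b c -> plen b.2 = plen c.2 -> b = c.
Proof.
move=> [e1 [s hs]] el; have ls := plen_pcat hs.
have s0 : plen s = 0%N by apply/eqP; rewrite -(eqn_add2l (plen b.2)) addn0 -ls el.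
have e2 : b.2 = c.2.
  have := hs; rewrite (plen0 s0); have [<- _] := (pcatE _ _ _).1 hs.
  by rewrite pcatp1 => -[].
by case: b c e1 e2 {el hs ls} => i p [j q] /= -> ->.
Qed.

(** The indices are the tips of elements of [C] that are minimal for left division. An element with
    such a tip, multiplied by the vertex where the tip ends, becomes uniform and keeps its tip.
    Dividing x in [C] leaves a remainder in [C] whose tip, if any, would be divisible by a minimal
    one; so it is 0. *)
Lemma tip_basis (C : V -> Prop) : submodule C ->
  exists (U : eqType) (f : U -> V) (u : U -> Q) (b : U -> B),
  [/\ forall j, C (f j), forall j, ract (f j) (vtx k (u j)) = f j,
      forall j, is_tip lt (f j) (b j),
      forall j j', j <> j' -> ~ left_divides (b j) (b j') &
      forall x, C x -> rspan_in f (fun=> True) x].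
Proof.
move=> hC; pose T b := exists x, C x /\ is_tip lt x b.
pose mint b := T b /\ forall c, T c -> left_divides c b -> c = b.
pose U : eqType := {b : B | `[< mint b >]}.
have hU (j : U) : exists x, [/\ C x, is_tip lt x (val j) &
    ract x (vtx k (terminus (val j).2)) = x].
  have /asboolP[[x [cx [ob mb]]] _] := valP j.
  exists (ract x (vtx k (terminus (val j).2))); split; first exact: submodule_ract.
    split; first by rewrite /occurs coordM coef_Mvtx eqxx.
    move=> c; rewrite {1}/occurs coordM coef_Mvtx; case: (terminus c.2 =P _) => _.
      exact: mb.
    by rewrite eqxx.
  by rewrite ractA vtxMM.
pose f j := projT1 (cid (hU j)).
have fP j : [/\ C (f j), is_tip lt (f j) (val j) & ract (f j) (vtx k (terminus (val j).2)) = f j].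
  exact: (projT2 (cid (hU j))).
have f1 j : C (f j) by case: (fP j).
have f2 j : is_tip lt (f j) (val j) by case: (fP j).
have f3 j : ract (f j) (vtx k (terminus (val j).2)) = f j by case: (fP j).
exists U, f, (fun j => terminus (val j).2), (fun j => val j); split=> //.
  move=> j j' ne dj; apply: ne; apply: val_inj.
  have /asboolP[_ hm] := valP j'; apply: hm dj.
  by exists (f j).
(* Descent on length: a left divisor of the same length is equal. *)
have minimal b : T b -> exists j : U, left_divides (val j) b.
  have [m] := ubnP (plen b.2); elim: m b => // m IH b /ltnSE hm hb.
  case: (pselect (mint b)) => [mb|nmb].
    have pb : `[< mint b >] by apply/asboolP.
    by exists (exist _ b pb); exact: left_divides_refl.
  have [c [tc dc ne]] : exists c, [/\ T c, left_divides c b & c <> b].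
    apply: contrapT => h; apply: nmb; split=> // c tc dc; apply: contrapT => ne.
    by apply: h; exists c.
  have lc : (plen c.2 < plen b.2)%N.
    rewrite ltn_neqAle (left_divides_plen dc) andbT; apply/eqP => e.
    by apply: ne; exact: left_divides_eq.
  have [j hj] := IH c (leq_trans lc hm) tc.
  by exists j; exact: left_dividesI hj dc.
move=> x cx; have [n [z [ex hn hz]]] := division f3 f2 x.
case: (pselect (z = 0)) => [z0|nz]; first by rewrite ex z0 addr0.
have cz : C z.
  have -> : z = x - n by rewrite ex addrAC subrr add0r.
  by apply: submoduleB => //; apply: rspan_min hn.
have [d hd] := exists_tip nz; have [j hj] := minimal d (ex_intro _ z (conj cz hd)).
by case: (hz d hd.1 j).
Qed.

End TipTheory.

Section IntegerOrder.
Import Order.TTheory Num.Theory.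

Lemma ltz_addl (j : nat) (d : int) : (j%:Z + d < d)%R = false.
Proof. by rewrite ltNge lerDr le0z_nat. Qed.

End IntegerOrder.

(** * Ideals and the grading of the quotient *)

Section Ideals.
Variable R : pzRingType.

Lemma ideal_genD (S : R -> Prop) x y : ideal_gen S x -> ideal_gen S y -> ideal_gen S (x + y).
Proof.
move=> [n [a [g [b [hg ->]]]]] [n' [a' [g' [b' [hg' ->]]]]].
pose sel (X : Type) (f : 'I_n -> X) (f' : 'I_n' -> X) (i : 'I_(n + n')) :=
  match split i with inl j => f j | inr j => f' j end.
exists (n + n')%N, (sel _ a a'), (sel _ g g'), (sel _ b b'); split.
  by move=> i; rewrite /sel; case: (split i).
rewrite big_split_ord /=; congr (_ + _); apply: eq_bigr => i _; rewrite /sel.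
  by rewrite (unsplitK (inl i : 'I_n + 'I_n')).
by rewrite (unsplitK (inr i : 'I_n + 'I_n')).
Qed.

Lemma ideal_gen0 (S : R -> Prop) : ideal_gen S 0.
Proof.
by exists 0%N, (fun=> 0), (fun=> 0), (fun=> 0); split=> [[]|]; rewrite ?big_ord0.
Qed.

Lemma ideal_genM (S : R -> Prop) c d x : ideal_gen S x -> ideal_gen S (c * x * d).
Proof.
move=> [n [a [g [b [hg ->]]]]]; exists n, (fun i => c * a i), g, (fun i => b i * d).
split=> //; rewrite mulr_sumr mulr_suml; apply: eq_bigr => i _.
by rewrite !mulrA.
Qed.

Lemma ideal_gen_mem (S : R -> Prop) x : S x -> ideal_gen S x.
Proof.
move=> h; exists 1%N, (fun=> 1), (fun=> x), (fun=> 1); split=> //.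
by rewrite big_ord1 mul1r mulr1.
Qed.

End Ideals.

(** * Homogeneous components in the quotient algebra *)

Section GradedQuotient.
Variables (k : fieldType) (Q : quiver) (I : pathalg k Q -> Prop) (L : pzRingType).
Variable pr : {rmorphism pathalg k Q -> L}.
Local Notation PA := (pathalg k Q).
Hypothesis I_sub : forall x, I x -> ideal_prod (@arrow_ideal k Q) (@arrow_ideal k Q) x.
Hypothesis I_homog : exists S : PA -> Prop,
  (forall g, S g -> exists n : nat, pa_deg n%:Z g) /\ forall x, I x <-> ideal_gen S x.
Hypothesis I_quot : is_quotient_ring I pr.

Lemma ideal0 : I 0.
Proof. by have [S [_ h]] := I_homog; apply/h; exact: ideal_gen0. Qed.
Lemma idealD x y : I x -> I y -> I (x + y).
Proof. by have [S [_ h]] := I_homog => /h hx /h hy; apply/h; exact: ideal_genD. Qed.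
Lemma idealM a b x : I x -> I (a * x * b).
Proof. by have [S [_ h]] := I_homog => /h hx; apply/h; exact: ideal_genM. Qed.
Lemma idealMr x a : I x -> I (x * a).
Proof. by move=> /(idealM 1 a); rewrite mul1r. Qed.
Lemma idealMl x a : I x -> I (a * x).
Proof. by move=> /(idealM a 1); rewrite mulr1. Qed.
Lemma ideal_sum (J : Type) (s : seq J) (P : pred J) (F : J -> PA) :
  (forall j, P j -> I (F j)) -> I (\sum_(j <- s | P j) F j).
Proof.
by move=> h; apply: (big_ind I) => //; [exact: ideal0 | exact: idealD].
Qed.

Lemma arrow_ideal_low (x : PA) p : arrow_ideal x -> x@_p != 0 -> (0 < plen p)%N.
Proof.
move=> [n [a [g [b [hg ->]]]]] h.
have [i hi] : exists i, (a i * g i * b i)@_p != 0.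
  apply: contrapT => nex; move/eqP: h; apply; rewrite coef_sum big1 // => i _.
  by apply/eqP; apply: contraT => hi; case: nex; exists i.
have [p1 [q1 [h1 n1 _]]] := mcoeffM_pcat hi.
have [p2 [q2 [h2 _ n2]]] := mcoeffM_pcat n1.
have [ar er] := hg i; move: n2; rewrite er => /coef_mono_neq0 eq.
by rewrite (plen_pcat h1) (plen_pcat h2) -eq /= addn1 addSn.
Qed.

Lemma ideal_low x p : I x -> x@_p != 0 -> (1 < plen p)%N.
Proof.
move=> /I_sub[n [a [b [h ->]]]] hp.
have [i hi] : exists i, (a i * b i)@_p != 0.
  apply: contrapT => nex; move/eqP: hp; apply; rewrite coef_sum big1 // => i _.
  by apply/eqP; apply: contraT => hi; case: nex; exists i.
have [ha hb] := h i; have [p1 [q1 [h1 n1 n2]]] := mcoeffM_pcat hi.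
have l1 := arrow_ideal_low ha n1; have l2 := arrow_ideal_low hb n2.
by rewrite (plen_pcat h1); case: (plen p1) l1 => // m _; rewrite addSn ltnS addn_gt0 l2 orbT.
Qed.

(** As I is contained in J^2, the degrees 0 and 1 of the quotient are those of kQ, so identities
    there can be verified on lifts. *)
Lemma ideal_low_eq0 (n : nat) x : I x -> pa_deg n%:Z x -> (n < 2)%N -> x = 0.
Proof.
move=> hx hd hn; apply: pa_eqP => p; rewrite coef0; apply/eqP; apply: contraT => np.
have l := ideal_low hx np; have /pa_degP/(_ _ np) [e] := hd.
by move: l; rewrite e ltnNge -ltnS hn.
Qed.

Lemma hcompD n x y : hcomp n (x + y) = hcomp n x + hcomp n y :> PA.
Proof. by rewrite -[x in LHS]scale1r hcompP scale1r. Qed.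

(** Splitting the outer factors of a g b into components, with g homogeneous, writes the element as
    a sum of homogeneous elements of I. *)
Lemma ideal_hcomp n x : I x -> I (hcomp n x).
Proof.
have [S [hS hI]] := I_homog; move=> /hI[m [a [g [b [hg ->]]]]].
rewrite hcomp_sumE; apply: ideal_sum => i _; have [d hd] := hS _ (hg i).
have Ig : I (g i) by apply/hI; exact: ideal_gen_mem.
have [N1 /(_ N1 (leqnn N1)) e1] := hcomp_sum (a i).
have [N2 /(_ N2 (leqnn N2)) e2] := hcomp_sum (b i).
have -> : a i * g i * b i = \sum_(j1 < N1) \sum_(j2 < N2) hcomp j1 (a i) * g i * hcomp j2 (b i).
  rewrite {1}e1 {1}e2 [X in X * _ = _]mulr_suml [LHS]mulr_suml; apply: eq_bigr => j1 _.
  exact: mulr_sumr.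
rewrite hcomp_sumE; apply: ideal_sum => j1 _; rewrite hcomp_sumE; apply: ideal_sum => j2 _.
have hd' := pa_degM (pa_degM (pa_deg_hcomp j1 (a i)) hd) (pa_deg_hcomp j2 (b i)).
case: (eqVneq (j1%:Z + d%:Z + j2%:Z) n) => e; last first.
  by rewrite (hcomp_out hd' e); exact: ideal0.
by rewrite hcomp_id -?e //; exact: idealM.
Qed.

Lemma pr_eq0 x : pr x = 0 <-> I x. Proof. by case: I_quot. Qed.
Lemma pr_surj y : exists x, pr x = y. Proof. by case: I_quot. Qed.

Definition lift (y : L) : PA := projT1 (cid (pr_surj y)).
Lemma liftK y : pr (lift y) = y. Proof. exact: (projT2 (cid (pr_surj y))). Qed.

Lemma pr_eq x y : I (x - y) -> pr x = pr y.
Proof. by move=> /pr_eq0; rewrite rmorphB => /eqP; rewrite subr_eq0 => /eqP. Qed.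

Lemma quot_deg0 n : quot_deg pr n 0.
Proof. by exists 0; [exact: pa_deg0 | rewrite rmorph0]. Qed.
Lemma quot_degB n x y : quot_deg pr n x -> quot_deg pr n y -> quot_deg pr n (x - y).
Proof. by move=> [a ha <-] [b hb <-]; exists (a - b); [exact: pa_degB | rewrite rmorphB]. Qed.
Lemma quot_degM n m x y : quot_deg pr n x -> quot_deg pr m y -> quot_deg pr (n + m) (x * y).
Proof. by move=> [a ha <-] [b hb <-]; exists (a * b); [exact: pa_degM | rewrite rmorphM]. Qed.
Lemma quot_deg_vtx u : quot_deg pr 0 (pr (vtx k u)).
Proof. by exists (vtx k u) => //; exact: pa_deg_vtx. Qed.

Definition lcomp (n : int) (y : L) : L := locked (pr (hcomp n (lift y))).

(** The choice of preimage made by [lift] does not matter, since I contains the components of its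
    elements. *)
Lemma lcomp_pr n x : lcomp n (pr x) = pr (hcomp n x).
Proof.
rewrite /lcomp -lock; apply: pr_eq.
have -> : hcomp n (lift (pr x)) - hcomp n x = hcomp n (lift (pr x) - x).
  by rewrite addrC -scaleN1r -hcompP scaleN1r addrC.
by apply: ideal_hcomp; apply/pr_eq0; rewrite rmorphB liftK subrr.
Qed.

Lemma lcompD n x y : lcomp n (x + y) = lcomp n x + lcomp n y.
Proof. by rewrite -(liftK x) -(liftK y) -rmorphD !lcomp_pr hcompD rmorphD. Qed.

Lemma lcomp0 n : lcomp n 0 = 0.
Proof.
rewrite -[0 in LHS](rmorph0 pr) lcomp_pr (_ : hcomp n 0 = 0) ?rmorph0 //.
by apply: pa_eqP => p; rewrite coef_hcomp coef0 if_same.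
Qed.

Lemma lcomp_sum n (J : Type) (s : seq J) (P : pred J) (F : J -> L) :
  lcomp n (\sum_(j <- s | P j) F j) = \sum_(j <- s | P j) lcomp n (F j).
Proof. exact: (big_morph (lcomp n) (lcompD n) (lcomp0 n)). Qed.

Lemma quot_deg_lcomp n y : quot_deg pr n (lcomp n y).
Proof. by rewrite -(liftK y) lcomp_pr; exists (hcomp n (lift y)) => //; exact: pa_deg_hcomp. Qed.

Lemma lcomp_id n y : quot_deg pr n y -> lcomp n y = y.
Proof. by move=> [x hx <-]; rewrite lcomp_pr hcomp_id. Qed.

Lemma lcomp_out n m y : quot_deg pr n y -> n != m -> lcomp m y = 0.
Proof. by move=> [x hx <-] ne; rewrite lcomp_pr (hcomp_out hx ne) rmorph0. Qed.

Lemma lcompMr n m a y : quot_deg pr m a -> lcomp n (y * a) = lcomp (n - m) y * a.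
Proof.
move=> [x hx <-]; rewrite -(liftK y) -rmorphM 2!lcomp_pr -rmorphM.
by congr (pr _); exact: hcompM_homr.
Qed.

Lemma lcompMl n m a y : quot_deg pr m a -> lcomp n (a * y) = a * lcomp (n - m) y.
Proof.
move=> [x hx <-]; rewrite -(liftK y) -rmorphM 2!lcomp_pr -rmorphM.
by congr (pr _); exact: hcompM_homl.
Qed.

Lemma lcomp_neg n y : (n < 0)%R -> lcomp n y = 0.
Proof. by move=> h; rewrite -(liftK y) lcomp_pr hcomp_neg // rmorph0. Qed.

Lemma lcomp_decomp y : exists N : nat,
  (y = \sum_(i < N) lcomp i y) /\ forall n : nat, (N <= n)%N -> lcomp n y = 0.
Proof.
have [N hN] := hcomp_sum (lift y).
have E n : (N <= n)%N -> y = \sum_(i < n) lcomp i y.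
  move=> le; rewrite -[LHS]liftK [in LHS](hN n le) rmorph_sum.
  by apply: eq_bigr => i _; rewrite -lcomp_pr liftK.
exists N; split=> [|n le]; first exact: E.
(* The decompositions with n and with n + 1 summands agree, so the additional summand is 0. *)
have := E n.+1 (leqW le); rewrite big_ord_recr /= -E // => /eqP.
by rewrite -[X in X == _]addr0 (inj_eq (addrI _)) eq_sym => /eqP.
Qed.

Section CoproductComponents.
Variables (n : nat) (u : 'I_n -> Q) (s : int).
Local Notation B := (copL pr u).
Implicit Types (x y : B).

Lemma vtxL_idem i : pr (vtx k (u i)) * pr (vtx k (u i)) = pr (vtx k (u i)).
Proof. by rewrite -rmorphM vtxMM. Qed.

Definition ccomp (d : int) (x : B) : B := mkcop _ (fun i => lcomp (d - s) (cop_coord x i)).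

Lemma coord_ccomp d x i : cop_coord (ccomp d x) i = lcomp (d - s) (cop_coord x i).
Proof.
apply: (mkcopE (F := fun i => lcomp (d - s) (cop_coord x i))) => j.
by rewrite -[d - s in LHS]subr0 -(lcompMl _ _ (quot_deg_vtx (u j))) coord_id.
Qed.

Lemma ccomp_deg d x : copL_deg s d (ccomp d x).
Proof. by move=> i; rewrite coord_ccomp; exact: quot_deg_lcomp. Qed.

Lemma ccomp_id d x : copL_deg s d x -> ccomp d x = x.
Proof. by move=> h; apply: cop_eqP => i; rewrite coord_ccomp lcomp_id. Qed.

Lemma ccomp_out d d' x : copL_deg s d x -> d != d' -> ccomp d' x = 0.
Proof.
move=> h ne; apply: cop_eqP => i; rewrite coord_ccomp coord0 (lcomp_out (h i)) //.
by rewrite (inj_eq (addIr _)).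
Qed.

Lemma ccomp_sum d (J : Type) (r : seq J) (P : pred J) (F : J -> B) :
  ccomp d (\sum_(j <- r | P j) F j) = \sum_(j <- r | P j) ccomp d (F j).
Proof.
apply: cop_eqP => i; rewrite coord_ccomp !coord_sum lcomp_sum.
by apply: eq_bigr => j _; rewrite coord_ccomp.
Qed.

Lemma ccompM d m x a : quot_deg pr m a -> ccomp d (ract x a) = ract (ccomp (d - m) x) a.
Proof.
move=> ha; apply: cop_eqP => i; rewrite coord_ccomp !coordM coord_ccomp.
by rewrite (lcompMr _ _ ha) addrAC.
Qed.

Lemma copL_deg0 d : copL_deg s d (0 : B).
Proof. by move=> i; rewrite coord0; exact: quot_deg0. Qed.

Lemma copL_degB d x y : copL_deg s d x -> copL_deg s d y -> copL_deg s d (x - y).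
Proof. by move=> hx hy i; rewrite coordB; exact: quot_degB. Qed.

Lemma copL_degM d m x a : copL_deg s d x -> quot_deg pr m a -> copL_deg s (d + m) (ract x a).
Proof. by move=> hx ha i; rewrite coordM addrAC; exact: quot_degM. Qed.

Lemma copL_deg_eps i : copL_deg s s (eps (fun i => pr (vtx k (u i))) i).
Proof.
move=> j; rewrite subrr (coord_eps vtxL_idem); case: eqP => _; last exact: quot_deg0.
exact: quot_deg_vtx.
Qed.

(** Any list of degrees covering the range is allowed, so that a degree under study can be added to
    it. *)
Lemma ccomp_decomp x : exists N : nat, forall r : seq int, uniq r ->
  (forall i : nat, (i < N)%N -> (i%:Z + s) \in r) -> x = \sum_(d <- r) ccomp d x.
Proof.
have [N hN] : exists N : nat, forall i,
    (cop_coord x i = \sum_(j < N) lcomp j (cop_coord x i)) /\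
    forall m : nat, (N <= m)%N -> lcomp m (cop_coord x i) = 0.
  pose N0 i := projT1 (cid (lcomp_decomp (cop_coord x i))).
  have hN0 i : (cop_coord x i = \sum_(j < N0 i) lcomp j (cop_coord x i)) /\
      forall m : nat, (N0 i <= m)%N -> lcomp m (cop_coord x i) = 0.
    exact: (projT2 (cid (lcomp_decomp (cop_coord x i)))).
  exists (\max_i N0 i) => i; have [h1 h2] := hN0 i.
  have le : (N0 i <= \max_i N0 i)%N by exact: leq_bigmax.
  split=> [|m hm]; last by apply: h2; exact: leq_trans hm.
  rewrite [LHS]h1 (big_ord_widen _ (fun j => lcomp j (cop_coord x i)) le) big_mkcond.
  by apply: eq_bigr => j _; case: ltnP => // /h2 ->.
exists N => r ur hr; apply: cop_eqP => i; rewrite coord_sum.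
under eq_bigr => d _ do rewrite coord_ccomp.
pose r0 := [seq j%:Z + s | j <- iota 0 N].
have ur0 : uniq r0.
  by rewrite map_inj_uniq ?iota_uniq // => a b /addIr [].
have hr0 : {subset r0 <= r}.
  by move=> d /mapP[j]; rewrite mem_iota add0n => /andP[_ lj] ->; exact: hr.
rewrite (bigID (mem r0)) /= [X in _ + X]big1_seq ?addr0; last first.
  (* Outside the range the components vanish: below degree s because the quotient has no negative
     degrees, above by the choice of N. *)
  move=> d /andP[nd _]; case ed: (d - s) => [m|m]; last by rewrite lcomp_neg.
  have [_ hm] := hN i; apply: hm; rewrite leqNgt; apply: contra nd => lm.
  by apply/mapP; exists m; rewrite ?mem_iota // -ed subrK.
rewrite -big_filter (perm_big r0) /=; last first.
  apply: uniq_perm => //; first exact: filter_uniq.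
  by move=> d; rewrite mem_filter; case: (boolP (d \in r0)) => // /hr0 ->.
have eN : iota 0 N = index_iota 0 N by rewrite /index_iota subn0.
rewrite /r0 big_map eN big_mkord.
rewrite [LHS](hN i).1; apply: eq_bigr => j _; by rewrite addrK.
Qed.

Lemma copL_graded : is_graded pr (copL_gmod pr u s).
Proof.
split=> [d|d m x a|x|r c ur hc h d dr] /=.
- by split; [exact: copL_deg0 | move=> x y; exact: copL_degB].
- exact: copL_degM.
- have [N hN] := ccomp_decomp x.
  exists [seq j%:Z + s | j <- iota 0 N], (fun d => ccomp d x); split=> [d|].
    exact: ccomp_deg.
  apply: hN; first by rewrite map_inj_uniq ?iota_uniq // => a b /addIr [].
  by move=> i li; apply/mapP; exists i; rewrite ?mem_iota.
have := congr1 (ccomp d) h; rewrite ccomp_sum (ccomp_id (copL_deg0 d)).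
rewrite (bigD1_seq d) //= (ccomp_id (hc d)) big1 ?addr0 // => d' ne.
exact: ccomp_out (hc d') ne.
Qed.

Lemma copL_projective : projective (copL pr u).
Proof. exact: projective_cop vtxL_idem. Qed.

Lemma copL_fin_gen : fin_gen_in_degree s (copL_gmod pr u s).
Proof.
exists n, (eps (fun i => pr (vtx k (u i)))); split; first exact: copL_deg_eps.
move=> x; exists (cop_coord x); exact: (cop_eps vtxL_idem).
Qed.

End CoproductComponents.

Lemma gdegD (A : gmod L) d (x y : A) : is_graded pr A ->
  gdeg d x -> gdeg d y -> gdeg d (x + y).
Proof.
move=> [h _ _ _] hx hy; have [h0 hB] := h d.
have hN : gdeg d (- y) by rewrite -sub0r; exact: (hB _ _ h0 hy).
by rewrite -[y]opprK; exact: (hB _ _ hx hN).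
Qed.

Lemma gdeg_sum (A : gmod L) d (J : Type) (r : seq J) (P : pred J) (F : J -> A) :
  is_graded pr A -> (forall j, P j -> gdeg d (F j)) -> gdeg d (\sum_(j <- r | P j) F j).
Proof.
move=> hA h; apply: (big_ind (@gdeg _ A d)) => //; last by move=> x y; apply: gdegD.
by have [h0 _ _ _] := hA; case: (h0 d).
Qed.

Lemma gdegM (A : gmod L) d m (x : A) a : is_graded pr A ->
  gdeg d x -> quot_deg pr m a -> gdeg (d + m) (ract x a).
Proof. by move=> [_ h _ _]; exact: h. Qed.

(** The components of [e z] supplied by the generators have degrees at least d. Together with y, of
    degree n < d, they form a vanishing sum in distinct degrees, so each term is 0. *)
Lemma image_low_degree (A A' : gmod L) (e : {linear A -> A'}) d n (y : A') z :
  is_graded pr A' -> degree0 e -> fin_gen_in_degree d A -> (n < d)%R -> gdeg n y ->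
  y = e z -> y = 0.
Proof.
move=> hA' he [m [g [hg hgen]]] lt hy ey; have [a ez] := hgen z.
have [N hN] : exists N : nat, forall i, a i = \sum_(j < N) lcomp j (a i).
  pose N0 i := projT1 (cid (lcomp_decomp (a i))).
  have hN0 i : (a i = \sum_(j < N0 i) lcomp j (a i)) /\
      forall m : nat, (N0 i <= m)%N -> lcomp m (a i) = 0.
    exact: (projT2 (cid (lcomp_decomp (a i)))).
  exists (\max_i N0 i) => i; have [h1 h2] := hN0 i.
  have le : (N0 i <= \max_i N0 i)%N by exact: leq_bigmax.
  rewrite [LHS]h1 (big_ord_widen _ (fun j => lcomp j (a i)) le) big_mkcond.
  by apply: eq_bigr => j _; case: ltnP => // /h2 ->.
pose c (i : int) : A' := if i == n then y else - \sum_l ract (e (g l)) (lcomp (i - d) (a l)).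
pose r := n :: [seq j%:Z + d | j <- iota 0 N].
have ne j : (j%:Z + d == n) = false.
  apply/negbTE/eqP => e1; by move: lt; rewrite -e1 ltz_addl.
have hr : uniq r.
  rewrite /= map_inj_uniq ?iota_uniq ?andbT; last by move=> i j /addIr [].
  by apply/mapP => -[j _ e1]; have := ne j; rewrite e1 eqxx.
have hc i : gdeg i (c i).
  rewrite /c; case: eqP => [-> //|_].
  have [h0 _ _ _] := hA'; rewrite -sub0r; apply: (h0 i).2; first by case: (h0 i).
  apply: gdeg_sum => // l _; rewrite -[i in gdeg i](subrK d) addrC.
  by apply: gdegM => //; [apply: he | exact: quot_deg_lcomp].
have sum0 : \sum_(i <- r) c i = 0.
  rewrite big_cons {1}/c eqxx big_map.
  under eq_bigr => j _ do rewrite /c ne addrK.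
  rewrite sumrN ey ez linear_sum exchange_big /= -sumrB big1 // => l _.
  have -> : iota 0 N = index_iota 0 N by rewrite /index_iota subn0.
  by rewrite linear_ract {1}(hN l) ract_sumr big_mkord subrr.
have [_ _ _ hu] := hA'; have := hu r c hr hc sum0 n (mem_head _ _).
by rewrite /c eqxx.
Qed.

Section HeadIsomorphism.
Variables (n : nat) (u : 'I_n -> Q) (s : int) (A : gmod L) (X : lmodType L^c).
Local Notation B := (copL_gmod pr u s).
Variables (alpha : {linear A -> X}) (beta : {linear B -> X}).
Hypotheses (A_gr : is_graded pr A) (A_proj : projective A) (A_fg : fin_gen_in_degree s A).
Hypothesis alpha_inj : forall a, gdeg s a -> alpha a = 0 -> a = 0.
Hypothesis beta_inj : forall b : B, gdeg s b -> beta b = 0 -> b = 0.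
Local Notation ep := (eps (fun i => pr (vtx k (u i)))).
Hypothesis beta_alpha : forall j, exists a, gdeg s a /\ alpha a = beta (ep j).
Hypothesis alpha_beta : forall a, gdeg s a -> exists b : B, gdeg s b /\ beta b = alpha a.

(* Graded Nakayama: [phi] lifts [beta] through [alpha] and splits by a section
   [psi]; an element of [ker phi] is a sum of multiples of the components in
   degree [s] of [id - psi phi] on the generators, and these vanish because
   [phi] is injective in degree [s]. *)
Lemma head_iso : exists (phi : {linear B -> A}) (psi : {linear A -> B}),
  [/\ forall b, alpha (phi b) = beta b, cancel phi psi, cancel psi phi,
      degree0 phi & degree0 psi].
Proof.
pose a0 j := projT1 (cid (beta_alpha j)).
have a0P j : gdeg s (a0 j) /\ alpha (a0 j) = beta (ep j) by exact: (projT2 (cid (beta_alpha j))).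
pose a j := ract (a0 j) (pr (vtx k (u j))).
have a_deg j : gdeg s (a j).
  by rewrite -[s in gdeg s]addr0; apply: gdegM (quot_deg_vtx _) => //; case: (a0P j).
have a_alpha j : alpha (a j) = beta (ep j).
  rewrite linear_ract (a0P j).2 -linear_ract; congr (beta _).
  exact: (eps_id (vtxL_idem u)).
have [phi phiE] := cop_lift (fun i => pr (vtx k (u i))) a.
have phi_alpha b : alpha (phi b) = beta b.
  rewrite phiE linear_sum [in RHS](cop_eps (vtxL_idem u) b) linear_sum.
  by apply: eq_bigr => j _; rewrite [LHS]linear_ract [RHS]linear_ract a_alpha.
have phi_deg : degree0 (phi : B -> A).
  move=> d b hb; rewrite phiE; apply: gdeg_sum => // j _.
  by rewrite -[d](subrK s) addrC; apply: gdegM => //; exact: hb.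
have phi_surj x : exists b, phi b = x.
  have [m [g [hg hgen]]] := A_fg; have [c ->] := hgen x.
  have hb i : exists b : B, phi b = g i.
    have [b [db eb]] := alpha_beta (hg i); exists b.
    apply/eqP; rewrite -subr_eq0; apply/eqP; apply: alpha_inj.
      have [h0 _ _ _] := A_gr; apply: (h0 s).2 => //; exact: phi_deg.
    by rewrite linearB /= phi_alpha eb subrr.
  exists (\sum_i ract (projT1 (cid (hb i))) (c i)); rewrite linear_sum.
  by apply: eq_bigr => i _; rewrite linear_ract (projT2 (cid (hb i))).
have [psi hpsi] := A_proj (g := phi) idfun phi_surj.
have psiK : cancel psi phi by [].
have comp (b : B) d0 (y : A) : gdeg d0 y -> phi b = y -> forall d, d != d0 -> phi (ccomp s d b) = 0.
  move=> hy eb d ne; have [N hN] := ccomp_decomp s b.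
  pose r := undup (d :: d0 :: [seq j%:Z + s | j <- iota 0 N]).
  have er : b = \sum_(i <- r) ccomp s i b.
    apply: hN; first exact: undup_uniq.
    move=> i li; rewrite mem_undup !inE; apply/orP; right; apply/orP; right.
    by apply/mapP; exists i; rewrite ?mem_iota.
  pose c i : A := phi (ccomp s i b) - (if i == d0 then y else 0).
  have hc i : gdeg i (c i).
    have [h0 _ _ _] := A_gr; apply: (h0 i).2; first by apply: phi_deg; exact: ccomp_deg.
    by case: eqP => [->|_] //; case: (h0 i).
  have sum0 : \sum_(i <- r) c i = 0.
    have d0r : d0 \in r by rewrite mem_undup !inE eqxx orbT.
    rewrite sumrB -linear_sum -er eb (bigD1_seq d0) ?undup_uniq //= eqxx.
    by rewrite big1 ?addr0 ?subrr // => i /negPf ->.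
  have [_ _ _ hu] := A_gr.
  have dr : d \in r by rewrite mem_undup inE eqxx.
  by have := hu r c (undup_uniq _) hc sum0 d dr; rewrite /c (negPf ne) subr0.
have comp0 (b : B) d : phi b = 0 -> phi (ccomp s d b) = 0.
  (* Zero is homogeneous of every degree; d + 1 is taken only because it differs from d. *)
  move=> eb; have hz : gdeg (d + 1) (0 : A) by case: A_gr => h0 _ _ _; case: (h0 (d + 1)).
  apply: (comp b _ 0 hz eb); apply/eqP => e1.
  have := addrI d; move: e1; rewrite -{1}[d]addr0 => /addrI /esym /eqP.
  by [].
have bot (b : B) : phi b = 0 -> ccomp s s b = 0.
  move=> eb; apply: beta_inj; first exact: ccomp_deg.
  by rewrite -phi_alpha comp0 // linear0.
pose theta (b : B) : B := b - psi (phi b).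
have theta_ker b : phi (theta b) = 0 by rewrite /theta linearB /= psiK subrr.
have theta_lin (c : 'I_n -> L) :
    theta (\sum_j ract (ep j) (c j)) = \sum_j ract (theta (ep j)) (c j).
  rewrite /theta 2!linear_sum -sumrB; apply: eq_bigr => j _.
  by rewrite 2!linear_ract ractDl ractN.
(* Here [theta b] is [b], and the coordinates of [b] have degree d - s. In degree d only the
   degree-s components of the [theta] of the generators contribute, and these are 0 by [bot]. *)
have hom0 d (b : B) : gdeg d b -> phi b = 0 -> b = 0.
  move=> hb eb.
  have E : b = \sum_j ract (theta (ep j)) (cop_coord b j).
    rewrite -theta_lin -(cop_eps (vtxL_idem u) b).
    by rewrite /theta eb linear0 subr0.
  rewrite -(ccomp_id hb) E ccomp_sum big1 // => j _.
  by rewrite (ccompM _ _ _ (hb j)) opprB addrCA subrr addr0 bot // ract0r.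
have phi_inj b : phi b = 0 -> b = 0.
  move=> eb; have [N hN] := ccomp_decomp s b.
  rewrite (hN [seq j%:Z + s | j <- iota 0 N]).
  - by rewrite big1 // => d _; apply: (hom0 d); [exact: ccomp_deg | exact: comp0].
  - by rewrite map_inj_uniq ?iota_uniq // => i j /addIr [].
  - by move=> i li; apply/mapP; exists i; rewrite ?mem_iota.
have phiK : cancel phi psi.
  move=> b; apply/eqP; rewrite -subr_eq0; apply/eqP; apply: phi_inj.
  by rewrite linearB /= psiK subrr.
exists phi, psi; split=> // d x hx /=.
have ecomp : ccomp s d (psi x) = psi x.
  have [N hN] := ccomp_decomp s (psi x).
  pose r := undup (d :: [seq j%:Z + s | j <- iota 0 N]).
  rewrite [RHS](hN r).
  - rewrite (bigD1_seq d) ?undup_uniq ?mem_undup ?mem_head //= big1 ?addr0 // => d' ne.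
    by apply: phi_inj; apply: (comp (psi x) d x hx (psiK x)).
  - exact: undup_uniq.
  - move=> i li; rewrite mem_undup inE; apply/orP; right.
    by apply/mapP; exists i; rewrite ?mem_iota.
by rewrite -ecomp; exact: ccomp_deg.
Qed.

End HeadIsomorphism.

End GradedQuotient.

(** * Independent families over the field *)

Section FreeFamilies.
Variables (k : fieldType) (W : lmodType k).

Definition free_family n (f : 'I_n -> W) : Prop :=
  forall c : 'I_n -> k, \sum_i c i *: f i = 0 -> forall i, c i = 0.

(** The two matrices of coefficients satisfy A B = 1 because f is independent, and the rank of A is
    at most n. *)
Lemma free_family_leq m n (f : 'I_m -> W) (g : 'I_n -> W) : free_family f ->
  (forall i, exists c : 'I_n -> k, f i = \sum_j c j *: g j) ->
  (forall j, exists c : 'I_m -> k, g j = \sum_i c i *: f i) -> (m <= n)%N.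
Proof.
move=> ff hf hg.
pose A := \matrix_(i, j) projT1 (cid (hf i)) j.
pose B := \matrix_(j, i) projT1 (cid (hg j)) i.
have eA i : f i = \sum_j A i j *: g j.
  rewrite {1}(projT2 (cid (hf i))); apply: eq_bigr => j _; by rewrite mxE.
have eB j : g j = \sum_i B j i *: f i.
  rewrite {1}(projT2 (cid (hg j))); apply: eq_bigr => i _; by rewrite mxE.
have AB : A *m B = 1%:M.
  apply/matrixP => i i'; apply/eqP; rewrite -subr_eq0; apply/eqP.
  apply: (ff (fun i' => (A *m B) i i' - (1%:M : 'M_m) i i')).
  under eq_bigr => l _ do rewrite scalerBl.
  rewrite sumrB; apply/eqP; rewrite subr_eq0; apply/eqP.
  have -> : \sum_l (1%:M : 'M_m) i l *: f l = f i.
    rewrite (bigD1 i) //= mxE eqxx scale1r big1 ?addr0 // => l ne.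
    by rewrite mxE eq_sym (negPf ne) scale0r.
  under eq_bigr => l _ do rewrite mxE scaler_suml.
  rewrite exchange_big /= [RHS](eA i); apply: eq_bigr => j _.
  by rewrite (eB j) scaler_sumr; apply: eq_bigr => l _; rewrite scalerA.
have := mxrankM_maxl A B; rewrite AB mxrank1 => h; exact: leq_trans h (rank_leq_col A).
Qed.

Lemma inspan_comb (s : seq W) y : inspan s y ->
  exists c : nat -> k, y = \sum_(i < size s) c i *: nth 0 s i.
Proof.
move=> h; apply: (h (fun y => exists c : nat -> k, y = \sum_(i < size s) c i *: nth 0 s i)).
  split; first by exists (fun=> 0); rewrite big1 // => i _; rewrite scale0r.
  move=> a x z [c ->] [c' ->]; exists (fun i => a * c i + c' i).
  rewrite scaler_sumr -big_split; apply: eq_bigr => i _.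
  by rewrite scalerDl scalerA.
move=> x xs; have ix : (index x s < size s)%N by rewrite index_mem.
exists (fun i => if i == index x s then 1 else 0).
rewrite (bigD1 (Ordinal ix)) //= eqxx scale1r nth_index // big1 ?addr0 // => i.
by rewrite -val_eqE /= => /negPf ->; rewrite scale0r.
Qed.

End FreeFamilies.

(** * The degree-2 part of the ideal *)

Section DegreeZeroTwo.
Variables (k : fieldType) (Q : quiver).
Local Notation PA := (pathalg k Q).
Local Notation pot := (@pa_of_terms k Q).

Lemma deg0_decomp (x : PA) : pa_deg 0 x -> x = \sum_u x@_(vertex_path u) *: vtx k u.
Proof.
move=> /pa_degP hx; apply: pa_eqP => p; rewrite coef_sum.
under eq_bigr => u _ do rewrite coefZ vtxE coef_mono.
case: (eqVneq (x@_p) 0) => [e|np].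
  rewrite e big1 // => u _; case: eqP => [eu|_]; last by rewrite mulr0.
  by rewrite eu e mul0r.
have ep : p = vertex_path (orig p) by have [] := hx _ np => /plen0.
rewrite (bigD1 (orig p)) //= -ep eqxx mulr1 big1 ?addr0 // => u ne.
case: eqP => [eu|_]; last by rewrite mulr0.
by move: ne; rewrite -eu /= /orig /= eqxx.
Qed.

Variables (gens : seq (terms k Q)).
Hypothesis gens_deg : forall g, g \in gens -> pa_deg 2 (pot g).
Local Notation V := [seq vertex_path u | u <- enum Q].

Lemma mem_vertex_paths p : (p \in V) = (plen p == 0%N).
Proof.
apply/mapP/eqP => [[u _ ->] //|/plen0 e].
by exists (orig p); rewrite ?mem_enum.
Qed.

Lemma rel2_vtx g u u' : g \in gens -> rel2 V gens (vtx k u * pot g * vtx k u').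
Proof.
move=> hg; apply: inspan_mem; apply/mapP.
exists (mulr_terms (mull_terms (vertex_path u) g) (vertex_path u')); last first.
  by rewrite pot_mulr pot_mull.
apply/flatten_mapP; exists g => //; apply/flatten_mapP; exists (vertex_path u).
  by rewrite mem_vertex_paths.
by apply/mapP; exists (vertex_path u') => //; rewrite mem_vertex_paths.
Qed.

(** A generator g already has degree 2, so only the degree-0 components of a and b contribute to a g
    b in degree 2, and these are combinations of vertices. *)
Lemma ideal_rel2 x :
  ideal_gen (fun y => exists2 g, g \in gens & y = pot g) x -> pa_deg 2 x -> rel2 V gens x.
Proof.
move=> [n [a [h [b [hh ex]]]]] dx; rewrite -(hcomp_id dx) ex hcomp_sumE.
apply: inspan_sum => i _; have [g hg ->] := hh i.
have [N1 /(_ N1 (leqnn N1)) e1] := hcomp_sum (a i).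
have [N2 /(_ N2 (leqnn N2)) e2] := hcomp_sum (b i).
have -> : a i * pot g * b i =
    \sum_(j1 < N1) \sum_(j2 < N2) hcomp j1 (a i) * pot g * hcomp j2 (b i).
  rewrite {1}e1 {1}e2 [X in X * _ = _]mulr_suml [LHS]mulr_suml; apply: eq_bigr => j1 _.
  exact: mulr_sumr.
rewrite hcomp_sumE; apply: inspan_sum => j1 _; rewrite hcomp_sumE; apply: inspan_sum => j2 _.
have hd := pa_degM (pa_degM (pa_deg_hcomp j1 (a i)) (gens_deg hg)) (pa_deg_hcomp j2 (b i)).
case: (eqVneq (j1%:Z + 2 + j2%:Z) 2) => e; last first.
  by rewrite (hcomp_out hd e); exact: inspan0.
rewrite hcomp_id; last by rewrite -[X in pa_deg X _]e.
have [z1 z2] : (j1 : nat) = 0%N /\ (j2 : nat) = 0%N.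
  by move: e; rewrite -[2]/(2%N%:Z) -!PoszD => -[]; case: (nat_of_ord j1) (nat_of_ord j2)
    => [|m1] [|m2] //; rewrite ?addn2 ?addSn ?addn0 ?addnS.
rewrite z1 z2 (deg0_decomp (pa_deg_hcomp 0 (a i))) (deg0_decomp (pa_deg_hcomp 0 (b i))).
set A := fun u => (hcomp 0 (a i))@_(vertex_path u); set C := fun u => (hcomp 0 (b i))@_(vertex_path u).
have -> : (\sum_u A u *: vtx k u) * pot g * (\sum_u C u *: vtx k u) =
   \sum_u \sum_u' (A u * C u') *: (vtx k u * pot g * vtx k u').
  rewrite [X in X * _ = _]mulr_suml [LHS]mulr_suml; apply: eq_bigr => u _.
  rewrite [LHS]mulr_sumr; apply: eq_bigr => u' _.
  rewrite -[X in X * _ = _]scale_pathalgAl -[LHS]scale_pathalgAl -[X in _ *: X = _]scale_pathalgAr.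
  by rewrite scalerA.
by apply: inspan_sum => u _; apply: inspan_sum => u' _; apply: inspanZ; exact: rel2_vtx.
Qed.

Lemma rel2_ideal x : rel2 V gens x ->
  ideal_gen (fun y => exists2 g, g \in gens & y = pot g) x.
Proof.
move=> h; apply: (h (ideal_gen (fun y => exists2 g, g \in gens & y = pot g))).
  split; first exact: ideal_gen0.
  move=> a y z hy hz; apply: ideal_genD => //.
  have -> : a *: y = ((a *: (1 : PA)) * (y : PA) * 1 : PA).
    by rewrite mulr1 -scale_pathalgAl mul1r.
  exact: ideal_genM.
move=> _ /mapP[t /flatten_mapP[g hg /flatten_mapP[y _ /mapP[z _ ->]]] ->].
rewrite pot_mulr pot_mull; apply: ideal_genM; apply: ideal_gen_mem.
by exists g.
Qed.

End DegreeZeroTwo.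

(** [syzygiesP] with the sizes of the lists replaced by given numbers, so that families indexed by
    ['I_t0] and ['I_t1] fit without transport. *)
Lemma syzygiesP_cast (k : fieldType) (Q : quiver) (lt : rel (qpath Q)) (ars V : seq (qpath Q))
    (gens : seq (terms k Q)) (X : Type) (vs : seq X) (F : seq (seq (terms k Q))) (n m : nat)
    (u : 'I_m -> Q) (famv : 'I_m -> {ffun 'I_n -> pathalg k Q}) :
  strict_well_order lt -> uniq ars -> (forall p, (p \in ars) = (plen p == 1%N)) ->
  (forall p, (p \in V) = (plen p == 0%N)) ->
  (forall g, g \in gens -> pa_deg 2 (pa_of_terms g)) -> size vs = n -> size F = m ->
  (forall l : 'I_m, fv n (nth [::] F l) = famv l) ->
  (forall x, x \in F -> size x = n) -> (forall l, fam_deg 1 (famv l)) ->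
  (forall l i, famv l i * vtx k (u l) = famv l i) -> (forall l, famv l <> 0) ->
  let C := syzygies lt V ars gens vs F in
  [/\ forall x, x \in C -> [/\ size x = m, fam_deg 1 (fv m x) & fam_unif (fv m x)],
      exists b : seq ('I_m * qpath Q), [/\ size b = size C, uniq b &
        Forall2 (fun x c => fam_tip lt (fv m x) c) C b] &
      forall z, inspan (map (fv m) C) z <->
        [/\ fam_deg 1 z, forall l, vtx k (u l) * z l = z l &
            forall i, rel2 V gens (\sum_l famv l i * z l)]].
Proof.
move=> h1 h2 h3 h4 h5 en em; subst n m => h6 h7 h8 h9 h10 C.
have [c1 c2 c3] := syzygiesP h1 h2 h3 h4 h5 h6 h7 h8 h9 h10.
split=> // z; rewrite c3; split=> -[z1 z2 z3]; split=> // i; have := z3 i;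
  by rewrite prodfE.
Qed.

Lemma coord_sum_eps (R : pzRingType) n (e : 'I_n -> R) (ee : forall i, e i * e i = e i)
    (c : 'I_n -> R) j :
  cop_coord (\sum_(i <- index_enum 'I_n) ract (eps e i) (c i)) j = e j * c j.
Proof.
rewrite coord_sum (bigD1 j) //= coordM (coord_eps ee) eqxx big1 ?addr0 // => i ne.
by rewrite coordM (coord_eps ee) eq_sym (negPf ne) mul0r.
Qed.

(** * Homogeneous preimages and quotients of coproducts *)

Section GradedTools.
Variables (k : fieldType) (Q : quiver) (I : pathalg k Q -> Prop) (L : pzRingType).
Variable pr : {rmorphism pathalg k Q -> L}.
Local Notation PA := (pathalg k Q).
Hypothesis I_homog : exists S : PA -> Prop,
  (forall g, S g -> exists n : nat, pa_deg n%:Z g) /\ forall x, I x <-> ideal_gen S x.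
Hypothesis I_quot : is_quotient_ring I pr.

(** The decomposition in [is_graded] may repeat a degree, whereas its uniqueness clause needs
    distinct degrees; repetitions are therefore collected with multiplicity. *)
Lemma graded_decomp (A : gmod L) (z : A) : is_graded pr A ->
  exists (s : seq int) (c : int -> A), [/\ uniq s, forall n, gdeg n (c n),
    forall n, n \notin s -> c n = 0 & z = \sum_(n <- s) c n].
Proof.
move=> hA; have [h0 _ dec _] := hA; have [s [c [hc ez]]] := dec z.
pose c' n := (if n \in s then c n *+ count_mem n s else 0 : A).
exists (undup s), c'; split; first exact: undup_uniq.
- move=> n; rewrite /c'; case: ifP => _; last by case: (h0 n).
  elim: (count_mem n s) => [|m IH]; first by rewrite mulr0n; case: (h0 n).
  by rewrite mulrS; exact: (gdegD hA (hc n) IH).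
- by move=> n; rewrite mem_undup /c' => /negPf ->.
rewrite ez -big_undup_iterop_count /=.
by apply: eq_big_seq => n; rewrite mem_undup /c' => ->.
Qed.

(** The degree-d component of z works: by uniqueness of decompositions in A', its image is the
    component y of [e z]. *)
Lemma graded_preimage (A A' : gmod L) (e : {linear A -> A'}) d (y : A') z :
  is_graded pr A -> is_graded pr A' -> degree0 e -> gdeg d y -> y = e z ->
  exists z', gdeg d z' /\ y = e z'.
Proof.
move=> hA hA' he hy ey; have [s [c' [us hc' c0 ez]]] := graded_decomp z hA.
have [h0' _ _ uni] := hA'.
pose r := undup (d :: s); have ur : uniq r by exact: undup_uniq.
have ez' : z = \sum_(n <- r) c' n.
  rewrite ez /r /=; case: (boolP (d \in s)) => ds; rewrite undup_id //.
  by rewrite big_cons c0 // add0r.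
have dr : d \in r by rewrite mem_undup inE eqxx.
exists (c' d); split=> //.
pose c'' n : A' := e (c' n) - (if n == d then y else 0).
have hc'' n : gdeg n (c'' n).
  apply: (h0' n).2; first exact: he.
  by case: eqP => [->|_] //; case: (h0' n).
have sum0 : \sum_(n <- r) c'' n = 0.
  rewrite sumrB -linear_sum -ez' -ey (bigD1_seq d) //= eqxx.
  by rewrite big1 ?addr0 ?subrr // => n /negPf ->.
have := uni r c'' ur hc'' sum0 d dr; rewrite /c'' eqxx => /eqP.
by rewrite subr_eq0 => /eqP.
Qed.

Lemma mul_rad_img (M M' : lmodType L^c) (h : {linear M -> M'}) x :
  mul_rad pr x -> mul_rad pr (h x).
Proof.
move=> [n [y [a [ha ->]]]]; exists n, (fun i => h (y i)), a; split=> //.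
by rewrite linear_sum; apply: eq_bigr => i _; rewrite linear_ract.
Qed.

Section CoproductQuotient.
Variables (V : lmodType PA^c) (n : nat) (f : 'I_n -> V) (u : 'I_n -> Q).
Hypothesis f_unif : forall j, ract (f j) (vtx k (u j)) = f j.
Hypothesis f_direct : direct_family f.
Hypothesis f_cancel : forall j r, ract (f j) r = 0 -> vtx k (u j) * r = 0.
Local Notation ep := (eps (fun i => pr (vtx k (u i)))).

(** Since f_j R is isomorphic to u_j R, sending f_j to the j-th basis element identifies the
    quotient with the coproduct of the u_j Lambda. The gradings are given as equal functions, so
    that one graded module can be rewritten into the other. *)
Lemma coprod_quotient : exists q : {linear rspan f -> restr pr (copL pr u)},
  [/\ is_coprod_quotient I q,
      forall x (r : 'I_n -> PA) j, val x = \sum_j ract (f j) (r j) ->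
        cop_coord (q x : copL pr u) j = pr (vtx k (u j) * r j) &
      forall s, @gdeg L (coprod_quotient_gmod q s) = @copL_deg _ _ _ pr _ u s].
Proof.
have ann j (r : PA) : ract (f j) r = 0 -> ract (ep j : restr pr (copL pr u)) r = 0.
  move=> /f_cancel h; rewrite -[LHS]/(ract (ep j : copL pr u) (pr r)).
  rewrite -(eps_id (vtxL_idem pr u) j) ractA -rmorphM h rmorph0 ractr0.
  by [].
have [q hq] := rspan_lift f_direct ann; exists q.
have qE x (r : 'I_n -> PA) j : val x = \sum_j ract (f j) (r j) ->
    cop_coord (q x : copL pr u) j = pr (vtx k (u j) * r j).
  move=> ex; have eY : (q x : copL pr u) =
      \sum_(i <- index_enum 'I_n) ract (ep i : copL pr u) (pr (r i)).
    exact: (hq x (index_enum 'I_n) r (index_enum_uniq _) ex).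
  rewrite rmorphM -(coord_sum_eps (vtxL_idem pr u) (fun i => pr (r i))).
  exact: (congr1 (fun y : copL pr u => cop_coord y j) eY).
have span (x : rspan f) : exists r : 'I_n -> PA, val x = \sum_j ract (f j) (r j).
  by apply/rspan_fin; apply/mem_rspan; exact: (valP x).
have inspan (r : 'I_n -> PA) : \sum_j ract (f j) (r j) \in rspan_pred f.
  by apply/mem_rspan; apply/rspan_fin; exists r.
have surj (y : copL pr u) (r : 'I_n -> PA) : (forall j, pr (r j) = cop_coord y j) ->
    y = q (Submod (inspan r)).
  move=> er; apply: cop_eqP => j; rewrite (qE _ r) // rmorphM er.
  by rewrite (coord_id y).
split=> //.
- split=> [y|x].
    exists (Submod (inspan (fun j => lift I_quot (cop_coord (y : copL pr u) j)))).
    by apply/esym/surj => j; rewrite liftK.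
  split=> [qx|[s [r [hr ex]]]].
    have [r er] := span x; exists (index_enum 'I_n), (fun j => vtx k (u j) * r j).
    split=> [j|]; last by rewrite er; apply: eq_bigr => j _; rewrite -ractA f_unif.
    apply/(pr_eq0 I_quot); rewrite -(qE x r j er) qx.
    exact: (coord0 (fun i => pr (vtx k (u i)))).
  (* A combination with coefficients in I may repeat an index; its coefficients are first collected,
     which keeps them in I. *)
  have [r' hr' er'] : exists2 r' : 'I_n -> PA, (forall j, I (r' j)) &
      val x = \sum_j ract (f j) (r' j).
    rewrite ex; elim: s {ex} => [|j s [r' hr' IH]].
      exists (fun=> 0); first by move=> j; exact: ideal0.
      by rewrite big_nil big1 // => j _; rewrite ractr0.
    exists (fun i => (if i == j then r j else 0) + r' i).
      by move=> i; apply: idealD => //; case: eqP => // _; exact: ideal0.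
    rewrite big_cons IH; under [RHS]eq_bigr => i _ do rewrite ractDr.
    rewrite big_split /=; congr (_ + _); rewrite (bigD1 j) //= eqxx big1 ?addr0 //.
    by move=> i /negPf ->; rewrite ractr0.
  apply: (cop_eqP (e := fun i => pr (vtx k (u i)))) => j.
  rewrite (qE x r' j er') [RHS]coord0; apply/(pr_eq0 I_quot).
  by apply: idealMl.
move=> s; apply/funext => d; apply/funext => y; apply/propext; split.
  move=> [x [r [dr ex ->]]] j; rewrite (qE x r j ex).
  exists (vtx k (u j) * r j) => //.
  by have := pa_degM (@pa_deg_vtx k Q (u j)) (dr j); rewrite add0r.
move=> hy; pose r j := projT1 (cid2 (hy j)).
have rP j : pa_deg (d - s) (r j) /\ pr (r j) = cop_coord y j.
  by rewrite /r; case: (cid2 (hy j)).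
exists (Submod (inspan r)), r; split=> //; first by move=> j; case: (rP j).
by apply: surj => j; case: (rP j).
Qed.

End CoproductQuotient.

Lemma matrix_lift n (u : 'I_n -> Q) m (v : 'I_m -> Q) (E : 'I_n -> 'I_m -> PA) :
  (forall j i, vtx k (v i) * E j i = E j i) ->
  exists h : {linear copL pr u -> copL pr v}, forall x i,
    cop_coord (h x) i = \sum_j pr (E j i) * cop_coord x j.
Proof.
move=> hE; pose a j : copL pr v := mkcop _ (fun i => pr (E j i)).
have aE j i : cop_coord (a j) i = pr (E j i).
  by rewrite /a (mkcopE (F := fun i => pr (E j i))) // => i'; rewrite -rmorphM hE.
have [h hh] := cop_lift (fun i => pr (vtx k (u i))) a; exists h => x i.
by rewrite hh coord_sum; apply: eq_bigr => j _; rewrite coordM aE.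
Qed.

End GradedTools.

Lemma inspan_comb_ord (k : fieldType) (W : lmodType k) n (s : seq W) y : size s = n ->
  inspan s y -> exists c : 'I_n -> k, y = \sum_i c i *: nth 0 s i.
Proof. by move=> <- /inspan_comb[c ->]; exists c. Qed.

Section ArrowPaths.
Variable Q : quiver.

Lemma arrow_paths_uniq : uniq [seq arrow_path a | a <- enum (arrow Q)].
Proof.
rewrite map_inj_uniq ?enum_uniq // => a b /(congr1 (@arrows Q)).
by rewrite /arrows /= => -[].
Qed.

Lemma mem_arrow_paths (p : qpath Q) :
  (p \in [seq arrow_path a | a <- enum (arrow Q)]) = (plen p == 1%N).
Proof.
apply/mapP/eqP => [[a _ ->] //|/plen1[a ->]].
by exists a; rewrite ?mem_enum.
Qed.

End ArrowPaths.

Lemma is_tip_reduced (k : fieldType) (Q : quiver) (lt : rel (qpath Q)) (t : nat)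
    (v : 'I_t -> Q) (J : Type) (f : J -> copR k v) (u : J -> Q) (b : J -> 'I_t * qpath Q) :
  admissible lt -> (forall j, ract (f j) (vtx k (u j)) = f j) ->
  (forall j, is_tip lt (f j) (b j)) ->
  (forall j j', j <> j' -> ~ left_divides (b j) (b j')) -> right_tip_reduced lt f.
Proof.
move=> adm hu ht hd; split=> [j|j j' c c' ne tc tc'].
  split; last by exists (u j).
  by move=> e; have [] := ht j; rewrite e => /not_occurs0.
rewrite -(tip_unique adm (ht j) tc) -(tip_unique adm (ht j') tc').
by apply: hd => e; apply: ne; rewrite e.
Qed.

(** The passage from lists of terms to elements of a coproduct, shared by f^1 and by the coefficient
    vectors of f^2. *)
Lemma row_family (k : fieldType) (Q : quiver) (lt : rel (qpath Q)) (C : seq (seq (terms k Q)))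
    (m n : nat) (v : 'I_n -> Q) (bs : seq ('I_n * qpath Q)) : size C = m ->
  (forall x, x \in C -> [/\ size x = n, fam_deg 1 (fv n x) & fam_unif (fv n x)]) ->
  (forall x, x \in C -> forall i, vtx k (v i) * fv n x i = fv n x i) ->
  size bs = size C -> uniq bs -> Forall2 (fun x c => fam_tip lt (fv n x) c) C bs ->
  exists (f : 'I_m -> copR k v) (u : 'I_m -> Q) (b : 'I_m -> 'I_n * qpath Q),
  [/\ forall (l : 'I_m) i, cop_coord (f l) i = fv n (nth [::] C l) i,
      forall l i, pa_deg 1 (cop_coord (f l) i),
      forall l, ract (f l) (vtx k (u l)) = f l,
      forall l, is_tip lt (f l) (b l) & injective b].
Proof.
move=> em c1 vC sb ub tb.
have memC (l : 'I_m) : nth [::] C l \in C by rewrite mem_nth ?em.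
pose f (l : 'I_m) : copR k v := mkcop _ (fv n (nth [::] C l)).
have fE (l : 'I_m) i : cop_coord (f l) i = fv n (nth [::] C l) i.
  by apply: mkcopE => j; exact: (vC _ (memC l)).
have hu0 l : exists u, ract (f l) (vtx k u) = f l.
  have [_ _ [u hu]] := c1 _ (memC l); exists u; apply: cop_eqP => i.
  by rewrite coordM fE hu.
have [u hu] := choice hu0.
have sb' : size bs = m by rewrite sb em.
pose b (l : 'I_m) := tnth (in_tuple bs) (cast_ord (esym sb') l).
exists f, u, b; split=> // [l i|l|l l' /= e].
- by rewrite fE; have [_ d _] := c1 _ (memC l); exact: d.
- have lC : (l < size C)%N by rewrite em.
  have [h1 h2] := Forall2_nth [::] (b l) tb lC.
  have eb : nth (b l) bs l = b l by rewrite {2}/b (tnth_nth (b l)).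
  rewrite eb in h1 h2; split; first by rewrite /occurs fE.
  by move=> c; rewrite /occurs fE; exact: h2.
have /tuple_uniqP inj : uniq (in_tuple bs) by [].
by have /cast_ord_inj := inj _ _ e.
Qed.

(** * First syzygies and the presentation over the path algebra *)

Section Presentation.
Variables (k : fieldType) (Q : quiver) (I : pathalg k Q -> Prop)
  (L : pzRingType) (pr : {rmorphism pathalg k Q -> L}) (M : gmod L)
  (t0 t1 : nat) (v : 'I_t0 -> Q) (w : 'I_t1 -> Q)
  (d0 : {linear copL pr v -> M}) (d1 : {linear copL pr w -> copL pr v})
  (mx : 'I_t1 -> 'I_t0 -> terms k Q) (lt : rel (qpath Q)).
Local Notation PA := (pathalg k Q).
Local Notation pot := (@pa_of_terms k Q).
Local Notation fam := (seq (terms k Q)).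
Hypothesis I_sub : forall x, I x -> ideal_prod (@arrow_ideal k Q) (@arrow_ideal k Q) x.
Hypothesis I_homog : exists S : PA -> Prop,
  (forall g, S g -> exists n : nat, pa_deg n%:Z g) /\ forall x, I x <-> ideal_gen S x.
Hypothesis I_quot : is_quotient_ring I pr.
Hypothesis d0_surj : forall y, exists x, d0 x = y.
Hypothesis d0_ker : forall x, d0 x = 0 <-> exists y, d1 y = x.
Hypothesis d1_inj : forall y, copL_deg (pr := pr) 1 1 y -> d1 y = 0 -> y = 0.
Hypothesis mat : is_matrix d1 mx.
Hypothesis adm : admissible lt.

Let lt_order : strict_well_order lt. Proof. by case: adm. Qed.
Local Notation ars := [seq arrow_path a | a <- enum (arrow Q)].
Local Notation mxs := [seq [seq mx l i | i <- enum 'I_t0] | l <- enum 'I_t1].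
Local Notation F := (echelon lt (sort_paths lt ars) mxs).

Definition entry l i : PA := pot (mx l i).
Definition colv (l : 'I_t1) : {ffun 'I_t0 -> PA} := [ffun i => entry l i].

Lemma entry_deg l i : pa_deg 1 (entry l i).
Proof. by have [h _] := mat; have [] := h l i. Qed.
Lemma entry_vw l i : vtx k (v i) * entry l i * vtx k (w l) = entry l i.
Proof. by have [h _] := mat; have [] := h l i. Qed.
Lemma entry_v l i : vtx k (v i) * entry l i = entry l i.
Proof. by rewrite -{1}(entry_vw l i) 2!mulrA vtxMM entry_vw. Qed.
Lemma entry_w l i : entry l i * vtx k (w l) = entry l i.
Proof. by rewrite -{1}(entry_vw l i) -[LHS]mulrA vtxMM entry_vw. Qed.
Lemma d1_coord x i : cop_coord (d1 x) i = \sum_l pr (entry l i) * cop_coord x l.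
Proof. by have [_ h] := mat; exact: h. Qed.

Lemma map_mxs_fv : map (fv t0) mxs = map colv (enum 'I_t1).
Proof.
rewrite -map_comp; apply: eq_map => l /=; apply/ffunP => i; rewrite !ffunE.
by rewrite (nth_map i) ?size_enum_ord // nth_ord_enum.
Qed.

(** A dependency with coefficients c_l gives the element (c_l w_l) of degree 1 in the kernel of
    [d1]. It is 0 by injectivity there, so c_l w_l lies in I, which has nothing in degree 0. *)
Lemma colv_free : free_family colv.
Proof.
move=> c h l; pose y : copL pr w := mkcop _ (fun l => pr (c l *: vtx k (w l))).
have yE j : cop_coord y j = pr (c j *: vtx k (w j)).
  rewrite /y (mkcopE (F := fun l => pr (c l *: vtx k (w l)))) // => i.
  by rewrite -rmorphM -[X in pr X = _]scale_pathalgAr vtxMM.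
have y0 : y = 0.
  apply: d1_inj.
    move=> j; rewrite subrr yE; exists (c j *: vtx k (w j)) => //.
    by apply: pa_degZ; exact: pa_deg_vtx.
  apply: cop_eqP => i; rewrite d1_coord coord0.
  have e : \sum_j c j *: entry j i = 0.
    have := congr1 (fun f : {ffun 'I_t0 -> PA} => f i) h; rewrite sum_ffunE ffunE => e.
    by rewrite -[RHS]e; apply: eq_bigr => j _; rewrite !ffunE.
  transitivity (pr (\sum_j c j *: entry j i)); last by rewrite e rmorph0.
  rewrite rmorph_sum; apply: eq_bigr => j _.
  rewrite yE -rmorphM; congr (pr _).
  by rewrite -[LHS]scale_pathalgAr entry_w.
have : I (c l *: vtx k (w l)).
  by apply/(pr_eq0 I_quot); rewrite -yE y0 coord0.
move=> /(ideal_low_eq0 I_sub) h0.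
have := h0 0%N (pa_degZ (c l) (@pa_deg_vtx k Q (w l))) isT.
move=> /(congr1 (mcoeff (vertex_path (w l)))).
by rewrite coefZ vtxE coef_mono eqxx mulr1 coef0.
Qed.

Lemma mxs_rows x : x \in mxs -> [/\ size x = t0, fam_deg 1 (fv t0 x) & fam_unif (fv t0 x)].
Proof.
move=> /mapP[l _ ex]; have ef : fv t0 x = colv l.
  rewrite ex; apply/ffunP => i; rewrite !ffunE.
  by rewrite (nth_map i) ?size_enum_ord // nth_ord_enum.
rewrite ef ex size_map size_enum_ord; split=> //.
  by move=> i; rewrite ffunE; exact: entry_deg.
by exists (w l) => i; rewrite ffunE entry_w.
Qed.

Lemma F_rows x : x \in F -> size x = t0.
Proof.
have [c1 _ _] := echelonP lt_order (@arrow_paths_uniq Q) (@mem_arrow_paths Q) mxs_rows.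
by move=> /c1[].
Qed.

(** The number of reduced rows is left open here, because [F_size] computes it from this very
    statement. *)
Lemma first_syzygies_aux m : size F = m ->
  exists (f1 : 'I_m -> copR k v) (u : 'I_m -> Q) (b : 'I_m -> 'I_t0 * qpath Q),
  [/\ forall (l : 'I_m) i, cop_coord (f1 l) i = pot (nth [::] (nth [::] F l) i),
      (forall l i, pa_deg 1 (cop_coord (f1 l) i)) /\
        (forall l, ract (f1 l) (vtx k (u l)) = f1 l),
      (forall l, is_tip lt (f1 l) (b l)) /\ injective b,
      (forall l, exists c : 'I_m -> k, forall i,
         entry l i = \sum_j c j *: cop_coord (f1 j) i) &
      forall j, exists c : 'I_t1 -> k, forall i,
         cop_coord (f1 j) i = \sum_l c l *: entry l i].
Proof.
move=> em.
have [c1 c2 [bs [sb ub tb]]] :=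
  echelonP lt_order (@arrow_paths_uniq Q) (@mem_arrow_paths Q) mxs_rows.
have spanF x : x \in F -> inspan (map (fv t0) mxs) (fv t0 x).
  by move=> xF; apply/c2; apply: inspan_mem; apply: map_f.
have vF x : x \in F -> forall i, vtx k (v i) * fv t0 x i = fv t0 x i.
  move=> /spanF h.
  apply: (h (fun z : {ffun 'I_t0 -> PA} => forall i, vtx k (v i) * z i = z i)).
    split=> [i|a y z hy hz i]; first by rewrite ffunE mulr0.
    by rewrite ffun_lin pa_mulrP hy hz.
  rewrite map_mxs_fv => _ /mapP[l _ ->] i; rewrite ffunE; exact: entry_v.
have [f1 [u [b [fE fd fu ft bi]]]] := row_family em c1 vF sb ub tb.
exists f1, u, b; split.
- by move=> l i; rewrite fE ffunE.
- by split.
- by split.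
- move=> l; have : inspan (map (fv t0) F) (colv l).
    by apply/c2; apply: inspan_mem; rewrite map_mxs_fv map_f ?mem_enum.
  have sF : size (map (fv t0) F) = m by rewrite size_map em.
  move=> /(inspan_comb_ord sF)[c ec]; exists c => i.
  have := congr1 (fun f : {ffun 'I_t0 -> PA} => f i) ec; rewrite ffunE => ->.
  rewrite sum_ffunE; apply: eq_bigr => j _; rewrite fE (nth_map [::]) ?em //.
  by rewrite ffunE.
- move=> j; have := spanF _ (mem_nth [::] (eq_ind_r (fun n => (j < n)%N) (ltn_ord j) em)).
  rewrite map_mxs_fv.
  have sm : size (map colv (enum 'I_t1)) = t1 by rewrite size_map size_enum_ord.
  move=> /(inspan_comb_ord sm)[c ec]; exists c => i; rewrite fE.
  have := congr1 (fun f : {ffun 'I_t0 -> PA} => f i) ec => ->.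
  rewrite sum_ffunE; apply: eq_bigr => l _; rewrite (nth_map l) ?size_enum_ord //.
  by rewrite nth_ord_enum !ffunE.
Qed.

(** The tips are arrows, and among paths of equal length division means equality. *)
Lemma tip1_ndiv m (f1 : 'I_m -> copR k v) (b : 'I_m -> 'I_t0 * qpath Q) :
  (forall l i, pa_deg 1 (cop_coord (f1 l) i)) -> (forall l, is_tip lt (f1 l) (b l)) ->
  injective b -> (forall l, plen (b l).2 = 1%N) /\
  forall l l', l <> l' -> ~ left_divides (b l) (b l').
Proof.
move=> fd ft bi; have lb l : plen (b l).2 = 1%N.
  by have [ob _] := ft l; have /pa_degP/(_ _ ob) [] := fd l (b l).1.
split=> // l l' ne /left_divides_eq e; apply: ne; apply: bi; apply: e.
by rewrite !lb.
Qed.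

(** The reduced rows and the columns of the matrix span the same space, and both are independent:
    the columns by [colv_free], the rows because directness over kQ can be applied to scalar
    coefficients. *)
Lemma F_size : size F = t1.
Proof.
have [f1 [u [b [_ [fd fu] [ft bi] h1 h2]]]] := first_syzygies_aux (erefl (size F)).
have [_ nd] := tip1_ndiv fd ft bi.
have dir := tip_direct adm fu ft nd.
pose g l : {ffun 'I_t0 -> PA} := [ffun i => cop_coord (f1 l) i].
have gfree : free_family g.
  move=> c h l.
  have z : \sum_j ract (f1 j) (c j *: (1 : PA)) = 0.
    apply: cop_eqP => i; rewrite coord_sum coord0.
    have := congr1 (fun f : {ffun 'I_t0 -> PA} => f i) h; rewrite sum_ffunE ffunE => e.
    rewrite -[RHS]e; apply: eq_bigr => j _.
    by rewrite coordM !ffunE -[LHS]scale_pathalgAr mulr1.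
  have := direct_fin dir z l => /(congr1 (fun x : copR k v => (cop_coord x (b l).1)@_(b l).2)).
  rewrite coordM -[X in X@_ _ = _]scale_pathalgAr mulr1 coefZ coord0 coef0 => /eqP.
  by rewrite mulf_eq0 => /orP[/eqP //|]; have [/negPf ob _] := ft l; rewrite ob.
have s1 j : exists c : 'I_t1 -> k, g j = \sum_l c l *: colv l.
  have [c hc] := h2 j; exists c; apply/ffunP => i; rewrite ffunE hc sum_ffunE.
  by apply: eq_bigr => l _; rewrite !ffunE.
have s2 l : exists c : 'I_(size F) -> k, colv l = \sum_j c j *: g j.
  have [c hc] := h1 l; exists c; apply/ffunP => i; rewrite ffunE hc sum_ffunE.
  by apply: eq_bigr => j _; rewrite !ffunE.
apply/eqP; rewrite eqn_leq (free_family_leq gfree s1 s2).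
exact: (free_family_leq colv_free s2 s1).
Qed.

Variables (f1 : 'I_t1 -> copR k v) (u : 'I_t1 -> Q) (b : 'I_t1 -> 'I_t0 * qpath Q).
Hypothesis f1_deg : forall l i, pa_deg 1 (cop_coord (f1 l) i).
Hypothesis f1_unif : forall l, ract (f1 l) (vtx k (u l)) = f1 l.
Hypothesis f1_tip : forall l, is_tip lt (f1 l) (b l).
Hypothesis b_inj : injective b.
Hypothesis entry_f1 : forall l, exists c : 'I_t1 -> k, forall i,
  entry l i = \sum_j c j *: cop_coord (f1 j) i.
Hypothesis f1_entry : forall j, exists c : 'I_t1 -> k, forall i,
  cop_coord (f1 j) i = \sum_l c l *: entry l i.

Lemma f1_ndiv l l' : l <> l' -> ~ left_divides (b l) (b l').
Proof. by have [_] := tip1_ndiv f1_deg f1_tip b_inj; apply. Qed.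
Lemma f1_direct : direct_family f1.
Proof. exact: (tip_direct adm f1_unif f1_tip f1_ndiv). Qed.
Lemma f1_cancel l (r : PA) : ract (f1 l) r = 0 -> vtx k (u l) * r = 0.
Proof. exact: (fam_cancel adm f1_unif f1_tip). Qed.
Lemma f1_reduced : right_tip_reduced lt f1.
Proof. exact: (is_tip_reduced adm f1_unif f1_tip f1_ndiv). Qed.

Lemma red_exists (x : copR k v) : exists y, reduces_to (pr := pr) x y.
Proof.
exists (mkcop _ (fun i => pr (cop_coord x i))) => i.
by rewrite (mkcopE (F := fun i => pr (cop_coord x i))) // => j; rewrite -rmorphM coord_id.
Qed.

Lemma pi_exists : exists pi : {linear copR k v -> restr pr M},
  forall x y, reduces_to (pr := pr) x y -> pi x = d0 y.
Proof.
have ee i : vtx k (v i) * vtx k (v i) = vtx k (v i) := vtxMM k (v i).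
have [pi hpi] := cop_lift (fun i => vtx k (v i))
  (fun i => d0 (eps (fun i => pr (vtx k (v i))) i) : restr pr M).
exists pi => x y hxy; rewrite hpi.
transitivity (\sum_i ract (d0 (eps (fun i => pr (vtx k (v i))) i)) (pr (cop_coord x i))).
  by [].
rewrite [in RHS](cop_eps (vtxL_idem pr v) y) linear_sum.
by apply: eq_bigr => i _; rewrite linear_ract hxy.
Qed.

Variable pi : {linear copR k v -> restr pr M}.
Hypothesis piE : forall x y, reduces_to (pr := pr) x y -> pi x = d0 y.

Local Notation N := (rspan_in f1 (fun=> True)).

Definition colR l : copR k v := mkcop _ (entry l).

Lemma colR_coord l i : cop_coord (colR l) i = entry l i.
Proof. by apply: mkcopE => j; exact: entry_v. Qed.

Lemma colR_span l : N (colR l).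
Proof.
have [c hc] := entry_f1 l; apply/rspan_fin; exists (fun j => c j *: (1 : PA)).
apply: cop_eqP => i; rewrite colR_coord hc coord_sum; apply: eq_bigr => j _.
by rewrite coordM -[RHS]scale_pathalgAr mulr1.
Qed.

Lemma pi_submodule : submodule (fun x => pi x = 0).
Proof.
split=> [|r x y hx hy]; first exact: linear0.
by rewrite linearD linear_ract /= hx hy ract0r addr0.
Qed.

Lemma pi_colR l : pi (colR l) = 0.
Proof.
have [y hy] := red_exists (colR l); rewrite (piE hy); apply/d0_ker.
exists (eps (fun l => pr (vtx k (w l))) l); apply: cop_eqP => i; rewrite d1_coord hy.
rewrite (bigD1 l) //= (coord_eps (vtxL_idem pr w)) eqxx big1 ?addr0.
  by rewrite -rmorphM entry_w colR_coord.
by move=> j ne; rewrite (coord_eps (vtxL_idem pr w)) (negPf ne) mulr0.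
Qed.

Lemma pi_f1 j : pi (f1 j) = 0.
Proof.
have [c hc] := f1_entry j.
have -> : f1 j = \sum_l ract (colR l) (c l *: (1 : PA)).
  apply: cop_eqP => i; rewrite hc coord_sum; apply: eq_bigr => l _.
  by rewrite coordM colR_coord -[RHS]scale_pathalgAr mulr1.
by apply: (submodule_sum pi_submodule) => l _; apply: (submodule_ract _ pi_submodule);
  exact: pi_colR.
Qed.

Lemma pi_ideal x : (forall i, I (cop_coord x i)) -> pi x = 0.
Proof.
move=> hx; rewrite (piE (y := 0)) ?linear0 // => i.
by rewrite coord0; apply/esym/(pr_eq0 I_quot).
Qed.

Lemma pi_surj m : exists x, pi x = m.
Proof.
have [y <-] := d0_surj m.
pose x : copR k v := mkcop _ (fun i => vtx k (v i) * lift I_quot (cop_coord y i)).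
have xE i : cop_coord x i = vtx k (v i) * lift I_quot (cop_coord y i).
  have hv j : vtx k (v j) * (vtx k (v j) * lift I_quot (cop_coord y j)) =
      vtx k (v j) * lift I_quot (cop_coord y j) by rewrite mulrA vtxMM.
  exact: (mkcopE i hv).
exists x; apply: piE => i; rewrite xE rmorphM liftK.
by rewrite (coord_id y).
Qed.

(** The reduction of x modulo I is in the image of [d1]. Lifting the coordinates of a preimage to kQ
    gives a combination of the columns, which lies in N and agrees with x modulo I. *)
Lemma pi_kernel x : pi x = 0 -> exists n h, [/\ x = n + h, N n & forall i, I (cop_coord h i)].
Proof.
move=> hx; have [z hz] := red_exists x; move: hx; rewrite (piE hz) => /d0_ker[y ey].
pose n := \sum_l ract (colR l) (lift I_quot (cop_coord y l)).
exists n, (x - n); split; first by rewrite addrC subrK.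
  by apply: (submodule_sum (rspan_submodule f1)) => l _;
    apply: (submodule_ract _ (rspan_submodule f1)); exact: colR_span.
move=> i; apply/(pr_eq0 I_quot); rewrite coordB rmorphB -hz -ey d1_coord coord_sum rmorph_sum.
rewrite -sumrB big1 // => l _; by rewrite coordM colR_coord rmorphM liftK subrr.
Qed.

Definition positive (x : copR k v) : Prop := forall c, occurs x c -> (0 < plen c.2)%N.
Definition reduced (x : copR k v) : Prop :=
  positive x /\ forall c, occurs x c -> forall l, ~ left_divides (b l) c.

Lemma positive_submodule : submodule positive.
Proof.
split=> [c /not_occurs0 //|r x y hx hy c /occursD[|/hy //]].
rewrite /occurs coordM => /mcoeffM_pcat[p [q [h np _]]].
by have := hx (c.1, p) np; rewrite (plen_pcat h) addn_gt0 /= => ->.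
Qed.

(* The tips of the f1 are arrows, so no path of positive length acquires one as
   a prefix by multiplication on the right. *)
Lemma reduced_submodule : submodule reduced.
Proof.
have [p0 pS] := positive_submodule; split.
  by split=> // c /not_occurs0.
move=> r x y [px hx] [py hy]; split; first exact: pS.
move=> c /occursD[|/hy //]; rewrite {1}/occurs coordM => /mcoeffM_pcat[p [q [h np _]]] l [e1 [s hs]].
have [lb _] := tip1_ndiv f1_deg f1_tip b_inj.
have oc : occurs x (c.1, p) by [].
apply: (hx (c.1, p) oc l); split=> //=.
have le : (plen (b l).2 <= plen p)%N by rewrite lb; exact: px oc.
exists (pdrop (plen (b l).2) p).
by rewrite -{1}(ptake_prefix hs h le); exact: pcat_take_drop.
Qed.

Lemma N_positive x : N x -> positive x.
Proof.
apply: rspan_min => [|l c oc]; first exact: positive_submodule.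
by have /pa_degP/(_ _ oc) [->] := @f1_deg l c.1.
Qed.

Lemma N_reduced x : N x -> reduced x -> x = 0.
Proof.
move=> hN [_ hx]; apply: contrapT => nx.
have [c [l [oc dc]]] := rspan_tip adm f1_unif f1_tip f1_ndiv hN nx.
exact: (hx c oc l dc).
Qed.

Lemma ideal_positive x : (forall i, I (cop_coord x i)) -> positive x.
Proof. by move=> hx c oc; apply: ltnW; exact: (ideal_low I_sub (hx c.1) oc). Qed.

Lemma sum_split (A B : eqType) (V : nmodType) (s : seq (A + B)) (G : A + B -> V) :
  uniq s -> exists s1 s2, [/\ uniq s1, uniq s2,
    forall a, (a \in s1) = (inl a \in s), forall c, (c \in s2) = (inr c \in s) &
    \sum_(j <- s) G j = \sum_(a <- s1) G (inl a) + \sum_(c <- s2) G (inr c)].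
Proof.
elim: s => [|j s IH] /=; first by exists [::], [::]; rewrite !big_nil addr0.
move=> /andP[nj /IH[s1 [s2 [u1 u2 m1 m2 e]]]]; rewrite big_cons e.
case: j nj => [a|c] nj.
  exists (a :: s1), s2; split=> //=; first by rewrite m1 nj.
  - by move=> a'; rewrite !inE m1.
  - by rewrite big_cons addrA.
exists s1, (c :: s2); split=> //=; first by rewrite m2 nj.
- by move=> c'; rewrite !inE m2.
- by rewrite big_cons addrCA.
Qed.

Lemma complement_exists : exists (U1 : eqType) (f1' : U1 -> copR k v) (u' : U1 -> Q),
  [/\ forall j i, I (cop_coord (f1' j) i),
      (forall j, ract (f1' j) (vtx k (u' j)) = f1' j) /\
        (forall j r, ract (f1' j) r = 0 -> vtx k (u' j) * r = 0),
      right_tip_reduced lt f1' /\ direct_family f1',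
      forall x, N x -> rspan_in f1' (fun=> True) x -> x = 0 &
      forall x, pi x = 0 -> exists n c, [/\ x = n + c, N n & rspan_in f1' (fun=> True) c]].
Proof.
have subN := rspan_submodule f1.
pose C1 x := pi x = 0 /\ reduced x.
have subC1 : submodule C1.
  have [a0 aS] := pi_submodule; have [r0 rS] := reduced_submodule.
  by split=> // r x y [x1 x2] [y1 y2]; split; [exact: aS | exact: rS].
have [J [g [ug [bg [gC gu gt gd gs]]]]] := tip_basis adm subC1.
have gdir := tip_direct adm gu gt gd.
have gcan j (r : PA) : ract (g j) r = 0 -> vtx k (ug j) * r = 0.
  exact: (fam_cancel adm gu gt).
have gnh j : exists nh : copR k v * copR k v,
    [/\ g j = nh.1 + nh.2, N nh.1 & forall i, I (cop_coord nh.2 i)].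
  by have [/pi_kernel[n [h hh]] _] := gC j; exists (n, h).
have [nh hnh] := choice gnh.
(* Multiplying both parts by the vertex of g_j makes them uniform and keeps their sum equal to
   g_j. *)
pose n' j := ract (nh j).1 (vtx k (ug j)).
pose h' j := ract (nh j).2 (vtx k (ug j)).
have eg j : g j = n' j + h' j.
  by have [e _ _] := hnh j; rewrite -[LHS]gu {1}e ractDl.
have hn' j : N (n' j) by have [_ hN _] := hnh j; exact: submodule_ract.
have hI j i : I (cop_coord (h' j) i).
  by have [_ _ hI] := hnh j; rewrite /h' coordM; exact: idealMr.
have hu j : ract (h' j) (vtx k (ug j)) = h' j by rewrite ractA vtxMM.
pose C2 := rspan_in h' (fun=> True).
have C2I x : C2 x -> forall i, I (cop_coord x i).
  apply: (rspan_min (C := fun x : copR k v => forall i, I (cop_coord x i))) => [|j]; last exact: hI.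
  split=> [i|r y z hy hz i]; first by rewrite coord0; exact: ideal0.
  by rewrite coordD coordM; apply: idealD => //; apply: idealMr.
(* Replacing h' by g in the expression of x changes it by an element of N, so the result is in N and
   also reduced, hence 0. Directness of g then annihilates every coefficient, and with it x. *)
have NC2 x : N x -> C2 x -> x = 0.
  move=> hx /rspan_uniq[s [r [us ex]]].
  have e : \sum_(j <- s) ract (g j) (r j) = x + \sum_(j <- s) ract (n' j) (r j).
    by rewrite ex -big_split; apply: eq_bigr => j _; rewrite eg ractDl addrC.
  have z : \sum_(j <- s) ract (g j) (r j) = 0.
    apply: N_reduced.
      rewrite e; apply: submoduleD => //; apply: submodule_sum => // j _.
      exact: submodule_ract.
    apply: (submodule_sum reduced_submodule) => j _.
    by apply: (submodule_ract _ reduced_submodule); case: (gC j).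
  rewrite ex big_seq big1 // => j js.
  by rewrite -hu ractA (gcan j _ (gdir s r us z j js)) ractr0.
have [U1 [f1' [u' [b' [fC fu ft fd fs]]]]] := tip_basis adm (rspan_submodule h').
exists U1, f1', u'; split.
- move=> j; exact: (C2I (f1' j) (fC j)).
- by split; [exact: fu | move=> j r; exact: (fam_cancel adm fu ft)].
- by split; [exact: (is_tip_reduced adm fu ft fd) | exact: (tip_direct adm fu ft fd)].
- move=> x hx hc; apply: NC2 => //.
  by apply: rspan_min hc; [exact: rspan_submodule | exact: fC].
(* Without vertex terms in x, the remainder of the division by f^1 has none either and is therefore
   reduced. *)
move=> x hx; have px : positive x.
  have [n [h [-> hn hI']]] := pi_kernel hx.
  by apply: (submoduleD positive_submodule); [exact: N_positive | exact: ideal_positive].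
have [n [z [ex hn hz]]] := division adm f1_unif f1_tip x.
have ez : z = x - n by rewrite ex addrAC subrr add0r.
have Nz y : N y -> pi y = 0.
  by move=> hy; exact: (rspan_min pi_submodule pi_f1 hy).
have cz : C1 z.
  split; first by rewrite ez; apply: (submoduleB pi_submodule) => //; exact: Nz.
  split=> //; rewrite ez; apply: (submoduleB positive_submodule) => //.
  exact: N_positive.
have [s [r [us er]]] := rspan_uniq (gs z cz).
exists (n + \sum_(j <- s) ract (n' j) (r j)), (\sum_(j <- s) ract (h' j) (r j)); split.
- rewrite {1}ex er -addrA -big_split; congr (_ + _); apply: eq_bigr => j _.
  by rewrite eg ractDl.
- apply: submoduleD => //; apply: submodule_sum => // j _; exact: submodule_ract.
- apply: fs; apply: (submodule_sum (rspan_submodule h')) => j _.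
  by apply: (submodule_ract _ (rspan_submodule h')); exact: rspan_gen.
Qed.

Lemma presentation : exists (U1 : eqType) (f1' : U1 -> copR k v),
  [/\ forall x, pi x = 0 <-> exists y : rspan (sum_family f1 f1'), val y = x,
      direct_family (sum_family f1 f1'), projective (rspan (sum_family f1 f1')),
      right_tip_reduced lt f1' & forall j i, I (cop_coord (f1' j) i)].
Proof.
have [U1 [f1' [u' [hI [fu fc] [fr fdir] NC hK]]]] := complement_exists.
exists U1, f1'; set f := sum_family f1 f1'.
have subf := rspan_submodule f.
have dir : direct_family f.
  move=> s r us h; have [s1 [s2 [us1 us2 m1 m2 es]]] := sum_split (fun j => ract (f j) (r j)) us.
  rewrite es in h.
  have hN : N (\sum_(a <- s1) ract (f (inl a)) (r (inl a))).
    by exists s1, (fun a => r (inl a)).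
  have hC : rspan_in f1' (fun=> True) (- \sum_(c <- s2) ract (f (inr c)) (r (inr c))).
    exists s2, (fun c => - r (inr c)); split=> //.
    by rewrite -sumrN; apply: eq_bigr => c _; rewrite ractNr.
  (* This element lies both in N and in the span of f^1', so it is 0 and the two families can be
     treated separately. *)
  have e : \sum_(a <- s1) ract (f (inl a)) (r (inl a)) =
      - \sum_(c <- s2) ract (f (inr c)) (r (inr c)) by apply/eqP; rewrite -addr_eq0 h.
  have z1 : \sum_(a <- s1) ract (f1 a) (r (inl a)) = 0 by apply: NC => //; rewrite e.
  have z2 : \sum_(c <- s2) ract (f1' c) (r (inr c)) = 0.
    by move: h; rewrite [X in X + _]z1 add0r.
  move=> [a|c] js /=.
    by apply: (f1_direct us1 (r := fun a => r (inl a)) z1); rewrite m1.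
  by apply: (fdir _ (fun c => r (inr c)) us2 z2); rewrite m2.
split=> //.
- move=> x; split=> [/hK[n [c [ex hn hc]]]|[y <-]].
    have hx : x \in rspan_pred f.
      apply/mem_rspan; rewrite ex; apply: submoduleD => //.
        by apply: rspan_min hn => // l; exact: (rspan_gen f (inl l)).
      by apply: rspan_min hc => // l; exact: (rspan_gen f (inr l)).
    by exists (Submod hx).
  have hy : rspan_in f (fun=> True) (val y) by apply/mem_rspan; exact: (valP y).
  apply: (rspan_min pi_submodule _ hy).
  by move=> [l|j]; [exact: pi_f1 | exact: (pi_ideal (hI j))].
apply: (projective_rspan (e := fun j => match j with inl l => vtx k (u l) | inr j => vtx k (u' j) end)).
- exact: dir.
- by case.
- by move=> [l|j] r; [exact: f1_cancel | exact: fc].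
Qed.

End Presentation.

(** * Second syzygies *)

Section SyzygyResolution.
Variables (k : fieldType) (Q : quiver) (I : pathalg k Q -> Prop) (L : pzRingType).
Variable pr : {rmorphism pathalg k Q -> L}.
Hypothesis I_homog : exists S : pathalg k Q -> Prop,
  (forall g, S g -> exists n : nat, pa_deg n%:Z g) /\ forall x, I x <-> ideal_gen S x.
Hypothesis I_quot : is_quotient_ring I pr.

(** The syzygy is generated in degree 1; lowering all degrees by 1 makes its resolution start in
    degree 0. *)
Definition gshift (A : gmod L) : gmod L := @GMod L A (fun n x => gdeg (n + 1) x).

Lemma gshift_graded (A : gmod L) : is_graded pr A -> is_graded pr (gshift A).
Proof.
move=> hA; have [h1 h2 _ h4] := hA; split.
- by move=> n; exact: h1.
- by move=> n m x a hx ha /=; rewrite addrAC; exact: h2.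
- move=> x; have [s [c [us hc _ ex]]] := graded_decomp (x : A) hA.
  exists [seq n - 1 | n <- s], (fun n => c (n + 1)); split=> [n|]; first exact: hc.
  by rewrite big_map ex; apply: eq_bigr => n _; rewrite subrK.
move=> s c us hc hs n ns.
have us' : uniq [seq n + 1 | n <- s] by rewrite map_inj_uniq // => i j /addIr.
have := h4 [seq n + 1 | n <- s] (fun n => c (n - 1)) us' _ _ (n + 1).
rewrite addrK; apply; last by apply/mapP; exists n.
  by move=> i; rewrite -[i in gdeg i](subrK 1); exact: hc.
by rewrite big_map -[RHS]hs; apply: eq_bigr => i _; rewrite addrK.
Qed.

(* A graded submodule [K] of [A], its degrees lowered by 1. *)
Lemma gker_graded (A K M : gmod L) (iota : {linear K -> A}) (d : {linear A -> M}) :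
  is_graded pr A -> is_graded pr M -> degree0 d -> injective iota ->
  (forall n x, gdeg n x <-> gdeg (n + 1) (iota x)) ->
  (forall x, d x = 0 <-> exists y, iota y = x) -> is_graded pr K.
Proof.
move=> hA hM dd inj hdeg hker; have [h1 h2 _ h4] := hA; have [m1 _ _ m4] := hM.
split.
- move=> n; split=> [|x y]; first by apply/hdeg; rewrite linear0; case: (h1 (n + 1)).
  by rewrite !hdeg => hx hy; rewrite linearB; apply: (h1 (n + 1)).2.
- by move=> n m x a; rewrite !hdeg linear_ract addrAC; exact: h2.
- move=> x; have [s [c [us hc c0 ex]]] := graded_decomp (iota x) hA.
  have z n : exists y, iota y = c n.
    apply/hker; case: (boolP (n \in s)) => [ns|/c0 ->]; last exact: linear0.
    apply: (m4 s (fun n => d (c n)) us _ _ n ns) => [i|]; first exact: dd.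
    by rewrite -linear_sum -ex; apply/hker; exists x.
  have [c' hc'] := choice z; exists [seq n - 1 | n <- s], (fun n => c' (n + 1)).
  split=> [n|]; first by apply/hdeg; rewrite hc'.
  apply: inj; rewrite ex linear_sum big_map; apply: eq_bigr => n _.
  by rewrite hc' subrK.
move=> s c us hc hs n ns; apply: inj; rewrite linear0.
have us' : uniq [seq n + 1 | n <- s] by rewrite map_inj_uniq // => i j /addIr.
have := h4 [seq n + 1 | n <- s] (fun n => iota (c (n - 1))) us' _ _ (n + 1).
rewrite addrK; apply; last by apply/mapP; exists n.
  by move=> i; rewrite -[i in gdeg i](subrK 1); apply/hdeg.
rewrite big_map -[RHS](linear0 iota) -hs linear_sum; apply: eq_bigr => i _.
by rewrite addrK.
Qed.

Variables (M : gmod L) (P : nat -> gmod L) (e : forall n, {linear P n.+1 -> P n}).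
Variable d0 : {linear P 0%N -> M}.
Hypothesis res : minimal_linear_resolution pr e d0.
Variables (K B1 B2 : gmod L) (iota : {linear K -> P 0%N}) (e1 : {linear B1 -> K}).
Variables (e2 : {linear B2 -> B1}) (phi1 : {linear B1 -> P 1%N}) (psi1 : {linear P 1%N -> B1}).
Variables (phi2 : {linear B2 -> P 2%N}) (psi2 : {linear P 2%N -> B2}).
Hypotheses (iota_inj : injective iota).
Hypothesis iota_deg : forall n x, gdeg n x <-> gdeg (n + 1) (iota x).
Hypothesis iota_ker : forall x, d0 x = 0 <-> exists y, iota y = x.
Hypotheses (phi1K : cancel phi1 psi1) (psi1K : cancel psi1 phi1).
Hypotheses (phi2K : cancel phi2 psi2) (psi2K : cancel psi2 phi2).
Hypothesis phi1_deg : forall n x, gdeg n x <-> gdeg (n + 1) (phi1 x).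
Hypothesis phi2_deg : forall n x, gdeg n x <-> gdeg (n + 1) (phi2 x).
Hypothesis e1E : forall x, iota (e1 x) = e 0%N (phi1 x).
Hypothesis e2E : forall x, phi1 (e2 x) = e 1%N (phi2 x).
Hypotheses (B1_gr : is_graded pr B1) (B1_proj : projective B1) (B1_fg : fin_gen_in_degree 0 B1).
Hypotheses (B2_gr : is_graded pr B2) (B2_proj : projective B2) (B2_fg : fin_gen_in_degree 1 B2).

(** [B1] and [B2] stand for [P 1] and [P 2]. From [P 3] on the given resolution is kept, so only the
    differential out of [P 3] has to be transported. *)
Definition tail_diff n : {linear splice B1 B2 (fun m => gshift (P m.+3)) n.+1 ->
    splice B1 B2 (fun m => gshift (P m.+3)) n} :=
  match n with
  | 0 => e2
  | 1 => psi2 \o e 2%N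
  | m.+2 => e m.+3
  end.

(** Exactness is carried over by the isomorphisms [phi1] and [phi2], and minimality by the fact that
    linear maps respect multiples of the radical. *)
Lemma syzygy_resolution : linear_resolution_start pr (M := K) e2 e1.
Proof.
have [[M_gr _] [gp [d0_deg e_deg] d0_surj d0_ker e_ker] rad fg] := res.
have e1_deg : degree0 e1.
  by move=> n x hx; apply/iota_deg; rewrite e1E; apply: e_deg; apply/phi1_deg.
have e1_surj y : exists x, e1 x = y.
  have /d0_ker[z ez] : d0 (iota y) = 0 by apply/iota_ker; exists y.
  by exists (psi1 z); apply: iota_inj; rewrite e1E psi1K.
have K_gr : is_graded pr K.
  exact: (gker_graded (proj1 (gp 0%N)) M_gr d0_deg iota_inj iota_deg iota_ker).
have psi2_deg n x : gdeg (n + 1) x -> gdeg n (psi2 x).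
  by move=> hx; apply/phi2_deg; rewrite psi2K.
exists (fun m => gshift (P m.+3)), tail_diff; split; first by [].
split.
(* [K] is an image of [B1], which is generated in degree 0, so nothing of [K] lies in negative
   degrees. *)
- split=> //; exists 0 => n x lt hx; have [z ez] := e1_surj x.
  exact: (image_low_degree I_homog I_quot K_gr e1_deg B1_fg lt hx (esym ez)).
- split.
  + move=> [|[|n]] //=; split; last exact: (proj2 (gp n.+3)).
    exact: (gshift_graded (proj1 (gp n.+3))).
  + split=> // -[|[|n]] d x hx /=.
    * by apply/phi1_deg; rewrite e2E; apply: e_deg; apply/phi2_deg.
    * by apply: psi2_deg; exact: (e_deg 2%N).
    * exact: (e_deg n.+3).
  + exact: e1_surj.
  + move=> x; split=> [h|[y <-]].
      have /e_ker[z ez] : e 0%N (phi1 x) = 0 by rewrite -e1E h linear0.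
      by exists (psi2 z); rewrite -(phi1K (e2 _)) e2E psi2K ez phi1K.
    apply: iota_inj; rewrite e1E linear0 /= e2E; apply/e_ker.
    by exists (phi2 y).
  move=> [|[|n]] x /=.
  + split=> [h|[y <-]].
      have /e_ker[z ez] : e 1%N (phi2 x) = 0 by rewrite -e2E h linear0.
      by exists z; rewrite /= ez phi2K.
    rewrite -(phi1K (e2 _)) e2E /= psi2K.
    have -> : e 1%N (e 2%N y) = 0 by apply/e_ker; exists y.
    exact: linear0.
  + split=> [h|[y <-]].
      by apply/e_ker; rewrite -(psi2K (e 2%N x)) h linear0.
    have -> : e 2%N (e 3%N y) = 0 by apply/e_ker; exists y.
    exact: linear0.
  + exact: e_ker.
- move=> [|[|n]] x /=.
  + by rewrite -(phi1K (e2 x)) e2E; apply: mul_rad_img; exact: rad.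
  + by apply: mul_rad_img; exact: rad.
  + exact: rad.
move=> [|[|n]] //=; have [m [g [hg hgen]]] := fg n.+3.
exists m, g; split=> // i /=.
by have -> : n.+2%:Z + 1 = n.+3%:Z by rewrite -PoszD addn1.
Qed.

End SyzygyResolution.

Section InjectiveImage.
Variable R : pzRingType.

Lemma linear_inj0 (M M' : lmodType R^c) (h : {linear M -> M'}) :
  (forall x, h x = 0 -> x = 0) -> injective h.
Proof.
by move=> h0 x y e; apply/eqP; rewrite -subr_eq0; apply/eqP/h0; rewrite linearB e subrr.
Qed.

Lemma linear_can_eq0 (M M' : lmodType R^c) (h : {linear M -> M'}) (h' : {linear M' -> M}) x :
  cancel h h' -> h x = 0 -> x = 0.
Proof. by move=> hK e; rewrite -(hK x) e linear0. Qed.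

Lemma cop_lift_inj (M : lmodType R^c) n (e : 'I_n -> R) (f : 'I_n -> M) (h : {linear cop e -> M}) :
  direct_family f -> (forall j r, ract (f j) r = 0 -> e j * r = 0) ->
  (forall x, h x = \sum_j ract (f j) (cop_coord x j)) -> injective h.
Proof.
move=> fd fc hE; apply: linear_inj0 => x; rewrite hE => h0.
apply: cop_eqP => j; rewrite coord0 -(coord_id x).
exact: fc _ _ (direct_fin fd h0 j).
Qed.

Lemma ract_image_eq0 (M M' : lmodType R^c) (h : {linear M -> M'}) x (r : R) :
  injective h -> ract (h x) r = 0 -> ract x r = 0.
Proof. by move=> inj h0; apply: inj; rewrite linear_ract h0 linear0. Qed.

Lemma ract_image (M M' : lmodType R^c) (h : {linear M -> M'}) x (r : R) :
  ract x r = x -> ract (h x) r = h x.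
Proof. by move=> e; rewrite -linear_ract e. Qed.

Lemma direct_image (J : eqType) (M M' : lmodType R^c) (h : {linear M -> M'}) (f : J -> M') (g : J -> M) :
  injective h -> (forall j, f j = h (g j)) -> direct_family g -> direct_family f.
Proof.
move=> inj fE gd s r us h0 j js; rewrite fE -linear_ract (gd s r us _ j js) ?linear0 //.
apply: inj; rewrite linear0 linear_sum -[RHS]h0; apply: eq_bigr => i _.
by rewrite linear_ract fE.
Qed.

Lemma ract_sum_sum (M : lmodType R^c) n m (f : 'I_n -> M) (c : 'I_m -> 'I_n -> R) (r : 'I_m -> R) :
  \sum_j ract (\sum_l ract (f l) (c j l)) (r j) = \sum_l ract (f l) (\sum_j c j l * r j).
Proof.
under [RHS]eq_bigr => l _ do rewrite ract_sumr.
rewrite exchange_big; apply: eq_bigr => j _; rewrite ract_suml.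
by apply: eq_bigr => l _; rewrite ractA.
Qed.

Lemma rmorph_sum_corner (L : pzRingType) (pr : {rmorphism R -> L}) n (a : R) (c b r : 'I_n -> R) :
  (forall j, a * c j = c j) -> (forall j, c j * b j = c j) ->
  \sum_j pr (c j) * pr (b j * r j) = pr (a * \sum_j c j * r j).
Proof.
move=> ac cb; rewrite mulr_sumr rmorph_sum; apply: eq_bigr => j _.
by rewrite -rmorphM !mulrA cb ac.
Qed.

End InjectiveImage.

(** * Maps of coproducts given by matrices over the path algebra *)

Section MatrixMaps.
Variables (k : fieldType) (Q : quiver) (I : pathalg k Q -> Prop) (L : pzRingType).
Variable pr : {rmorphism pathalg k Q -> L}.
Local Notation PA := (pathalg k Q).
Hypothesis I_sub : forall x, I x -> ideal_prod (@arrow_ideal k Q) (@arrow_ideal k Q) x.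
Hypothesis I_homog : exists S : PA -> Prop,
  (forall g, S g -> exists n : nat, pa_deg n%:Z g) /\ forall x, I x <-> ideal_gen S x.
Hypothesis I_quot : is_quotient_ring I pr.

Local Notation ep u := (eps (fun i => pr (vtx k (u i)))).

(** The condition on termini makes the image of the j-th basis element exactly the j-th column. *)
Definition is_matrix_map n m (u : 'I_n -> Q) (v : 'I_m -> Q)
    (h : {linear copL pr u -> copL pr v}) (E : 'I_n -> 'I_m -> PA) : Prop :=
  (forall j i, E j i * vtx k (u j) = E j i) /\
  forall x i, cop_coord (h x) i = \sum_j pr (E j i) * cop_coord x j.

Lemma matrix_map_eps n m (u : 'I_n -> Q) (v : 'I_m -> Q)
    (h : {linear copL pr u -> copL pr v}) E j i :
  is_matrix_map h E -> cop_coord (h (ep u j)) i = pr (E j i).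
Proof.
move=> [hE ->]; rewrite (bigD1 j) //= (coord_eps (vtxL_idem pr u)) eqxx big1 ?addr0.
  by rewrite -rmorphM hE.
by move=> l ne; rewrite (coord_eps (vtxL_idem pr u)) (negPf ne) mulr0.
Qed.

Definition lincomb n (u : 'I_n -> Q) (c : 'I_n -> k) : copL pr u :=
  \sum_j ract (ep u j) (pr (c j *: (1 : PA))).

Lemma quot_deg_scalar (c : k) : quot_deg pr 0 (pr (c *: (1 : PA))).
Proof.
exists (c *: (1 : PA)) => //; apply: pa_degZ.
by apply: pa_deg_sum => u _; exact: pa_deg_vtx.
Qed.

Lemma lincomb_deg n (u : 'I_n -> Q) c s : copL_deg s s (lincomb u c).
Proof.
apply: (gdeg_sum (A := copL_gmod pr u s) _ (copL_graded I_homog I_quot u s)) => j _.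
rewrite -[X in @gdeg _ _ X _]addr0.
apply: (gdegM (A := copL_gmod pr u s) (copL_graded I_homog I_quot u s)).
  exact: copL_deg_eps.
exact: quot_deg_scalar.
Qed.

Lemma matrix_map_lincomb n m (u : 'I_n -> Q) (v : 'I_m -> Q)
    (h : {linear copL pr u -> copL pr v}) E c i : is_matrix_map h E ->
  cop_coord (h (lincomb u c)) i = pr (\sum_j c j *: E j i).
Proof.
move=> hE; rewrite linear_sum coord_sum rmorph_sum; apply: eq_bigr => j _.
rewrite linear_ract coordM (matrix_map_eps j i hE) -rmorphM.
by congr (pr _); rewrite -[LHS]scale_pathalgAr mulr1.
Qed.

(** Expressing the columns of [h'] through those of [h] with scalar coefficients factors [h']
    through [h], and scalar coefficients preserve degree s. *)
Lemma matrix_map_span n n' m (u : 'I_n -> Q) (u' : 'I_n' -> Q) (v : 'I_m -> Q)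
    (h : {linear copL pr u -> copL pr v}) (h' : {linear copL pr u' -> copL pr v}) E E' s a :
  is_matrix_map h E -> is_matrix_map h' E' ->
  (forall l, exists c : 'I_n -> k, forall i, E' l i = \sum_j c j *: E j i) ->
  copL_deg s s a -> exists b, copL_deg s s b /\ h b = h' a.
Proof.
move=> hE hE' hc ha; have [c ec] := choice hc.
have hb l : h (lincomb u (c l)) = h' (ep u' l).
  by apply: cop_eqP => i; rewrite (matrix_map_lincomb _ _ hE) (matrix_map_eps _ _ hE') ec.
exists (\sum_l ract (lincomb u (c l)) (cop_coord a l)); split.
  apply: (gdeg_sum (A := copL_gmod pr u s) _ (copL_graded I_homog I_quot u s)) => l _.
  rewrite -[X in @gdeg _ _ X _]addr0.
  apply: (gdegM (A := copL_gmod pr u s) (copL_graded I_homog I_quot u s)).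
    exact: lincomb_deg.
  by have := ha l; rewrite subrr.
rewrite [in RHS](cop_eps (vtxL_idem pr u') a) [LHS]linear_sum [RHS]linear_sum.
by apply: eq_bigr => l _; rewrite [LHS]linear_ract [RHS]linear_ract hb.
Qed.

(* Linear elements of [I] vanish, so in degree [s] the map lifts to [kQ], where
   the columns are independent. *)
Lemma matrix_map_inj n m (u : 'I_n -> Q) (v : 'I_m -> Q)
    (h : {linear copL pr u -> copL pr v}) (g : 'I_n -> copR k v) s b :
  is_matrix_map h (fun j => cop_coord (g j)) ->
  (forall j i, pa_deg 1 (cop_coord (g j) i)) -> direct_family g ->
  (forall j r, ract (g j) r = 0 -> vtx k (u j) * r = 0) ->
  copL_deg s s b -> h b = 0 -> b = 0.
Proof.
move=> [_ hE] gd dir can hb h0.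
have hr j : exists r, pa_deg 0 r /\ pr r = cop_coord b j.
  by have [r dr er] := hb j; exists r; split=> //; move: dr; rewrite subrr.
have [r rP] := choice hr.
have z : \sum_j ract (g j) (r j) = 0.
  apply: cop_eqP => i; rewrite coord_sum coord0.
  apply: (ideal_low_eq0 I_sub (n := 1)) => //.
    apply/(pr_eq0 I_quot); rewrite rmorph_sum -[RHS](coord0 (fun i => pr (vtx k (v i))) i) -h0 hE.
    by apply: eq_bigr => j _; rewrite coordM rmorphM (rP j).2.
  apply: pa_deg_sum => j _; rewrite coordM.
  by have := pa_degM (gd j i) (rP j).1; rewrite addr0.
apply: cop_eqP => j; rewrite -(coord_id b) -(rP j).2 -rmorphM.
by rewrite (can _ _ (direct_fin dir z j)) rmorph0 coord0.
Qed.

End MatrixMaps.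

Section SecondSyzygies.
Variables (k : fieldType) (Q : quiver) (I : pathalg k Q -> Prop)
  (L : pzRingType) (pr : {rmorphism pathalg k Q -> L}) (M : gmod L)
  (t0 t1 : nat) (v : 'I_t0 -> Q) (w : 'I_t1 -> Q)
  (d0 : {linear copL pr v -> M}) (d1 : {linear copL pr w -> copL pr v})
  (mx : 'I_t1 -> 'I_t0 -> terms k Q).
Local Notation PA := (pathalg k Q).
Hypothesis I_sub : forall x, I x -> ideal_prod (@arrow_ideal k Q) (@arrow_ideal k Q) x.
Hypothesis I_homog : exists S : PA -> Prop,
  (forall g, S g -> exists n : nat, pa_deg n%:Z g) /\ forall x, I x <-> ideal_gen S x.
Hypothesis I_quot : is_quotient_ring I pr.
Variable T : nat -> gmod L.
Local Notation P := (splice (copL_gmod pr v 0) (copL_gmod pr w 1) T).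
Variable e : forall n, {linear P n.+1 -> P n}.
Hypothesis e_d1 : e 0%N =1 d1.
Hypothesis res : minimal_linear_resolution pr e d0.
Hypothesis mat : is_matrix d1 mx.

Lemma start_surj y : exists x, d0 x = y.
Proof. by have [_ [_ _ h _ _] _ _] := res; exact: h. Qed.

Lemma start_ker x : d0 x = 0 <-> exists y, d1 y = x.
Proof.
have [_ [_ _ _ h _] _ _] := res; rewrite h.
by split=> -[y <-]; exists y; rewrite e_d1.
Qed.

(** The kernel is the image of [P n.+2], which is generated one degree higher. *)
Lemma differential_inj n x : @gdeg L (P n.+1) n.+1%:Z x -> e n x = 0 -> x = 0.
Proof.
have [_ [gp [_ he] _ _ hk] _ fg] := res => dx /hk[y ey].
apply: (image_low_degree I_homog I_quot (proj1 (gp n.+1)) (he n.+1) (fg n.+2) _ dx (esym ey)).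
by rewrite ltz_nat.
Qed.

Lemma start_inj y : copL_deg (pr := pr) 1 1 y -> d1 y = 0 -> y = 0.
Proof. by move=> dy; rewrite -e_d1; exact: (differential_inj (n := 0)). Qed.

Variables (f1 : 'I_t1 -> copR k v) (u : 'I_t1 -> Q).
Hypothesis f1_deg : forall l i, pa_deg 1 (cop_coord (f1 l) i).
Hypothesis f1_unif : forall l, ract (f1 l) (vtx k (u l)) = f1 l.
Hypothesis f1_direct : direct_family f1.
Hypothesis f1_cancel : forall l r, ract (f1 l) r = 0 -> vtx k (u l) * r = 0.
Hypothesis entry_f1 : forall l, exists c : 'I_t1 -> k, forall i,
  entry mx l i = \sum_j c j *: cop_coord (f1 j) i.
Hypothesis f1_entry : forall j, exists c : 'I_t1 -> k, forall i,
  cop_coord (f1 j) i = \sum_l c l *: entry mx l i.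

Variables (n : nat) (cc : 'I_n -> copR k u) (u2 : 'I_n -> Q).
Hypothesis cc_deg : forall j l, pa_deg 1 (cop_coord (cc j) l).
Hypothesis cc_unif : forall j, ract (cc j) (vtx k (u2 j)) = cc j.
Hypothesis cc_direct : direct_family cc.
Hypothesis cc_cancel : forall j r, ract (cc j) r = 0 -> vtx k (u2 j) * r = 0.
Hypothesis cc_rel : forall j i, I (\sum_l cop_coord (f1 l) i * cop_coord (cc j) l).
Hypothesis cc_all : forall z : 'I_t1 -> PA, (forall l, pa_deg 1 (z l)) ->
  (forall l, vtx k (u l) * z l = z l) -> (forall i, I (\sum_l cop_coord (f1 l) i * z l)) ->
  exists s : 'I_n -> k, forall l, z l = \sum_j s j *: cop_coord (cc j) l.

Definition f2 j : copR k v := \sum_l ract (f1 l) (cop_coord (cc j) l).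

(** Directness of f^1 and u_l R being isomorphic to f^1_l R make this map an embedding; uniformity,
    directness and cancellation of the coefficient vectors pass to f^2 along it. *)
Lemma f2_combination : exists Phi : {linear copR k u -> copR k v},
  injective Phi /\ (forall j, f2 j = Phi (cc j)) /\
  forall x, Phi x = \sum_l ract (f1 l) (cop_coord x l).
Proof.
have [Phi hPhi] := cop_lift (fun l => vtx k (u l)) f1; exists Phi; split.
  exact: (cop_lift_inj f1_direct f1_cancel hPhi).
by split=> [j|x]; [exact: esym (hPhi (cc j)) | exact: hPhi].
Qed.

Lemma f2_direct : direct_family f2.
Proof.
have [Phi [inj [e2 _]]] := f2_combination.
exact: (direct_image inj e2 cc_direct).
Qed.

Lemma f2_unif j : ract (f2 j) (vtx k (u2 j)) = f2 j.
Proof. by have [Phi [_ [e2 _]]] := f2_combination; rewrite e2; exact: (ract_image Phi (cc_unif j)). Qed.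

Lemma f2_cancel j r : ract (f2 j) r = 0 -> vtx k (u2 j) * r = 0.
Proof.
have [Phi [inj [e2 _]]] := f2_combination; rewrite e2 => h.
exact: cc_cancel (ract_image_eq0 inj h).
Qed.

Lemma d1_matrix_map : is_matrix_map d1 (entry mx).
Proof. by split=> [j i|]; [exact: (entry_w mat) | exact: (d1_coord mat)]. Qed.

(** The family f^1 and the columns of [d1] span the same space over k, and both maps are injective
    in degree 1: these are the hypotheses of [head_iso]. *)
Lemma first_iso (beta : {linear copL pr u -> copL pr v}) :
  is_matrix_map beta (fun l => cop_coord (f1 l)) ->
  exists (phi : {linear copL_gmod pr u 1 -> copL_gmod pr w 1})
         (psi : {linear copL_gmod pr w 1 -> copL_gmod pr u 1}),
  [/\ forall b, d1 (phi b) = beta b, cancel phi psi, cancel psi phi,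
      degree0 phi & degree0 psi].
Proof.
move=> hb; apply: (head_iso I_homog I_quot (A := copL_gmod pr w 1) (alpha := d1) (beta := beta)).
- exact: (copL_graded I_homog I_quot w 1).
- exact: copL_projective.
- exact: copL_fin_gen.
- exact: start_inj.
- by move=> b db; exact: (matrix_map_inj I_sub I_quot hb f1_deg f1_direct f1_cancel db).
- move=> j; apply: (matrix_map_span I_homog I_quot d1_matrix_map hb f1_entry).
  exact: copL_deg_eps.
- by move=> a; exact: (matrix_map_span I_homog I_quot hb d1_matrix_map entry_f1).
Qed.

(** [cc_rel] puts the columns of [e2], moved by [phi], into the kernel of [d1], which is the image
    of [e 1]; [cc_all] says that they exhaust the image in degree 2. Both maps being injective
    there, [head_iso] applies. *)
Lemma second_iso (beta : {linear copL pr u -> copL pr v})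
    (phi : {linear copL_gmod pr u 1 -> copL_gmod pr w 1})
    (psi : {linear copL_gmod pr w 1 -> copL_gmod pr u 1})
    (e2 : {linear copL pr u2 -> copL pr u}) :
  is_matrix_map beta (fun l => cop_coord (f1 l)) ->
  is_matrix_map e2 (fun j => cop_coord (cc j)) ->
  (forall b, d1 (phi b) = beta b) -> cancel phi psi -> cancel psi phi ->
  degree0 phi -> degree0 psi ->
  exists (phi2 : {linear copL_gmod pr u2 2 -> T 0%N}) (psi2 : {linear T 0%N -> copL_gmod pr u2 2}),
  [/\ forall b, e 1%N (phi2 b) = phi (e2 b), cancel phi2 psi2, cancel psi2 phi2,
      degree0 phi2 & degree0 psi2].
Proof.
move=> hb he2 ephi phiK psiK dphi dpsi.
have [_ [gp [_ he] _ _ hk] _ fg] := res.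
have e1e0 a : d1 (e 1%N a) = 0.
  exact: etrans (esym (e_d1 (e 1%N a))) (proj2 (hk 0%N (e 1%N a)) (ex_intro _ a (erefl _))).
apply: (head_iso I_homog I_quot (A := T 0%N) (X := copL pr w) (alpha := e 1%N)
  (beta := phi \o e2)).
- exact: (proj1 (gp 2%N)).
- exact: (proj2 (gp 2%N)).
- exact: (fg 2%N).
- by move=> a; exact: (differential_inj (n := 1)).
- move=> b db /= h; apply: (matrix_map_inj I_sub I_quot he2 cc_deg cc_direct cc_cancel db).
  exact: (linear_can_eq0 phiK h).
- move=> j; pose y := e2 (eps (fun i => pr (vtx k (u2 i))) j); have yE l : cop_coord y l = pr (cop_coord (cc j) l).
    exact: (matrix_map_eps j l he2).
  have dy : copL_deg 1 2 y by move=> l; rewrite yE; exists (cop_coord (cc j) l).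
  have [z ez] : exists z, e 1%N z = phi y.
    apply: (proj1 (hk 0%N (phi y))); rewrite [LHS]e_d1 [LHS]ephi; apply: cop_eqP => i; rewrite coord0 (proj2 hb).
    under eq_bigr => l _ do rewrite yE -rmorphM.
    by rewrite -rmorph_sum; apply/(pr_eq0 I_quot).
  have [z' [dz ez']] := graded_preimage (e := e 1%N) (proj1 (gp 2%N)) (proj1 (gp 1%N))
    (he 1%N) (dphi 2 y dy) (esym ez).
  by exists z'; split; [exact: dz | exact: (esym ez')].
move=> a da; pose y := psi (e 1%N a).
have dy : copL_deg 1 2 y by apply: dpsi; exact: (he 1%N).
have hr l : exists r, pa_deg 1 r /\ pr r = cop_coord y l.
  by have [r dr er] := dy l; exists r.
have [r rP] := choice hr; pose z l := vtx k (u l) * r l.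
have zy l : pr (z l) = cop_coord y l by rewrite rmorphM (rP l).2 coord_id.
(* The lifts [z] of the coordinates of [y] have degree 1, and they form a relation modulo I because
   [d1] kills the image of [e 1]. *)
have [||i|s hs] := @cc_all z.
- by move=> l; have := pa_degM (@pa_deg_vtx k Q (u l)) (rP l).1; rewrite add0r.
- by move=> l; rewrite /z mulrA vtxMM.
- apply/(pr_eq0 I_quot); rewrite rmorph_sum.
  rewrite -[RHS](coord0 (fun i => pr (vtx k (v i))) i) -(e1e0 a) -(psiK (e 1%N a)) ephi (proj2 hb).
  by apply: eq_bigr => l _; rewrite rmorphM zy.
exists (lincomb pr u2 s); split; first exact: (lincomb_deg I_homog I_quot).
have ey : e2 (lincomb pr u2 s) = y.
  by apply: cop_eqP => l; rewrite (matrix_map_lincomb _ _ he2) -zy hs.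
exact: (etrans (congr1 phi ey) (psiK (e 1%N a))).
Qed.

(** By [coprod_quotient] the two quotients may be taken to be coproducts of vertex modules over
    Lambda, where the maps become matrices with columns f^1 and the coefficient vectors of f^2. *)
Lemma quotient_presentation : exists (P1 P2 : lmodType L^c)
    (q1 : {linear rspan f1 -> restr pr P1}) (q2 : {linear rspan f2 -> restr pr P2})
    (e1 : {linear P1 -> ker d0}) (e2 : {linear P2 -> P1}),
  [/\ is_coprod_quotient I q1, is_coprod_quotient I q2,
      forall x, reduces_to (val x) (val (e1 (q1 x))),
      forall x y, val x = val y -> e2 (q2 x) = q1 y &
      linear_resolution_start pr (M := syzygy d0)
        (P0 := coprod_quotient_gmod q1 0) (P1 := coprod_quotient_gmod q2 1) e2 e1].
Proof.
have [q1 [q1P q1E q1d]] := coprod_quotient I_homog I_quot f1_unif f1_direct f1_cancel.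
have [q2 [q2P q2E q2d]] := coprod_quotient I_homog I_quot f2_unif f2_direct f2_cancel.
have [beta betaE] := matrix_lift pr u (v := v) (E := fun l => cop_coord (f1 l))
  (fun l => coord_id (f1 l)).
have [e2 e2E] := matrix_lift pr u2 (v := u) (E := fun j => cop_coord (cc j))
  (fun j => coord_id (cc j)).
have f1_w l i : cop_coord (f1 l) i * vtx k (u l) = cop_coord (f1 l) i.
  by rewrite -coordM f1_unif.
have cc_w j l : cop_coord (cc j) l * vtx k (u2 j) = cop_coord (cc j) l.
  by rewrite -coordM cc_unif.
have hb : is_matrix_map beta (fun l => cop_coord (f1 l)) := conj f1_w betaE.
have he2 : is_matrix_map e2 (fun j => cop_coord (cc j)) := conj cc_w e2E.
have [phi [psi [ephi phiK psiK dphi dpsi]]] := first_iso hb.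
have [phi2 [psi2 [ephi2 phi2K psi2K dphi2 dpsi2]]] :=
  second_iso hb he2 ephi phiK psiK dphi dpsi.
have bker x : beta x \in ker_pred d0.
  by rewrite unfold_in; apply/eqP/start_ker; exists (phi x).
have [e1 e1E] : exists e1 : {linear copL pr u -> ker d0}, forall x, val (e1 x) = beta x.
  have [e1 h] := cop_lift (fun l => pr (vtx k (u l)))
    (fun l => Submod (bker (eps (fun l => pr (vtx k (u l))) l)) : ker d0).
  exists e1 => x; rewrite h [in RHS](cop_eps (vtxL_idem pr u) x).
  rewrite [LHS]linear_sum [RHS]linear_sum.
  by apply: eq_bigr => l _; rewrite [LHS]linear_ract [RHS]linear_ract.
exists (copL pr u), (copL pr u2), q1, q2, e1, e2; split.
- exact: q1P.
- exact: q2P.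
- move=> x i; have [r er] : exists r, val x = \sum_l ract (f1 l) (r l).
    by apply/rspan_fin; apply/mem_rspan; exact: (valP x).
  rewrite e1E betaE er coord_sum rmorph_sum; apply: eq_bigr => l _.
  by rewrite (q1E x r l er) -rmorphM coordM mulrA f1_w.
- move=> x y exy; have [r er] : exists r, val x = \sum_j ract (f2 j) (r j).
    by apply/rspan_fin; apply/mem_rspan; exact: (valP x).
  have ey : val y = \sum_l ract (f1 l) (\sum_j cop_coord (cc j) l * r j).
    by rewrite -exy er; exact: ract_sum_sum.
  apply: cop_eqP => l; rewrite e2E (q1E y _ l ey).
  under [LHS]eq_bigr => j _ do rewrite (q2E x r j er).
  apply: (rmorph_sum_corner pr r) => j; last exact: cc_w.
  exact: coord_id.
suff : linear_resolution_start pr (M := syzygy d0)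
    (P0 := copL_gmod pr u 0) (P1 := copL_gmod pr u2 1) e2 e1.
  rewrite /coprod_quotient_gmod /copL_gmod.
  have := q1d 0; have := q2d 1; rewrite /gdeg /coprod_quotient_gmod => -> ->.
  by [].
(* The comparison isomorphisms have the generators in degrees 1 and 2; for the syzygy, with degrees
   lowered by 1, they are in degrees 0 and 1. *)
have shift1 x d : copL_deg (pr := pr) (v := u) 0 d x <-> copL_deg 1 (d + 1) x.
  by rewrite /copL_deg subr0 addrK.
have shift2 x d : copL_deg (pr := pr) (v := u2) 1 d x <-> copL_deg 2 (d + 1) x.
  have ed : d + 1 - 2 = d - 1 :> int by rewrite -addrA.
  by rewrite /copL_deg ed.
apply: (syzygy_resolution I_homog I_quot res (K := syzygy d0)
  (B1 := copL_gmod pr u 0) (B2 := copL_gmod pr u2 1) (e1 := e1) (e2 := e2)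
  (iota := val : {linear ker d0 -> copL pr v}) (phi1 := phi) (psi1 := psi)
  (phi2 := phi2) (psi2 := psi2)).
- exact: val_inj.
- by [].
- move=> x; split=> [/eqP hx|[y <-]]; last by apply/eqP; exact: (valP y).
  by exists (Submod (hx : x \in ker_pred d0)).
- exact: phiK.
- exact: psiK.
- exact: phi2K.
- exact: psi2K.
- move=> d x; split=> [/shift1/dphi //|hx]; apply/shift1.
  by rewrite -(phiK x); exact: dpsi.
- move=> d x; split=> [/shift2/dphi2 //|hx]; apply/shift2.
  by rewrite -(phi2K x); exact: dpsi2.
- by move=> x; rewrite [RHS]e_d1 [RHS]ephi; exact: e1E.
- by move=> x; exact: esym (ephi2 x).
- exact: (copL_graded I_homog I_quot u 0).
- exact: copL_projective.
- exact: copL_fin_gen.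
- exact: (copL_graded I_homog I_quot u2 1).
- exact: copL_projective.
- exact: copL_fin_gen.
Qed.

End SecondSyzygies.

(** * From the program output to the second syzygies *)

Section SyzygyRows.
Variables (k : fieldType) (Q : quiver) (I : pathalg k Q -> Prop) (lt : rel (qpath Q)).
Variables (t0 t1 : nat) (v : 'I_t0 -> Q) (f1 : 'I_t1 -> copR k v) (u : 'I_t1 -> Q).
Variables (b : 'I_t1 -> 'I_t0 * qpath Q) (F : seq (seq (terms k Q))) (gens : seq (terms k Q)).
Local Notation PA := (pathalg k Q).
Local Notation pot := (@pa_of_terms k Q).
Hypothesis adm : admissible lt.
Hypothesis f1_deg : forall l i, pa_deg 1 (cop_coord (f1 l) i).
Hypothesis f1_unif : forall l, ract (f1 l) (vtx k (u l)) = f1 l.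
Hypothesis f1_tip : forall l, is_tip lt (f1 l) (b l).
Hypothesis f1F : forall (l : 'I_t1) i, cop_coord (f1 l) i = pot (nth [::] (nth [::] F l) i).
Hypotheses (F_size : size F = t1) (F_rows : forall x, x \in F -> size x = t0).
Hypothesis gens_deg : forall g, g \in gens -> pa_deg 2 (pot g).
Hypothesis gens_I : forall x, I x <-> ideal_gen (fun y => exists2 g, g \in gens & y = pot g) x.
Local Notation V := [seq vertex_path x | x <- enum Q].
Local Notation ars := [seq arrow_path a | a <- enum (arrow Q)].
Local Notation C := (syzygies lt V ars gens [seq v i | i <- enum 'I_t0] F).

(** The sums of the f^1_l z_l with linear z_l have degree 2, where membership in I and [rel2]
    coincide; so the specification of the elimination becomes one about I. *)
Lemma second_syzygies : (forall x, x \in C -> size x = t1) /\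
  exists (cc : 'I_(size C) -> copR k u) (u2 : 'I_(size C) -> Q),
  [/\ (forall (j : 'I_(size C)) l, cop_coord (cc j) l = pot (nth [::] (nth [::] C j) l)) /\
        (forall j l, pa_deg 1 (cop_coord (cc j) l)),
      forall j, ract (cc j) (vtx k (u2 j)) = cc j,
      direct_family cc /\ (forall j r, ract (cc j) r = 0 -> vtx k (u2 j) * r = 0),
      forall j i, I (\sum_l cop_coord (f1 l) i * cop_coord (cc j) l) &
      forall z : 'I_t1 -> PA, (forall l, pa_deg 1 (z l)) ->
        (forall l, vtx k (u l) * z l = z l) -> (forall i, I (\sum_l cop_coord (f1 l) i * z l)) ->
        exists s : 'I_(size C) -> k, forall l, z l = \sum_j s j *: cop_coord (cc j) l].
Proof.
have lt_order : strict_well_order lt by case: adm.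
pose famv l : {ffun 'I_t0 -> PA} := [ffun i => cop_coord (f1 l) i].
have sv : size [seq v i | i <- enum 'I_t0] = t0 by rewrite size_map size_enum_ord.
have fvF (l : 'I_t1) : fv t0 (nth [::] F l) = famv l.
  by apply/ffunP => i; rewrite !ffunE f1F.
have famd l : fam_deg 1 (famv l) by move=> i; rewrite ffunE.
have famu l i : famv l i * vtx k (u l) = famv l i by rewrite ffunE -coordM f1_unif.
have fam0 l : famv l <> 0.
  move=> h; have [/negP[]] := f1_tip l; apply/eqP.
  have := congr1 (fun x : {ffun 'I_t0 -> PA} => x (b l).1) h.
  by rewrite /famv !ffunE => ->; exact: coef0.
have [c1 [bs [sb ub tb]] c3] := syzygiesP_cast lt_order (@arrow_paths_uniq Q)
  (@mem_arrow_paths Q) (@mem_vertex_paths Q) gens_deg sv F_size fvF F_rows famd famu fam0.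
have spanC x : x \in C -> [/\ fam_deg 1 (fv t1 x), forall l, vtx k (u l) * fv t1 x l = fv t1 x l &
    forall i, rel2 V gens (\sum_l famv l i * fv t1 x l)].
  by move=> xC; apply/c3; apply: inspan_mem; apply: map_f.
have uC x : x \in C -> forall l, vtx k (u l) * fv t1 x l = fv t1 x l.
  by move=> /spanC[].
split; first by move=> x /c1[].
have [cc [u2 [b2 [ccE cd cu ct bi]]]] := row_family (erefl (size C)) c1 uC sb ub tb.
have [_ nd] := tip1_ndiv cd ct bi.
exists cc, u2; split.
- by split=> [j l|]; [rewrite ccE ffunE | exact: cd].
- exact: cu.
- split; first exact: (tip_direct adm cu ct nd).
  by move=> j r; exact: (fam_cancel adm cu ct).
- move=> j i; apply/gens_I; apply: rel2_ideal.
  have [_ _ /(_ i)] := spanC _ (mem_nth [::] (ltn_ord j)).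
  by under eq_bigr => l _ do rewrite ffunE -ccE.
move=> z dz uz Iz; pose zf : {ffun 'I_t1 -> PA} := [ffun l => z l].
have : inspan (map (fv t1) C) zf.
  apply/c3; split=> [l|l|i]; [by rewrite ffunE | by rewrite ffunE uz |].
  have -> : \sum_l famv l i * zf l = \sum_l cop_coord (f1 l) i * z l.
    by apply: eq_bigr => l _; rewrite !ffunE.
  apply: (ideal_rel2 gens_deg); first by apply/gens_I; exact: Iz.
  apply: pa_deg_sum => l _.
  by have := pa_degM (@f1_deg l i) (dz l).
move=> /(inspan_comb_ord (size_map _ _))[s hs]; exists s => l.
have := congr1 (fun x : {ffun 'I_t1 -> PA} => x l) hs; rewrite ffunE => ->.
rewrite sum_ffunE; apply: eq_bigr => j _; rewrite ccE [LHS]ffunE.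
by rewrite (nth_map [::]) ?ltn_ord.
Qed.

End SyzygyRows.

Lemma map_nth_ord (T : Type) (x0 : T) (s : seq T) n : size s = n ->
  s = [seq nth x0 s i | i : 'I_n <- enum 'I_n].
Proof.
move=> sn; apply: (@eq_from_nth _ x0); first by rewrite size_map size_enum_ord.
move=> i; rewrite sn => lt.
by rewrite (nth_map (Ordinal lt)) ?size_enum_ord // nth_enum_ord.
Qed.

Lemma enc_matrixE (k : fieldType) (Q : quiver) n m (X : seq (seq (terms k Q))) :
  size X = n -> (forall x, x \in X -> size x = m) ->
  enc_seq (enc_seq (@enc_terms k Q)) X =
  enc_matrix (fun (i : 'I_n) (j : 'I_m) => nth [::] (nth [::] X i) j).
Proof.
move=> sn sm; rewrite /enc_matrix /enc_fam [LHS](congr1 _ (map_nth_ord [::] sn)).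
elim: (enum 'I_n) => //= i s ->; congr Node.
have im : nth [::] X i \in X by rewrite mem_nth ?sn.
exact: congr1 (map_nth_ord [::] (sm _ im)).
Qed.

Theorem theorem6p1 :
  exists A : prog,
  forall (k : fieldType) (Q : quiver) (I : pathalg k Q -> Prop)
    (L : pzRingType) (pr : {rmorphism pathalg k Q -> L}) (M : gmod L)
    (t0 t1 : nat) (v : 'I_t0 -> Q) (w : 'I_t1 -> Q)
    (d0 : {linear copL pr v -> M}) (d1 : {linear copL pr w -> copL pr v})
    (mx : 'I_t1 -> 'I_t0 -> terms k Q) (lt : rel (qpath Q)),
  (forall x, I x -> ideal_prod (@arrow_ideal k Q) (@arrow_ideal k Q) x) ->
  (exists S : pathalg k Q -> Prop,
     (forall g, S g -> exists n : nat, pa_deg n%:Z g) /\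
     forall x, I x <-> ideal_gen S x) ->
  is_quotient_ring I pr ->
  koszul pr ->
  linear_module pr M ->
  (0 < t0)%N -> (0 < t1)%N ->
  linear_resolution_start pr (M := M)
    (P0 := copL_gmod pr v 0) (P1 := copL_gmod pr w 1) d1 d0 ->
  is_matrix d1 mx ->
  admissible lt ->
  exists (f1 : 'I_t1 -> copR k v) (U1 : eqType) (f1' : U1 -> copR k v),
    (exists pi : {linear copR k v -> restr pr M},
      [/\ forall x y, reduces_to (pr := pr) x y -> pi x = d0 y,
          forall m, exists x, pi x = m,
          forall x, pi x = 0 <-> exists y : rspan (sum_family f1 f1'), val y = x,
          direct_family (sum_family f1 f1') &
          projective (copR k v) /\ projective (rspan (sum_family f1 f1'))] /\
      [/\ right_tip_reduced lt f1, right_tip_reduced lt f1',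
          forall l i, linear_elt (cop_coord (f1 l) i) &
          forall j i, I (cop_coord (f1' j) i)]) /\
    (forall gens : seq (terms k Q),
      (forall g, g \in gens -> pa_deg 2 (pa_of_terms g)) ->
      (forall x, I x <->
         ideal_gen (fun y => exists2 g, g \in gens & y = pa_of_terms g) x) ->
      exists (F : 'I_t1 -> 'I_t0 -> terms k Q)
             (n : nat) (c : 'I_n -> 'I_t1 -> terms k Q) (f2 : 'I_n -> copR k v),
        [/\ run lt A (enc_input gens v w mx) (Node (enc_matrix F) (enc_matrix c)),
            forall l i, cop_coord (f1 l) i = pa_of_terms (F l i),
            forall j l, linear_elt (pa_of_terms (c j l)),
            forall j, f2 j = \sum_l f1 l ** pa_of_terms (c j l) &
            direct_family f2] /\
        exists (P1 P2 : lmodType L^c)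
               (q1 : {linear rspan f1 -> restr pr P1})
               (q2 : {linear rspan f2 -> restr pr P2})
               (e1 : {linear P1 -> ker d0}) (e2 : {linear P2 -> P1}),
          [/\ is_coprod_quotient I q1, is_coprod_quotient I q2,
              forall x, reduces_to (val x) (val (e1 (q1 x))),
              forall x y, val x = val y -> e2 (q2 x) = q1 y &
              linear_resolution_start pr (M := syzygy d0)
                (P0 := coprod_quotient_gmod q1 0)
                (P1 := coprod_quotient_gmod q2 1) e2 e1]).
Proof.
exists SyzygyProgram => k Q I L pr M t0 t1 v w d0 d1 mx lt I_sub I_homog I_quot _ _ _ _.
move=> [T [e [e_d1 res]]] mat adm.
have d1_inj := start_inj I_homog I_quot e_d1 res.
have d0_ker := start_ker e_d1 res.
have sF := F_size I_sub I_quot d1_inj mat adm.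
have [f1 [u [b [f1F [fd fu] [ft bi] ef fe]]]] := first_syzygies_aux mat adm sF.
have fdir := f1_direct adm fd fu ft bi.
have fcan := f1_cancel adm fu ft.
have [pi piE] := pi_exists d0.
have [U1 [f1' [hker hdir hproj hred hI]]] :=
  presentation I_sub I_homog I_quot d0_ker mat adm fd fu ft bi ef fe piE.
exists f1, U1, f1'; split.
  exists pi; split; split.
  - exact: piE.
  - exact: (pi_surj I_quot (start_surj res) piE).
  - exact: hker.
  - exact: hdir.
  - split; last exact: hproj.
    exact: (projective_cop (fun i => vtxMM k (v i))).
  - exact: (f1_reduced adm fd fu ft bi).
  - exact: hred.
  - exact: fd.
  - exact: hI.
move=> gens gens_deg gens_I.
have rF := F_rows mat adm.
have [rC [cc [u2 [[ccE cd] cu [cdir ccan] crel call]]]] :=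
  second_syzygies adm fd fu ft f1F sF rF gens_deg gens_I.
pose ars := [seq arrow_path a | a <- enum (arrow Q)].
pose F := echelon lt (sort_paths lt ars) [seq [seq mx l i | i <- enum 'I_t0] | l <- enum 'I_t1].
pose C := syzygies lt [seq vertex_path x | x <- enum Q] ars gens [seq v i | i <- enum 'I_t0] F.
exists (fun l i => nth [::] (nth [::] F l) i), (size C).
exists (fun j l => nth [::] (nth [::] C j) l), (f2 f1 cc); split.
  split.
  - rewrite -(enc_matrixE sF rF) -(enc_matrixE (erefl _) rC).
    exact: run_syzygy_program.
  - exact: f1F.
  - by move=> j l; rewrite -ccE; exact: cd.
  - by move=> j; apply: eq_bigr => l _; exact: (congr1 (ract (f1 l)) (ccE j l)).
  exact: (f2_direct fdir fcan cdir).
exact: (quotient_presentation I_sub I_homog I_quot e_d1 res mat fd fu fdir fcan ef fe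
  cd cu cdir ccan crel call).
Qed.
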